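(* There exist universal constants $c_3,c_4>0$ such that the following holds. Let $\alpha,\beta>0$. There exists an integer $N_{\alpha,\beta}>0$ such that for all $d>N_{\alpha,\beta}$, all $L,m>0$ with $3\le \kappa:=L/m\le\alpha d^\beta$, all $M\ge 12$ and all $\epsilon\in(0,1)$, $$\mathfrak T(d,L,m,\epsilon,M)\ge\frac{c_3\,\kappa\sqrt d}{\max\{\log\kappa,\log d\}^3}\log\Big(\frac{c_4}{\epsilon}\Big).$$
   Context: Let $\mathcal A_{d,L,m}$ be the set of probability densities on $\mathbb R^d$ of the form $\pi\propto e^{-f}$ with $f$ twice differentiable, $L$-smooth (i.e. $f(y)\le f(x)+\nabla f(x)^\top(y-x)+\frac L2\|y-x\|_2^2$ for all $x,y$) and $m$-strongly convex (i.e. $f(y)\ge f(x)+\nabla f(x)^\top(y-x)+\frac m2\|y-x\|_2^2$ for all $x,y$). MALA with step size $h>0$ targeting $\pi\propto e^{-f}$: from the current state $x$, draw $y\sim\mathcal N(x-h\nabla f(x),2hI_d)$ and move to $y$ with probability $\min\{1,\frac{\pi(y)Q(y,x)}{\pi(x)Q(x,y)}\}$, where $Q(x,\cdot)$ is the density of $\mathcal N(x-h\nabla f(x),2hI_d)$; otherwise stay at $x$. $\mu_n$ is the law after $n$ steps from initial law $\mu_0$. $\mu_0$ is $M$-warm if $\mu_0(S)\le M\pi(S)$ for all Borel $S$. $\tau_{TV}(\epsilon,\mu_0)=\inf\{n:\sup_S|\mu_n(S)-\pi(S)|\le\epsilon\}$ (for the MALA chain with step size $h$ and target $\pi$). The minimax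 mixing time is $$\mathfrak T(d,L,m,\epsilon,M)=\min_{h>0}\ \max_{\pi\in\mathcal A_{d,L,m}}\ \max_{\mu_0\ M\text{-warm}}\ \tau_{TV}(\epsilon,\mu_0).$$ *)

(* Defs.v *)
From HB Require Import structures.
From mathcomp Require Import all_boot all_order all_algebra.
From mathcomp Require Import all_classical all_reals all_analysis.

Set Implicit Arguments.
Unset Strict Implicit.
Unset Printing Implicit Defensive.

Import Order.TTheory GRing.Theory Num.Theory.
Import numFieldNormedType.Exports.
Local Open Scope classical_set_scope.
Local Open Scope ring_scope.

Section MALA.
Variables (R : realType) (d : nat).

Definition Rd := 'rV[R]_d.

Definition Borel : measurableType _ := g_sigma_algebraType (@open Rd).

Definition dotv (u v : Rd) : R := \sum_(i < d) u ord0 i * v ord0 i.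
Definition sqnorm (u : Rd) : R := dotv u u.

Definition grad (f : Rd -> R) (x : Rd) : Rd :=
  \row_(i < d) ('d f x (delta_mx ord0 i : Rd)).

Definition twice_differentiable (f : Rd -> R) : Prop :=
  (forall x, differentiable f x) /\ (forall x, differentiable (grad f) x).

Definition L_smooth (L : R) (f : Rd -> R) : Prop :=
  forall x y, f y <= f x + dotv (grad f x) (y - x) + L / 2 * sqnorm (y - x).

Definition strongly_convex (m : R) (f : Rd -> R) : Prop :=
  forall x y, f y >= f x + dotv (grad f x) (y - x) + m / 2 * sqnorm (y - x).

(* the potentials f of the class A_{d,L,m} (pi propto exp(-f)) *)
Definition classA (L m : R) (f : Rd -> R) : Prop :=
  twice_differentiable f /\ L_smooth L f /\ strongly_convex m f.

Definition box (a b : Rd) : set Borel :=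
  [set x | forall i, a ord0 i <= x ord0 i <= b ord0 i].

Definition is_lebesgue (lam : set Borel -> \bar R) : Prop :=
  forall a b : Rd, (forall i, a ord0 i <= b ord0 i) ->
    lam (box a b) = (\prod_(i < d) (b ord0 i - a ord0 i))%:E.

Variable lam : set Borel -> \bar R.

Definition Zconst (f : Rd -> R) : \bar R :=
  (\int[lam]_(x in setT) (expR (- f x))%:E)%E.

Definition pi_density (f : Rd -> R) (x : Rd) : R :=
  expR (- f x) / fine (Zconst f).

Definition target (f : Rd -> R) (S : set Borel) : \bar R :=
  (\int[lam]_(x in S) (pi_density f x)%:E)%E.

(* density Q(x, y) of N(x - h grad f(x), 2h I_d) *)
Definition proposal (h : R) (f : Rd -> R) (x y : Rd) : R :=
  powR (4 * pi * h) (- (d%:R / 2)) *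
  expR (- sqnorm (y - x + h *: grad f x) / (4 * h)).

Definition accept (h : R) (f : Rd -> R) (x y : Rd) : R :=
  Order.min 1 ((pi_density f y * proposal h f y x) /
               (pi_density f x * proposal h f x y)).

Definition mala_kernel (h : R) (f : Rd -> R) (x : Rd) (S : set Borel) : \bar R :=
  (\int[lam]_(y in S) (proposal h f x y * accept h f x y)%:E
   + (1 - \int[lam]_(y in setT) (proposal h f x y * accept h f x y)%:E)
     * (\1_S x)%:E)%E.

Fixpoint mala_law (h : R) (f : Rd -> R) (mu0 : set Borel -> \bar R) (n : nat)
  : set Borel -> \bar R :=
  match n with
  | 0 => mu0
  | n'.+1 => fun S => (\int[mala_law h f mu0 n']_(x in setT) mala_kernel h f x S)%E
  end.

Definition warm (M : R) (f : Rd -> R) (mu0 : set Borel -> \bar R) : Prop :=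
  forall S : set Borel, measurable S -> (mu0 S <= M%:E * target f S)%E.

Definition tv_le (eps : R) (mu nu : set Borel -> \bar R) : Prop :=
  forall S : set Borel, measurable S -> (`|mu S - nu S| <= eps%:E)%E.

Definition tau_TV (h : R) (f : Rd -> R) (eps : R) (mu0 : set Borel -> \bar R)
  : \bar R :=
  ereal_inf [set (n%:R)%:E | n in [set n : nat | tv_le eps (mala_law h f mu0 n) (target f)]].

Definition minimax_mixing (L m eps M : R) : \bar R :=
  ereal_inf [set
    ereal_sup [set
      ereal_sup [set tau_TV h f eps (mu0 : set Borel -> \bar R)
                | mu0 in [set mu0 : probability Borel R | warm M f mu0]]
    | f in [set f : Rd -> R | classA L m f]]
  | h in [set h : R | 0 < h]].

End MALA.

(* Main.v *)
Require Import Defs.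
From HB Require Import structures.
From mathcomp Require Import all_boot all_order all_algebra.
From mathcomp Require Import all_classical all_reals all_analysis.
From mathcomp Require Import measurable_realfun ring lra.

(** Start MALA from the density [1 + g] relative to the target, where [|g| <= 1]
    and [g] has mean [0]. By reversibility the law after [n] steps has relative
    density [1 + P^n g], and [|P^n g|^2] is log-convex in [n], so that it decays at
    most at its initial rate. Hence if [<g, P g> >= (1 - delta) |g|^2], mixing takes
    of the order of [1 / delta] steps. The target is a product with potential
    [sum_i phi (x_i)], [phi x = a / 2 * x ^ 2 + A * cos (x / sqrt h)], and [g] is the
    function [sin (sqrt a * x_0)] of the first coordinate. With
    [La = max (ln kappa, ln d)], the adversary depends on the step size [h]:
    - if [L h <= La ^ 3 / sqrt d], take [a = m], [A = 0]: moves of variance [O(h)]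
      along a coordinate of variance [1 / m] give [delta = O(h m)];
    - if [La ^ 3 / sqrt d < L h <= 1 / 10000], take [a = 2 L / 3], [A = L h / 3]: the
      acceptance probability is at most the [d]-th power of the affinity of the
      forward and backward one-dimensional joint densities. The cosine oscillates at
      the scale of the proposal, so this affinity is at most [1 - c (L h) ^ 2], and
      [delta] is of order [exp (- c (L h) ^ 2 d) <= exp (- c La ^ 6)];
    - if [L h > 1 / 10000], take [a = L], [A = 0]: the affinity is
      [(1 + (L h) ^ 3 / 8) ^ (- 1 / 2)], bounded away from [1]. *)

Set Implicit Arguments.
Unset Strict Implicit.
Unset Printing Implicit Defensive.

Import Order.TTheory GRing.Theory Num.Theory.
Import numFieldNormedType.Exports.
Local Open Scope classical_set_scope.
Local Open Scope ring_scope.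

(** The acceptance probability couples all coordinates, so even for a product target the Dirichlet
    form does not factor. What factors are two majorants of the flow of accepted moves: the flow of
    proposals, and the geometric mean of the forward and backward flows of proposals, which
    dominates their minimum. As [g] depends on one coordinate, each majorant leaves only integrals
    over pairs of reals. Gaussian targets alone do not suffice: their affinity differs from [1] at
    order [(L h) ^ 3], which [d] coordinates make visible only from [L h] of order [d ^ (- 1 / 3)]
    on. The cosine produces a defect of order [(L h) ^ 2], visible down to [d ^ (- 1 / 2)] up to
    logarithms. The regimes then match. For small steps [delta] is at most of order
    [La ^ 3 / (kappa * sqrt d)]. Beyond the cutoff [delta] is at most a multiple of
    [exp (- 3 / 2 * La)], and [exp (3 / 2 * La) >= kappa * sqrt d] because [La] bounds both
    logarithms. *)

Section eq_measurable_integral.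
Local Open Scope ereal_scope.
Context d (T : measurableType d) (R : realType).
Import HBNNSimple.

(* [mala_law] is only a set function, whence no measure structure here. *)
Lemma eq_setfun_integral (m1 m2 : set T -> \bar R) (f : T -> \bar R) :
  (forall A, measurable A -> m1 A = m2 A) ->
  \int[m1]_x f x = \int[m2]_x f x.
Proof.
move=> m12; have E (h : {nnsfun T >-> R}) : sintegral m1 h = sintegral m2 h.
  by apply: eq_fsbigr => r _; rewrite m12.
rewrite /integral; congr (ereal_sup _ - ereal_sup _);
  by apply/seteqP; split => _ [h hf <-]; exists h.
Qed.

End eq_measurable_integral.

(** * Measures given by a density *)

Section density.
Local Open Scope ereal_scope.
Context d (T : measurableType d) (R : realType) (mu : {measure set T -> \bar R}).
Variables (w : T -> R) (mw : measurable_fun setT w) (w0 : forall x, (0 <= w x)%R).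

(** The two proofs are arguments so that the measure structure declared below can be inferred from
    the term alone. *)
Definition density_measure of measurable_fun setT w & (forall x, (0 <= w x)%R) :=
  fun S : set T => \int[mu]_(x in S) (w x)%:E.

Local Notation nu := (density_measure mw w0).

Let nu0 : nu set0 = 0. Proof. by rewrite /density_measure integral_set0. Qed.

Let nu_ge0 A : 0 <= nu A.
Proof. by apply: integral_ge0 => x _; rewrite lee_fin. Qed.

Let nu_sigma_additive : semi_sigma_additive nu.
Proof.
move=> /= A mA tA mUA; rewrite /density_measure ge0_integral_bigcup//.
- by apply: is_cvg_ereal_nneg_natsum_cond => n _ _; exact: nu_ge0.
- exact/measurable_EFinP/measurable_funTS.
- by move=> x _; rewrite lee_fin.
Qed.

HB.instance Definition _ := isMeasure.Build _ _ _ nu nu0 nu_ge0 nu_sigma_additive.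

Import HBNNSimple.

(** Both sides pass to the limit along an increasing sequence of simple functions, for which the
    identity is linearity over the level sets. *)
Lemma ge0_integral_density (f : T -> \bar R) :
  measurable_fun setT f -> (forall x, 0 <= f x) ->
  \int[nu]_x f x = \int[mu]_x (f x * (w x)%:E).
Proof.
move=> mf f0; pose h := nnsfun_approx measurableT mf.
have cvh x : (EFin \o h^~ x) @ \oo --> f x by exact: cvg_nnsfun_approx.
have ndh x : {homo h^~ x : a b / (a <= b)%N >-> (a <= b)%R}.
  by move=> a b ab; exact/lefP/nd_nnsfun_approx.
have mEw : measurable_fun setT (EFin \o w) by exact/measurable_EFinP.
transitivity (limn (fun n => \int[nu]_x (h n x)%:E)).
  rewrite -monotone_convergence//.
  - by apply: eq_integral => y _; apply/esym/cvg_lim => //; exact: cvh.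
  - by move=> n; exact/measurable_EFinP.
  - by move=> n x _; rewrite lee_fin.
  - by move=> x _ a b ab; rewrite lee_fin; exact: ndh.
transitivity (limn (fun n => \int[mu]_x ((h n x)%:E * (w x)%:E))); last first.
  rewrite -monotone_convergence//.
  - apply: eq_integral => y _; apply/cvg_lim => //.
    by apply: cvgeZr => //; exact: cvh.
  - move=> n; apply: emeasurable_funM => //.
    exact/measurable_EFinP.
  - by move=> n x _; rewrite -EFinM lee_fin mulr_ge0.
  - by move=> x _ a b ab; rewrite -!EFinM lee_fin ler_wpM2r//; exact: ndh.
congr (limn _); apply/funext => n.
have pre0 r : r \in range (h n) -> (0 <= r)%R.
  by rewrite inE => -[t _ <-].
transitivity (\sum_(r \in range (h n)) r%:E * nu (h n @^-1` [set r])).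
  by rewrite integral_nnsfun// patch_setT sintegralE.
transitivity (\int[mu]_x (\sum_(r \in range (h n))
   (r%:E * ((w x)%:E * (\1_(h n @^-1` [set r]) x)%:E)))).
  rewrite ge0_integral_fsum//.
  - apply: eq_fsbigr => r /pre0 r0.
    rewrite ge0_integralZl//.
    + congr (_ * _); rewrite /density_measure integral_mkcond.
      by apply: eq_integral => x _; rewrite epatch_indic.
    + by apply: emeasurable_funM => //; exact/measurable_EFinP.
    + by move=> x _; rewrite -EFinM lee_fin mulr_ge0.
  - move=> r; apply: emeasurable_funM => //.
    by apply: emeasurable_funM => //; exact/measurable_EFinP.
  - move=> r x _.
    have [r0|r0] := leP 0%R r.
      by rewrite -!EFinM lee_fin !mulr_ge0.
    by rewrite preimage_nnfun0// indic0 !mule0.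
apply: eq_integral => x _.
rewrite [in RHS](fimfunE _ x) -fsumEFin// ge0_mule_fsuml; last first.
  by move=> r; exact: nnfun_muleindic_ge0.
by apply: eq_fsbigr => r _; rewrite EFinM muleAC -muleA.
Qed.

End density.

(** * Expectations of bounded measurable functions *)

Section bounded_measurable.
Context d (T : measurableType d) (R : realType) (mu : probability T R).
Implicit Types u v : T -> R.

(** On a probability space these functions are integrable, and they are closed under products, so
    that no integrability condition has to be tracked along the iterates of the kernel. *)
Definition bmeas u := measurable_fun setT u /\ exists C, forall x, `|u x| <= C.

Local Notation E u := (\int[mu]_x u x).

Lemma bmeas_bounded u : bmeas u -> [bounded u x | x in [set: T]].
Proof.
move=> [_ [C uC]]; exists C; split; first exact: num_real.
by move=> M CM x _; exact: (le_trans (uC x) (ltW CM)).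
Qed.

Lemma bmeas_integrable u : bmeas u -> mu.-integrable setT (EFin \o u).
Proof.
move=> bu; apply: measurable_bounded_integrable => //.
- by rewrite /= probability_setT ltry.
- exact: bu.1.
- exact: bmeas_bounded.
Qed.

Lemma bmeas_cst c : bmeas (cst c).
Proof. by split => //; exists `|c|. Qed.

Lemma bmeas_indic (A : set T) : measurable A -> bmeas \1_A.
Proof.
move=> mA; split; first exact: measurable_indic.
by exists 1 => x; rewrite ger0_norm// indicE lern1 leq_b1.
Qed.

Lemma bmeasM u v : bmeas u -> bmeas v -> bmeas (fun x => u x * v x).
Proof.
move=> [mu_ [C uC]] [mv [D vD]]; split; first exact: measurable_funM.
by exists (C * D) => x; rewrite normrM ler_pM.
Qed.

Lemma bmeasD u v : bmeas u -> bmeas v -> bmeas (fun x => u x + v x).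
Proof.
move=> [mu_ [C uC]] [mv [D vD]]; split; first exact: measurable_funD.
by exists (C + D) => x; rewrite (le_trans (ler_normD _ _))// lerD.
Qed.

Lemma bmeasZ c u : bmeas u -> bmeas (fun x => c * u x).
Proof. by move=> bu; exact: (bmeasM (bmeas_cst c) bu). Qed.

Lemma bmeasB u v : bmeas u -> bmeas v -> bmeas (fun x => u x - v x).
Proof.
move=> bu bv; have := bmeasD bu (bmeasZ (-1) bv).
by congr bmeas; apply/funext => x; rewrite mulN1r.
Qed.

Lemma expectD u v : bmeas u -> bmeas v -> E (fun x => u x + v x) = E u + E v.
Proof. by move=> bu bv; rewrite RintegralD//; exact: bmeas_integrable. Qed.

Lemma expectB u v : bmeas u -> bmeas v -> E (fun x => u x - v x) = E u - E v.
Proof. by move=> bu bv; rewrite RintegralB//; exact: bmeas_integrable. Qed.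

Lemma expectZ c u : bmeas u -> E (fun x => c * u x) = c * E u.
Proof. by move=> bu; rewrite RintegralZl//; exact: bmeas_integrable. Qed.

Lemma le_expect u v : bmeas u -> bmeas v -> (forall x, u x <= v x) -> E u <= E v.
Proof. by move=> bu bv uv; apply: le_Rintegral => //; exact: bmeas_integrable. Qed.

Lemma EFin_expect u : bmeas u -> (E u)%:E = (\int[mu]_x (u x)%:E)%E.
Proof.
by move=> bu; rewrite /Rintegral fineK// integrable_fin_num//; exact: bmeas_integrable.
Qed.

(** The expectation of [(s u + t v) ^ 2] is a nonnegative quadratic form in [s] and [t], evaluated
    at one point if [b = 0] and at another if [b > 0]. *)
Lemma expect_CauchySchwarz u v : bmeas u -> bmeas v ->
  (E (fun x => u x * v x)) ^+ 2 <= E (fun x => u x * u x) * E (fun x => v x * v x).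
Proof.
move=> bu bv.
set a := E (fun x => u x * u x); set b := E (fun x => v x * v x).
set c := E (fun x => u x * v x).
have buu := bmeasM bu bu; have bvv := bmeasM bv bv; have buv := bmeasM bu bv.
have b0 : 0 <= b by apply: Rintegral_ge0 => x _; rewrite -expr2 sqr_ge0.
have H s t : 0 <= s ^+ 2 * a + 2 * (s * t) * c + t ^+ 2 * b.
  rewrite /a /b /c -!expectZ//.
  rewrite -expectD ?bmeasZ//; [|exact: bmeasZ|exact: bmeasZ].
  rewrite -expectD; [|apply: bmeasD; exact: bmeasZ|exact: bmeasZ].
  apply: Rintegral_ge0 => x _.
  by rewrite (_ : _ + _ = (s * u x + t * v x) ^+ 2) ?sqr_ge0//; ring.
have [b_eq0|b_neq0] := eqVneq b 0.
  have c0 : c = 0.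
    apply/eqP/negP => /negP cn0.
    (* With [b = 0] the form is affine in [t], and this [t] brings it to [- 1]. *)
    have := H 1 (- (a + 1) / (2 * c)); rewrite b_eq0 mulr0 addr0 leNgt => /negP; apply.
    rewrite (_ : _ + _ = -1); first by rewrite ltrN10.
    by field.
  by rewrite c0 expr0n/= b_eq0 mulr0.
have bp : 0 < b by rewrite lt_def b_neq0.
have := H b (- c).
rewrite (_ : _ + _ = b * (a * b - c ^+ 2)); last by ring.
by rewrite pmulr_rge0// subr_ge0.
Qed.

End bounded_measurable.
Arguments bmeas_cst {d T R} c.

(** * Reversible Metropolis operators and the decay of the relative density *)

Section symmetric_kernel.
Context d (T : measurableType d) (R : realType) (mu : probability T R).
Variable k : T * T -> R.
Hypothesis mk : measurable_fun setT k.
Hypothesis k0 : forall p, 0 <= k p.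
Hypothesis ksym : forall x y, k (x, y) = k (y, x).
Hypothesis k1 : forall x, (\int[mu]_y (k (x, y))%:E <= 1)%E.
Implicit Types u v : T -> R.

Local Notation E u := (\int[mu]_x u x).
Local Notation ig := (mu.-integrable setT).

(** Markov operator of the chain that jumps with density [k] relative to [mu] and stays put with the
    remaining probability. The symmetry of [k] is detailed balance. *)
Definition metropolis u x :=
  \int[mu]_y (k (x, y) * u y) + (1 - \int[mu]_y k (x, y)) * u x.

Local Notation P := metropolis.

Let mk1 x : measurable_fun setT (fun y => k (x, y)).
Proof. exact: measurableT_comp. Qed.

Let ig_k x : ig (EFin \o (fun y => k (x, y))).
Proof.
apply/integrableP; split; first exact/measurable_EFinP.
under eq_integral do rewrite /= ger0_norm//.
by rewrite (le_lt_trans (k1 x))// ltry.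
Qed.

Let ig_ku x u : bmeas u -> ig (EFin \o (fun y => k (x, y) * u y)).
Proof.
move=> bu.
have := integrableMl measurableT (ig_k x) bu.1 (bmeas_bounded bu).
by apply: eq_integrable => // y _; rewrite /= EFinM.
Qed.

Let ig_prod : (mu \x mu)%E.-integrable setT (EFin \o k).
Proof.
apply/integrable12ltyP; first exact/measurable_EFinP.
apply: (@le_lt_trans _ _ 1%E); last exact: ltry.
rewrite -[leRHS](probability_setT mu) -[leRHS]mul1e -integral_cst//.
apply: ge0_le_integral => //.
- by move=> x _; exact: integral_ge0.
- apply: (measurable_fun_fubini_tonelli_F (fun p => `|(k p)%:E|%E)) => //.
  by apply: measurableT_comp => //; exact/measurable_EFinP.
- move=> x _; under eq_integral do rewrite /= ger0_norm//.
  exact: k1.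
Qed.

Let ig_prod_uv u v : bmeas u -> bmeas v ->
  (mu \x mu)%E.-integrable setT (EFin \o (fun p => v p.1 * (k p * u p.2))).
Proof.
move=> [mu_ [C uC]] [mv [D vD]].
have buv : bmeas (fun p : T * T => v p.1 * u p.2).
  split; first by apply: measurable_funM; exact: measurableT_comp.
  by exists (D * C) => p; rewrite normrM ler_pM.
have := integrableMl measurableT ig_prod buv.1 (bmeas_bounded buv).
by apply: eq_integrable => // y _; rewrite /= -EFinM; congr EFin; ring.
Qed.

Let c x := \int[mu]_y k (x, y).

Let c01 x : 0 <= c x <= 1.
Proof.
rewrite /c; apply/andP; split; first exact: Rintegral_ge0.
rewrite -[leRHS]/(fine 1%E); apply: fine_le => //.
exact: (integrable_fin_num measurableT (ig_k x)).
Qed.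

Let A u x := \int[mu]_y (k (x, y) * u y).

Let mA u : bmeas u -> measurable_fun setT (A u).
Proof.
move=> bu; apply: measurableT_comp => //.
have := ig_prod_uv bu (bmeas_cst 1).
move/measurable_fubini_F; apply: eq_measurable_fun => x _.
by apply: eq_integral => y _ /=; rewrite mul1r.
Qed.

Let cE : c = A (cst 1).
Proof. by apply/funext => x; apply: eq_Rintegral => y _; rewrite mulr1. Qed.

Let AleC u C x : bmeas u -> (forall x, `|u x| <= C) -> `|A u x| <= C * c x.
Proof.
move=> bu uC; rewrite /A.
apply: le_trans (le_normr_Rintegral _ (ig_ku x bu)) _ => //.
rewrite /c -(RintegralZl C measurableT (ig_k x)).
apply: le_Rintegral => //.
- exact: integrable_norm (ig_ku x bu).
- by have := integrableZl measurableT C (ig_k x); apply: eq_integrable.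
- by move=> y _; rewrite normrM (ger0_norm (k0 _)) mulrC ler_wpM2r.
Qed.

Lemma metropolis_le u C x : bmeas u -> (forall x, `|u x| <= C) -> `|P u x| <= C.
Proof.
move=> bu uC; have /andP[cx0 cx1] := c01 x.
apply: (le_trans (ler_normD _ _)); rewrite -/(A u x) -/(c x).
apply: (@le_trans _ _ (C * c x + (1 - c x) * C)); last by rewrite le_eqVlt; apply/orP; left; apply/eqP; ring.
rewrite lerD ?AleC//.
by rewrite normrM ger0_norm ?subr_ge0// ler_wpM2l// subr_ge0.
Qed.

Let bc : bmeas c.
Proof.
split; first by rewrite cE; apply: mA; exact: bmeas_cst.
by exists 1 => x; have /andP[? ?] := c01 x; rewrite ger0_norm.
Qed.

Let bA u : bmeas u -> bmeas (A u).
Proof.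
move=> bu; split; first exact: mA.
have [_ [C uC]] := bu; exists C => x; apply: (le_trans (AleC x bu uC)).
have /andP[? ?] := c01 x; rewrite ler_piMr//.
by apply: le_trans (uC x).
Qed.

Let bcC : bmeas (fun x => 1 - c x).
Proof. exact: (bmeasB (bmeas_cst 1) bc). Qed.

Lemma bmeas_metropolis u : bmeas u -> bmeas (P u).
Proof.
by move=> bu; apply: (bmeasD (bA bu)); exact: bmeasM.
Qed.

Let EvA u v : bmeas u -> bmeas v ->
  (E (fun x => v x * A u x))%:E = (\int[mu]_x \int[mu]_y (v x * (k (x, y) * u y))%:E)%E.
Proof.
move=> bu bv; rewrite EFin_expect; last by apply: bmeasM => //; exact: bA.
apply: eq_integral => x _; rewrite EFinM /A /Rintegral fineK; last first.
  exact: (integrable_fin_num measurableT (ig_ku x bu)).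
rewrite -integralZl//; last exact: ig_ku.
Qed.

Let A_sym u v : bmeas u -> bmeas v ->
  E (fun x => v x * A u x) = E (fun x => u x * A v x).
Proof.
move=> bu bv; apply: EFin_inj; rewrite !EvA//.
have /= -> := Fubini (ig_prod_uv bu bv).
by apply: eq_integral => x _; apply: eq_integral => y _ /=; rewrite ksym; congr EFin; ring.
Qed.

(** The jump part is symmetric by Fubini and the symmetry of [k]; the holding part is multiplication
    by a function. *)
Lemma metropolis_sym u v : bmeas u -> bmeas v ->
  E (fun x => v x * P u x) = E (fun x => u x * P v x).
Proof.
move=> bu bv.
have H u' v' : bmeas u' -> bmeas v' -> E (fun x => v' x * P u' x) =
    E (fun x => v' x * A u' x) + E (fun x => (1 - c x) * (u' x * v' x)).
  move=> bu' bv'; rewrite -expectD.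
  - by apply: eq_Rintegral => x _; rewrite /P -/(A u' x) -/(c x); ring.
  - by apply: bmeasM => //; exact: bA.
  - by apply: bmeasM => //; exact: bmeasM.
rewrite !H// A_sym//; congr (_ + _).
by apply: eq_Rintegral => x _; ring.
Qed.

Lemma metropolisD1 u x : bmeas u -> P (fun y => 1 + u y) x = 1 + P u x.
Proof.
move=> bu; rewrite /P.
under eq_Rintegral do rewrite mulrDr mulr1.
rewrite RintegralD//; last exact: ig_ku.
by ring.
Qed.

(** Expanding the square, half of the double integral is [<g, g> - <g, P g>]: a chain that stays put
    leaves [g] unchanged, so the holding part drops out. *)
Lemma metropolis_dirichlet g D : bmeas g ->
  (\int[mu]_x \int[mu]_y (k (x, y) * (g x - g y) ^+ 2)%:E <= (2 * D)%:E)%E ->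
  E (fun x => g x * g x) - D <= E (fun x => g x * P g x).
Proof.
move=> bg.
have bgg := bmeasM bg bg.
have bAgg := bA bgg. have bAg := bA bg.
have bcgg := bmeasM bc bgg.
have bgAg := bmeasM bg bAg.
have F x : \int[mu]_y (k (x, y) * (g x - g y) ^+ 2) =
    c x * (g x * g x) - 2 * (g x * A g x) + A (fun x => g x * g x) x.
  rewrite /c /A -RintegralZr; [|by []|exact: ig_k].
  rewrite -RintegralZl//; last exact: ig_ku.
  rewrite -RintegralZl//; last first.
    by have := integrableZl measurableT (g x) (ig_ku x bg); apply: eq_integrable.
  have i1 : ig (EFin \o (fun y => k (x, y) * (g x * g x))).
    by have := integrableZr measurableT (g x * g x) (ig_k x); apply: eq_integrable.
  have i2 : ig (EFin \o (fun y => 2 * (g x * (k (x, y) * g y)))).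
    have := integrableZl measurableT (2 * g x) (ig_ku x bg); apply: eq_integrable => // y _.
    by rewrite /= -EFinM mulrA.
  rewrite -RintegralB// -RintegralD//; last exact: ig_ku.
    by apply: eq_Rintegral => y _; ring.
  by have := integrableB measurableT i1 i2; apply: eq_integrable.
have igF x : ig (EFin \o (fun y => k (x, y) * (g x - g y) ^+ 2)).
  have b2 : bmeas (fun y => (g x - g y) ^+ 2).
    have := bmeasB (bmeas_cst (g x)) bg => b; have := bmeasM b b.
    by congr bmeas; apply/funext => y; rewrite expr2.
  exact: ig_ku.
have -> : (\int[mu]_x \int[mu]_y (k (x, y) * (g x - g y) ^+ 2)%:E =
    \int[mu]_x (c x * (g x * g x) - 2 * (g x * A g x) + A (fun x => g x * g x) x)%:E)%E.
  apply: eq_integral => x _; rewrite -F /Rintegral fineK//.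
  exact: (integrable_fin_num measurableT (igF x)).
have b2 := bmeasZ 2 bgAg.
have b3 := bmeasB bcgg b2.
rewrite -EFin_expect; last exact: bmeasD.
rewrite lee_fin expectD// expectB// expectZ//.
have -> : E (A (fun x => g x * g x)) = E (fun x => c x * (g x * g x)).
  have := A_sym bgg (bmeas_cst 1).
  under eq_Rintegral do rewrite mul1r.
  by move=> ->; rewrite -cE; apply: eq_Rintegral => x _; rewrite mulrC.
have -> : E (fun x => g x * P g x) = E (fun x => g x * g x)
   - (E (fun x => c x * (g x * g x)) - E (fun x => g x * A g x)).
  rewrite -expectB// -expectB//; last exact: bmeasB.
  by apply: eq_Rintegral => x _; rewrite /P -/(A g x) -/(c x); ring.
lra.
Qed.

Lemma bmeas_iter n g : bmeas g -> bmeas (iter n P g).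
Proof. by move=> bg; elim: n => //= n; exact: bmeas_metropolis. Qed.

Lemma metropolis_iter_le n g : bmeas g -> (forall x, `|g x| <= 1) ->
  forall x, `|iter n P g x| <= 1.
Proof.
move=> bg g1; elim: n => //= n IH x; apply: metropolis_le => //; exact: bmeas_iter.
Qed.

Lemma metropolis_iter_sym m n g : bmeas g ->
  E (fun x => iter m P g x * iter n P g x) = E (fun x => g x * iter (m + n) P g x).
Proof.
move=> bg; elim: m n => // m IH n.
rewrite addSnnS -IH /= [RHS]metropolis_sym; [|exact: bmeas_iter..].
by apply: eq_Rintegral => x _; rewrite mulrC.
Qed.

(* Cauchy-Schwarz makes [b_j = |P^j g|^2] log-convex, so it decays at most at
   the initial rate [b_1 / b_0 >= rho ^+ 2]. *)
Lemma metropolis_decay g rho : bmeas g -> 0 < rho ->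
  0 < E (fun x => g x * g x) ->
  rho * E (fun x => g x * g x) <= E (fun x => g x * P g x) ->
  forall n, rho ^+ (n.*2) * E (fun x => g x * g x) <= E (fun x => g x * iter (n.*2) P g x).
Proof.
move=> bg rho0 v0 Hrho.
pose b j := E (fun x => iter j P g x * iter j P g x).
have b_E j : b j = E (fun x => g x * iter (j.*2) P g x).
  by rewrite /b metropolis_iter_sym// addnn.
have b0E : b 0 = E (fun x => g x * g x) by [].
(* By symmetry [<P^(j+1) g, P^(j+1) g> = <P^j g, P^(j+2) g>], to which Cauchy-Schwarz applies. *)
have CS j : b j.+1 ^+ 2 <= b j * b j.+2.
  have -> : b j.+1 = E (fun x => iter j P g x * iter j.+2 P g x).
    by rewrite /b !metropolis_iter_sym// addSnnS.
  by apply: expect_CauchySchwarz; exact: bmeas_iter.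
have b1 : rho ^+ 2 * b 0 <= b 1.
  have := expect_CauchySchwarz mu bg (bmeas_metropolis bg).
  rewrite -b0E -/(b 1); rewrite -b0E in v0 Hrho.
  have H0 : 0 <= rho * b 0 by rewrite mulr_ge0// ltW.
  move=> H; have : (rho * b 0) ^+ 2 <= b 0 * b 1.
    by apply: le_trans H; rewrite lerXn2r ?nnegrE// (le_trans H0).
  by rewrite exprMn (_ : rho ^+ 2 * b 0 ^+ 2 = b 0 * (rho ^+ 2 * b 0)) ?ler_pM2l//; ring.
have step j : 0 < b j /\ rho ^+ 2 * b j <= b j.+1.
  elim: j => [|j [bj0 IH]]; first by rewrite b0E.
  have bj1 : 0 < b j.+1 by apply: lt_le_trans IH; rewrite mulr_gt0// exprn_gt0.
  split => //.
  have : b j * (rho ^+ 2 * b j.+1) <= b j * b j.+2.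
    apply: le_trans (CS j); rewrite mulrCA mulrA expr2.
    by rewrite ler_wpM2r// ltW.
  by rewrite ler_pM2l.
move=> n; rewrite -b_E -b0E; elim: n => [|n IH]; first by rewrite mul1r.
apply: le_trans (step n).2.
by rewrite doubleS -addn2 exprD [_ * rho ^+ 2]mulrC -mulrA ler_wpM2l// exprn_ge0// ltW.
Qed.

Section law.
Variables (law : nat -> set T -> \bar R) (g : T -> R).
Hypotheses (bg : bmeas g) (g1 : forall x, `|g x| <= 1).
Hypothesis law0 : forall S, measurable S -> law 0 S = (E (fun x => \1_S x * (1 + g x)))%:E.
Hypothesis lawS : forall n S, measurable S ->
  law n.+1 S = (\int[law n]_x (P \1_S x)%:E)%E.

(** The next law integrates [P \1_S] against the density [1 + P^n g]; symmetry moves [P] onto the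
    density, and [P] fixes constants. *)
Lemma law_density n S : measurable S ->
  law n S = (E (fun x => \1_S x * (1 + iter n P g x)))%:E.
Proof.
elim: n S => [|n IH] S mS; first exact: law0.
rewrite lawS//.
have bit := bmeas_iter n bg.
have b1it := bmeasD (bmeas_cst 1) bit.
have w0 x : 0 <= 1 + iter n P g x.
  by have := metropolis_iter_le n bg g1 x; rewrite ler_norml => /andP[]; lra.
have bS := bmeas_indic R mS.
rewrite (eq_setfun_integral (m2 := density_measure mu b1it.1 w0)); last first.
  move=> B mB; rewrite IH// EFin_expect; last first.
    by apply: bmeasM => //; exact: bmeas_indic.
  rewrite /density_measure [RHS]integral_mkcond; apply: eq_integral => x _.
  by rewrite epatch_indic/= EFinM muleC.
rewrite ge0_integral_density//; last 2 first.
- by apply/measurable_EFinP; exact: (bmeas_metropolis bS).1.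
- move=> x; rewrite lee_fin; have /andP[? ?] := c01 x.
  rewrite addr_ge0//; first by apply: Rintegral_ge0 => y _; rewrite mulr_ge0.
  by rewrite mulr_ge0// subr_ge0.
transitivity (E (fun x => (1 + iter n P g x) * P \1_S x))%:E.
  rewrite EFin_expect; first by apply: eq_integral => x _; rewrite -EFinM mulrC.
  by apply: bmeasM => //; exact: bmeas_metropolis.
congr EFin; rewrite metropolis_sym//.
by apply: eq_Rintegral => x _; rewrite metropolisD1.
Qed.

(** With [q = P^n g], the left side is at most the expectation of [|q|]. This splits over the set
    where [q >= 0] and its complement; on each the integral of [q] is the difference of [law n] and
    [mu], of absolute value at most [eps]. *)
Lemma expect_tv n eps u : bmeas u -> (forall x, `|u x| <= 1) ->
  (forall S, measurable S -> (`|law n S - mu S| <= eps%:E)%E) ->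
  E (fun x => u x * iter n P g x) <= 2 * eps.
Proof.
move=> bu u1 tv; pose q := iter n P g; have bq : bmeas q by exact: bmeas_iter.
have tvq S : measurable S -> `|E (fun x => \1_S x * q x)| <= eps.
  move=> mS; rewrite -lee_fin; apply: le_trans (tv S mS).
  have bS := bmeas_indic R mS; have bSq := bmeasM bS bq.
  rewrite law_density// (_ : mu S = (E \1_S)%:E); last first.
    by rewrite EFin_expect// integral_indic// setIT.
  rewrite -EFinB lee_fin -expectB//; last first.
    by apply: bmeasM => //; exact: (bmeasD (bmeas_cst 1)).
  rewrite le_eqVlt; apply/orP; left; apply/eqP; congr (`| _ |).
  by apply: eq_Rintegral => x _; rewrite /q; ring.
pose S := [set x | 0 <= q x].
have mS : measurable S.
  have := bq.1 measurableT _ (measurable_itv `[0, +oo[).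
  rewrite setTI; congr measurable; apply/seteqP; split => x /=;
    by rewrite in_itv/= andbT.
have bS := bmeas_indic R mS. have bSC := bmeas_indic R (measurableC mS).
apply: (@le_trans _ _ (E (fun x => \1_S x * q x - \1_(~` S) x * q x))).
  apply: le_expect; [exact: bmeasM|by apply: bmeasB; exact: bmeasM|].
  move=> x; rewrite -mulrBl; apply: (le_trans (ler_norm _)); rewrite normrM.
  apply: (@le_trans _ _ `|q x|); first by rewrite ler_piMl.
  rewrite !indicE in_setC; have [qx|qx] := leP 0 (q x).
    by rewrite mem_set// ger0_norm// subr0 mul1r.
  rewrite memNset; first by rewrite ltr0_norm// sub0r mulN1r.
  by rewrite /S/= leNgt qx.
rewrite expectB; [|exact: bmeasM..].
have := tvq _ mS; have := tvq _ (measurableC mS).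
rewrite !ler_norml => /andP[? ?] /andP[? ?]; lra.
Qed.

(** [metropolis_decay] covers even powers only. For even [n] the test function is [g], with a factor
    [rho <= 1] to spare; for odd [n] it is [P g], which raises the power to the even number
    [n + 1]. *)
Lemma tv_lower_bound n eps rho : 0 < rho -> rho <= 1 ->
  0 < E (fun x => g x * g x) ->
  rho * E (fun x => g x * g x) <= E (fun x => g x * P g x) ->
  (forall S, measurable S -> (`|law n S - mu S| <= eps%:E)%E) ->
  rho ^+ n.+1 * E (fun x => g x * g x) <= 2 * eps.
Proof.
move=> rho0 rho1 v0 Hrho tv.
have D := metropolis_decay bg rho0 v0 Hrho.
have [on|en] := boolP (odd n).
  have n2 : n.+1 = (n.+1)./2.*2 by rewrite -[LHS]odd_double_half/= on.
  apply: (@le_trans _ _ (E (fun x => g x * iter n.+1 P g x))).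
    by rewrite n2; exact: D.
  have := expect_tv (bmeas_metropolis bg) (metropolis_iter_le 1 bg g1) tv.
  by rewrite (metropolis_iter_sym 1 n bg).
have n2 : n = n./2.*2 by rewrite -[LHS]odd_double_half (negbTE en).
apply: (@le_trans _ _ (rho ^+ n * E (fun x => g x * g x))).
  rewrite ler_wpM2r ?(ltW v0)// exprS ler_piMl// exprn_ge0//; exact: ltW.
apply: (@le_trans _ _ (E (fun x => g x * iter n P g x))); last exact: expect_tv.
by rewrite {1 2}n2; exact: D.
Qed.

End law.

End symmetric_kernel.

(** * Integrals of products over the coordinates *)

Section pushforward_measure.
Context d d' (T : measurableType d) (T' : measurableType d') (R : realType).

Definition pushforward_measure (m : {measure set T -> \bar R}) (f : T -> T')
    (mf : measurable_fun setT f) : {measure set T' -> \bar R} :=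
  measure_function_pushforward__canonical__measure_function_Measure m mf.

End pushforward_measure.

Section marginal.
Context d (T : measurableType d) (R : realType) (mu : {measure set T -> \bar R}).
Variables (p : T -> R) (w : T -> R) (C : R).
Hypotheses (mp : measurable_fun setT p) (mw : measurable_fun setT w).
Hypotheses (w0 : forall x, 0 <= w x) (C0 : 0 <= C).
Hypothesis wC : forall a b, a <= b ->
  (\int[mu]_x (w x * \1_(`[a, b]) (p x))%:E = (C * (b - a))%:E)%E.

(** The measure with density [w], pushed forward by [p], agrees with [C] times Lebesgue measure on
    intervals, hence on all Borel sets, hence on nonnegative integrands. *)
Lemma marginal_integral (g : R -> R) : measurable_fun setT g -> (forall t, 0 <= g t) ->
  (\int[mu]_x (w x * g (p x))%:E = C%:E * \int[lebesgue_measure]_t (g t)%:E)%E.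
Proof.
move=> mg g0.
pose nu : {measure set (measurableTypeR R) -> \bar R} :=
  pushforward_measure (density_measure mu mw w0) (mp : measurable_fun setT (p : T -> measurableTypeR R)).
pose leb : {measure set (measurableTypeR R) -> \bar R} :=
  mscale (NngNum C0) (@lebesgue_measure R).
have nuE (A : set R) : measurable A -> nu A = (\int[mu]_x (w x * \1_A (p x))%:E)%E.
  move=> mA; rewrite /nu/= /pushforward /density_measure integral_mkcond.
  by apply: eq_integral => x _; rewrite epatch_indic/= EFinM.
have nucc a b : a <= b -> nu `[a, b]%classic = (C * (b - a))%:E.
  by move=> ab; rewrite nuE ?wC.
(* Uniqueness of measures is applied to half-open intervals, whereas [wC] is about closed ones; its
   case [a = b] makes singletons null. *)
have nuoc a b : a <= b -> nu `]a, b]%classic = (C * (b - a))%:E.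
  move=> ab; have nu1 : nu [set a] = 0%E.
    by rewrite -[X in nu X](set_itv1 a) nucc// subrr mulr0.
  rewrite -nucc// -(@setU1itv _ _ _ a false)// measureU//.
    by rewrite [X in (X + _)%E]nu1 add0e.
  rewrite -subset0 => x [/= ->]; rewrite in_itv/= ltxx//.
have leboc a b : a <= b -> leb `]a, b]%classic = (C * (b - a))%:E.
  move=> ab; rewrite /leb/= /mscale/= lebesgue_measure_itv/= lte_fin.
  have [//|ba] := ltP a b.
  by rewrite (le_anti (introT andP (conj ab ba))) subrr mulr0 mule0.
have nuleb A : measurable A -> nu A = leb A.
  move=> mA; apply: (@measure_unique _ R (measurableTypeR R) (@ocitv R)
      (fun n => `] (- n%:R)%R, n%:R]%classic) _ _ _ _ nu leb) => //.
  - exact: ocitvI.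
  - by move=> n; exact: is_ocitv.
  - by rewrite bigcup_itvT.
  - move=> _ /ocitvP [->|[[a b]/= ab ->]]; first by rewrite !measure0.
    by rewrite nuoc ?ltW// leboc// ltW.
  - by move=> n; rewrite nuoc ?ltry// ge0_cp// oppr_le0.
transitivity (\int[nu]_t (g t)%:E)%E; last first.
  rewrite (eq_setfun_integral _ nuleb) ge0_integral_mscale//.
  - exact/measurable_EFinP.
  - by move=> t _; rewrite lee_fin.
rewrite [RHS]ge0_integral_pushforward//.
- rewrite preimage_setT ge0_integral_density//.
  + by apply: eq_integral => x _; rewrite EFinM muleC.
  + by apply/measurable_EFinP; exact: measurableT_comp.
  + by move=> x; rewrite lee_fin.
- exact/measurable_EFinP.
- by move=> t _; rewrite lee_fin.
Qed.

End marginal.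

Section tensor.
Context (R : realType) (d : nat).
Variables (lam : {measure set (Borel R d) -> \bar R}) (lamE : is_lebesgue lam).

Lemma measurable_coord (i : 'I_d) :
  measurable_fun [set: Borel R d] (fun x : Borel R d => (x : Rd R d) ord0 i).
Proof.
refine (@measurability _ _ (Borel R d) (measurableTypeR R) setT (fun x : Borel R d => (x : Rd R d) ord0 i) (@RGenOpens.G R) _ _); first exact: RGenOpens.measurableE.
move=> _ [_ [a [b ->] <-]].
rewrite setTI; apply: sub_sigma_algebra.
have : open `]a, b[%classic by exact: interval_open.
by apply: open_comp => x _; exact: coord_continuous.
Qed.

Lemma box_measurable (a b : Rd R d) : measurable (box a b).
Proof.
rewrite (_ : box a b = \big[setI/setT]_(i < d)
   ((fun x : Borel R d => (x : Rd R d) ord0 i) @^-1` `[a ord0 i, b ord0 i])).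
  apply: bigsetI_measurable => i _; rewrite -[X in measurable X]setTI.
  exact: measurable_coord.
rewrite -bigcap_seq; apply/seteqP; split => x /=.
  by move=> xab i _; rewrite /= in_itv/=; exact: xab.
by move=> xab i; have := xab i (mem_index_enum _); rewrite /= in_itv.
Qed.

(** As [lam] is specified on boxes only, the factors are freed one at a time: by induction on [k],
    those of index below [k] are arbitrary and the others are indicators of intervals. *)
Lemma tensor_integral (f : 'I_d -> R -> R) (c : 'I_d -> R) :
  (forall i, measurable_fun setT (f i)) -> (forall i t, 0 <= f i t) ->
  (forall i, (\int[lebesgue_measure]_t (f i t)%:E = (c i)%:E)%E) ->
  (\int[lam]_x (\prod_(i < d) f i ((x : Rd R d) ord0 i))%:E = (\prod_(i < d) c i)%:E)%E.
Proof.
suff H (k : nat) : forall (f : 'I_d -> R -> R) (c : 'I_d -> R), (forall i, measurable_fun setT (f i)) ->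
  (forall i t, 0 <= f i t) ->
  (forall i, (\int[lebesgue_measure]_t (f i t)%:E = (c i)%:E)%E) ->
  (forall i : 'I_d, (k <= i)%N -> exists a b, a <= b /\ f i = \1_(`[a, b])) ->
  (\int[lam]_x (\prod_(i < d) f i ((x : Rd R d) ord0 i))%:E = (\prod_(i < d) c i)%:E)%E.
  move=> mf f0 cE; apply: (H d) => // i.
  by rewrite leqNgt ltn_ord.
elim: k => [|k IH] {}f {}c mf f0 cE fk.
  have /choice[a] : forall i, exists ab : R * R, ab.1 <= ab.2 /\ f i = \1_(`[ab.1, ab.2]).
    by move=> i; have [a [b ab]] := fk i isT; exists (a, b).
  move=> aP.
  have -> : (\prod_(i < d) c i) = \prod_(i < d) ((a i).2 - (a i).1).
    apply: eq_bigr => i _; apply: EFin_inj; rewrite -cE (aP i).2.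
    rewrite integral_indic//= setIT lebesgue_measure_itv/= lte_fin.
    have := (aP i).1; rewrite le_eqVlt => /predU1P[->|->//].
    by rewrite ltxx subrr.
  have <- : lam (box (\row_i (a i).1) (\row_i (a i).2)) =
      (\prod_(i < d) ((a i).2 - (a i).1))%:E.
    rewrite lamE; last by move=> i; rewrite !mxE; exact: (aP i).1.
    by congr EFin; apply: eq_bigr => i _; rewrite !mxE.
  transitivity (\int[lam]_x (\1_(box (\row_i (a i).1) (\row_i (a i).2)) x)%:E)%E; last first.
    by rewrite integral_indic ?setIT//; exact: box_measurable.
  apply: eq_integral => x _; congr EFin; rewrite indicE.
  have [|] := boolP (x \in box _ _).
    rewrite inE => xb; rewrite big1// => i _; rewrite (aP i).2 indicE mem_set//=.
    by have := xb i; rewrite !mxE in_itv.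
  move=> xb; have [i xi] : exists i, ~ (x : Rd R d) ord0 i \in `[(a i).1, (a i).2].
    apply: contrapT => /forallNP H; move/negP: xb; apply; rewrite inE => i.
    by have := H i => /contrapT; rewrite !mxE in_itv.
  by rewrite (bigD1 i)//= (aP i).2 indicE memNset// mul0r.
have [dk|kd] := leqP d k.
  by apply: IH => // i ki; have := ltn_ord i; rewrite ltnNge (leq_trans dk ki).
pose j := Ordinal kd.
pose f1 i := if i == j then cst 1 else f i.
pose w (x : Borel R d) := \prod_(i < d) f1 i ((x : Rd R d) ord0 i).
pose C := \prod_(i < d | i != j) c i.
have fE (g : R -> R) x : \prod_(i < d) (if i == j then g else f i) ((x : Rd R d) ord0 i)
    = w x * g (x ord0 j).
  rewrite /w (bigD1 j)//= [in RHS](bigD1 j)//= /f1 !eqxx mul1r mulrC; congr (_ * _).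
  by apply: eq_bigr => i /negbTE ->.
have c0 i : 0 <= c i.
  by rewrite -lee_fin -cE; apply: integral_ge0 => t _; rewrite lee_fin.
have mf1 i : measurable_fun setT (f1 i) by rewrite /f1; case: ifP.
have mw : measurable_fun setT w.
  by apply: measurable_prod => i _; apply: measurableT_comp => //; exact: measurable_coord.
have w0 x : 0 <= w x by apply: prodr_ge0 => i _; rewrite /f1; case: ifP.
have C0 : 0 <= C by apply: prodr_ge0.
transitivity (\int[lam]_x (w x * f j ((x : Rd R d) ord0 j))%:E)%E.
  apply: eq_integral => x _; rewrite -fE; congr EFin; apply: eq_bigr => i _.
  by case: eqP => [->|].
rewrite (marginal_integral (measurable_coord j) mw w0 C0)//.
  by rewrite cE -EFinM (bigD1 j)//= mulrC.
move=> a b ab.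
(* With an indicator in slot [j], the induction hypothesis computes the [j]-th marginal of [w] on
   intervals, which is what [marginal_integral] asks for. *)
transitivity (\int[lam]_x (\prod_(i < d) (if i == j then \1_(`[a, b]) else f i)
    ((x : Rd R d) ord0 i))%:E)%E.
  by apply: eq_integral => x _; rewrite fE.
rewrite (IH (fun i => if i == j then \1_(`[a, b]) else f i) (fun i => if i == j then b - a else c i)).
- congr EFin; rewrite (bigD1 j)//= eqxx mulrC; congr (_ * _).
  by apply: eq_bigr => i /negbTE ->.
- by move=> i; case: ifP => // _; exact: measurable_indic.
- by move=> i t; case: ifP.
- move=> i; case: ifP => // _.
  rewrite integral_indic//= setIT lebesgue_measure_itv/= lte_fin.
  by move: ab; rewrite le_eqVlt => /predU1P[->|->//]; rewrite ltxx subrr.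
- move=> i ki; case: eqP => [_|ij]; first by exists a, b.
  apply: fk; rewrite ltn_neqAle ki andbT; apply/eqP => kij; apply: ij.
  by apply/val_inj; rewrite /= kij.
Qed.

(** For fixed [x] the inner integral is itself a product over the coordinates of [x], so
    [tensor_integral] is applied twice. Finiteness of the one-dimensional inner integrals makes them
    real-valued factors. *)
Lemma tensor_integral_pair (F : 'I_d -> R -> R -> R) (c : 'I_d -> R) :
  (forall i, measurable_fun setT (fun p : R * R => F i p.1 p.2)) ->
  (forall i s t, 0 <= F i s t) ->
  (forall i s, (\int[lebesgue_measure]_t (F i s t)%:E < +oo)%E) ->
  (forall i, (\int[lebesgue_measure]_s \int[lebesgue_measure]_t (F i s t)%:E = (c i)%:E)%E) ->
  let P := (fun x : Borel R d => \int[lam]_y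
    (\prod_(i < d) F i ((x : Rd R d) ord0 i) ((y : Rd R d) ord0 i))%:E)%E in
  measurable_fun setT P /\ (\int[lam]_x P x = (\prod_(i < d) c i)%:E)%E.
Proof.
move=> mF F0 Foo cE.
have mF1 i s : measurable_fun setT (F i s)
  by exact: (measurableT_comp (mF i) (pair1_measurable s)).
pose G i s := fine (\int[lebesgue_measure]_t (F i s t)%:E)%E.
have GE i s : (\int[lebesgue_measure]_t (F i s t)%:E)%E = (G i s)%:E.
  rewrite /G fineK// ge0_fin_numE//; apply: integral_ge0 => t _.
  by rewrite lee_fin.
have G0 i s : 0 <= G i s.
  by apply: fine_ge0; apply: integral_ge0 => t _; rewrite lee_fin.
have mG i : measurable_fun setT (G i).
  apply: measurableT_comp => //.
  apply: (@measurable_fun_fubini_tonelli_F _ _ _ _ _ lebesgue_measure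
    (fun p : R * R => (F i p.1 p.2)%:E)).
    by apply/measurable_EFinP; exact: mF.
  by move=> x; rewrite lee_fin.
move=> P.
have -> : P = (fun x => (\prod_(i < d) G i ((x : Rd R d) ord0 i))%:E).
  apply/funext => x; rewrite /P.
  by rewrite (tensor_integral (f := fun i => F i ((x : Rd R d) ord0 i))
    (c := fun i => G i ((x : Rd R d) ord0 i))).
split.
  apply/measurable_EFinP; apply: measurable_prod => i _.
  by apply: measurableT_comp => //; exact: measurable_coord.
apply: tensor_integral => // i.
by rewrite -cE; apply: eq_integral => s _; rewrite GE.
Qed.

End tensor.

Lemma sqr_diff_le4 (R : realFieldType) (a b : R) :
  `|a| <= 1 -> `|b| <= 1 -> (a - b) ^+ 2 <= 4.
Proof.
rewrite !ler_norml => /andP[a1 a2] /andP[b1 b2].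
have : 0 <= (2 - (a - b)) * (2 + (a - b)) by apply: mulr_ge0; lra.
by rewrite expr2; lra.
Qed.

(** * One-dimensional factors of the target and of the proposal *)

Section proposal_density.
Context (R : realType).
Variables (phi dphi : R -> R) (h Z1 : R).
Hypotheses (mphi : measurable_fun setT phi) (mdphi : measurable_fun setT dphi).
Hypotheses (h0 : 0 < h) (Z10 : 0 < Z1).
Hypothesis Z1E : (\int[lebesgue_measure]_t (expR (- phi t))%:E = Z1%:E)%E.

Definition w1 x := expR (- phi x) / Z1.
Definition q1 x y :=
  powR (4 * pi * h) (- (1 / 2)) * expR (- (y - x + h * dphi x) ^+ 2 / (4 * h)).
(** Geometric mean of the forward joint density [w1 x * q1 x y] and of the backward one
    [w1 y * q1 y x], with the square root already taken in the exponent. Its double integral is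
    their affinity, or Bhattacharyya coefficient. *)
Definition r1 x y := powR (4 * pi * h) (- (1 / 2)) / Z1 *
  expR (- (phi x + phi y + ((y - x + h * dphi x) ^+ 2 + (x - y + h * dphi y) ^+ 2) / (4 * h)) / 2).

Lemma w1_gt0 x : 0 < w1 x. Proof. by rewrite divr_gt0 ?expR_gt0. Qed.

Lemma w1_ge0 x : 0 <= w1 x. Proof. exact: ltW (w1_gt0 x). Qed.

Let cst_gt0 : 0 < powR (4 * pi * h) (- (1 / 2)).
Proof. by rewrite powR_gt0// !mulr_gt0// pi_gt0. Qed.

Lemma q1_gt0 x y : 0 < q1 x y. Proof. by rewrite mulr_gt0 ?expR_gt0. Qed.

Lemma q1_ge0 x y : 0 <= q1 x y. Proof. exact: ltW (q1_gt0 x y). Qed.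

Lemma r1_ge0 x y : 0 <= r1 x y.
Proof. by rewrite mulr_ge0 ?expR_ge0// divr_ge0 ?ltW. Qed.

Lemma r1_sqr x y : r1 x y ^+ 2 = (w1 x * q1 x y) * (w1 y * q1 y x).
Proof.
rewrite /r1 /w1 /q1 exprMn expr2 -expRM_natl.
set c := powR _ _.
have -> : 2%:R * (- (phi x + phi y + ((y - x + h * dphi x) ^+ 2 + (x - y + h * dphi y) ^+ 2)
    / (4 * h)) / 2) = (- phi x) + (- (y - x + h * dphi x) ^+ 2 / (4 * h))
    + (- phi y) + (- (x - y + h * dphi y) ^+ 2 / (4 * h)).
  by field; rewrite gt_eqF.
by rewrite !expRD; ring.
Qed.

Lemma measurable_w1 : measurable_fun setT w1.
Proof.
by apply: measurable_funM => //; apply: measurableT_comp => //; exact: measurableT_comp.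
Qed.

Lemma measurable_q1 : measurable_fun setT (fun p : R * R => q1 p.1 p.2).
Proof.
apply: measurable_funM => //; apply: measurableT_comp => //.
apply: measurable_funM => //; apply: measurableT_comp => //.
apply: measurable_funX; apply: measurable_funD.
  by apply: measurable_funB.
by apply: measurable_funM => //; exact: measurableT_comp.
Qed.

Lemma measurable_r1 : measurable_fun setT (fun p : R * R => r1 p.1 p.2).
Proof.
apply: measurable_funM => //; apply: measurableT_comp => //.
apply: measurable_funM => //; apply: measurableT_comp => //.
apply: measurable_funD.
  by apply: measurable_funD => //; exact: measurableT_comp.
apply: measurable_funM => //; apply: measurable_funD;
  apply: measurable_funX; apply: measurable_funD.
- exact: measurable_funB.
- by apply: measurable_funM => //; exact: measurableT_comp.
- exact: measurable_funB.
- by apply: measurable_funM => //; exact: measurableT_comp.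
Qed.

Lemma q1_normal x y : q1 x y = normal_pdf (x - h * dphi x) (Num.sqrt (2 * h)) y.
Proof.
have s0 : Num.sqrt (2 * h) != 0 :> R by rewrite gt_eqF// sqrtr_gt0 mulr_gt0.
rewrite normal_pdfE// /normal_fun /normal_peak /q1.
rewrite sqr_sqrtr; last by rewrite ltW// mulr_gt0.
congr (_ * _).
  rewrite powRN div1r powR12_sqrt; last by rewrite ltW// !mulr_gt0// pi_gt0.
  by congr (Num.sqrt _)^-1; ring.
congr expR; congr (_ / _); last by ring.
by congr (- _ ^+ 2); ring.
Qed.

Lemma measurable_q1r x : measurable_fun setT (q1 x).
Proof.
by rewrite (funext (q1_normal x)); exact: measurable_normal_pdf.
Qed.

Lemma integral_q1 x : (\int[lebesgue_measure]_y (q1 x y)%:E = 1)%E.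
Proof. by under eq_integral do rewrite q1_normal; exact: integral_normal_pdf. Qed.

Lemma integral_w1 : (\int[lebesgue_measure]_x (w1 x)%:E = 1)%E.
Proof.
under eq_integral do rewrite /w1 mulrC EFinM.
rewrite ge0_integralZl//.
- by rewrite Z1E -EFinM mulVf// gt_eqF.
- by apply/measurable_EFinP; apply: measurableT_comp => //; exact: measurableT_comp.
- by rewrite lee_fin invr_ge0 ltW.
Qed.

End proposal_density.

(** * Lower bounds for MALA on a separable potential *)

Section separable_mala.
Context (R : realType) (d : nat) (i0 : 'I_d).
Variables (lam : {measure set (Borel R d) -> \bar R}) (lamE : is_lebesgue lam).
Variables (phi dphi : R -> R) (h Z1 : R).
Hypotheses (mphi : measurable_fun setT phi) (mdphi : measurable_fun setT dphi).
Hypotheses (h0 : 0 < h) (Z10 : 0 < Z1).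
Hypothesis Z1E : (\int[lebesgue_measure]_t (expR (- phi t))%:E = Z1%:E)%E.

Definition separable (x : Rd R d) := \sum_(i < d) phi (x ord0 i).
Local Notation f := separable.
Hypothesis gradE : forall x, grad f x = \row_i dphi (x ord0 i).

Local Notation w1 := (w1 phi Z1).
Local Notation q1 := (q1 dphi h).
Local Notation r1 := (r1 phi dphi h Z1).

Let w (x : Borel R d) := \prod_(i < d) w1 ((x : Rd R d) ord0 i).
Let q (x y : Borel R d) := \prod_(i < d) q1 ((x : Rd R d) ord0 i) ((y : Rd R d) ord0 i).

Let w_gt0 x : 0 < w x. Proof. by apply: prodr_gt0 => i _; exact: w1_gt0. Qed.

Let w_ge0 x : 0 <= w x. Proof. exact: ltW (w_gt0 x). Qed.

Let q_gt0 x y : 0 < q x y. Proof. by apply: prodr_gt0 => i _; exact: q1_gt0. Qed.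

Lemma separable_Zconst : Zconst lam f = (Z1 ^+ d)%:E.
Proof.
rewrite /Zconst.
under eq_integral do rewrite /separable -sumrN expR_sum.
rewrite (@tensor_integral _ _ _ lamE (fun=> expR \o (-%R \o phi)) (fun=> Z1))//.
- by rewrite prodr_const card_ord.
- by move=> _; apply: measurableT_comp => //; exact: measurableT_comp.
- by move=> _ t; exact: expR_ge0.
Qed.

Let densityE : pi_density lam f = w.
Proof.
apply/funext => x; rewrite /pi_density separable_Zconst/= /w /w1 big_split/=.
by rewrite -expR_sum prodr_const card_ord exprVn /separable sumrN.
Qed.

Let proposalE x y : proposal h f x y = q x y.
Proof.
rewrite /proposal /q /q1 big_split/= prodr_const card_ord -expR_sum.
congr (_ * _).
  rewrite -powR_mulrn ?powR_ge0// -powRrM; congr powR.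
  by rewrite div1r mulNr mulrC.
congr expR; rewrite /sqnorm /dotv -sumrN mulr_suml; apply: eq_bigr => i _.
by rewrite gradE !mxE expr2.
Qed.

Let m_w : measurable_fun setT w.
Proof.
apply: measurable_prod => i _; apply: measurableT_comp; first exact: measurable_w1.
exact: measurable_coord.
Qed.

Let coord2 i : measurable_fun setT (fun p : Borel R d * Borel R d =>
   ((p.1 : Rd R d) ord0 i, (p.2 : Rd R d) ord0 i)).
Proof.
apply/measurable_fun_pairP; split;
  by apply: (measurableT_comp (measurable_coord i)).
Qed.

Let coord2' i : measurable_fun setT (fun p : Borel R d * Borel R d =>
   ((p.2 : Rd R d) ord0 i, (p.1 : Rd R d) ord0 i)).
Proof.
apply/measurable_fun_pairP; split;
  by apply: (measurableT_comp (measurable_coord i)).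
Qed.

Let m_q : measurable_fun setT (fun p : Borel R d * Borel R d => q p.1 p.2).
Proof.
apply: measurable_prod => i _.
exact: (measurableT_comp (measurable_q1 h mdphi) (coord2 i)).
Qed.

Let m_q' : measurable_fun setT (fun p : Borel R d * Borel R d => q p.2 p.1).
Proof.
apply: measurable_prod => i _.
exact: (measurableT_comp (measurable_q1 h mdphi) (coord2' i)).
Qed.

Let m_winv : measurable_fun setT (fun x => (w x)^-1).
Proof.
rewrite (_ : (fun x => _) = fun x : Borel R d =>
   \prod_(i < d) (Z1 * expR (phi ((x : Rd R d) ord0 i)))).
  apply: measurable_prod => i _; apply: measurable_funM => //.
  apply: measurableT_comp => //; apply: measurableT_comp => //.
  exact: measurable_coord.
apply/funext => x; rewrite /w -prodfV; apply: eq_bigr => i _.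
by rewrite /w1 invfM invrK expRN invrK mulrC.
Qed.

Let int_q x : (\int[lam]_y (q x y)%:E = 1)%E.
Proof.
rewrite (@tensor_integral _ _ _ lamE (fun i => q1 ((x : Rd R d) ord0 i)) (fun=> 1))//.
- by rewrite prodr_const expr1n.
- by move=> i; exact: measurable_q1r.
- by move=> i t; exact: q1_ge0.
- by move=> i; exact: integral_q1.
Qed.

Let mu := density_measure lam m_w w_ge0.

Let muT : mu setT = 1%E.
Proof.
rewrite /mu /density_measure.
rewrite (@tensor_integral _ _ _ lamE (fun=> w1) (fun=> 1))//.
- by rewrite prodr_const expr1n.
- by move=> i; exact: measurable_w1.
- by move=> i t; exact: w1_ge0.
- by move=> i; exact: integral_w1.
Qed.

HB.instance Definition _ := Measure.on mu.
HB.instance Definition _ := Measure_isProbability.Build _ _ _ mu muT.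

(** Proposal density times acceptance probability, relative to the target at the arrival point.
    Written as a minimum, it is visibly symmetric. *)
Let k (p : Borel R d * Borel R d) := Num.min (q p.1 p.2 / w p.2) (q p.2 p.1 / w p.1).

Let m_k : measurable_fun setT k.
Proof.
apply: measurable_minr; apply: measurable_funM => //;
  exact: (measurableT_comp m_winv).
Qed.

Let k_ge0 p : 0 <= k p.
Proof. by rewrite /k le_min !divr_ge0// ltW. Qed.

Let k_sym x y : k (x, y) = k (y, x).
Proof. by rewrite /k/= minC. Qed.

Let m_k1 x : measurable_fun setT (fun y => k (x, y)).
Proof. exact: (measurableT_comp m_k (pair1_measurable x)). Qed.

Let kw x y : k (x, y) * w y = proposal h f x y * accept lam h f x y.
Proof.
rewrite /accept densityE !proposalE /k/=.
rewrite [RHS]minr_pMr; last exact: ltW.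
rewrite minr_pMl; last exact: w_ge0.
by congr Num.min; field; rewrite ?gt_eqF.
Qed.

Let kw_le x y : k (x, y) * w y <= q x y.
Proof.
rewrite /k minr_pMl; last exact: w_ge0.
by rewrite ge_min/= divfK ?lexx// gt_eqF.
Qed.

Let integral_mu (F : Borel R d -> R) : measurable_fun setT F -> (forall x, 0 <= F x) ->
  (\int[mu]_x (F x)%:E = \int[lam]_x (F x * w x)%:E)%E.
Proof.
move=> mF F0; under [RHS]eq_integral do rewrite EFinM.
apply: ge0_integral_density; first exact/measurable_EFinP.
by move=> x; rewrite lee_fin.
Qed.

Let k_le1 x : (\int[mu]_y (k (x, y))%:E <= 1)%E.
Proof.
rewrite integral_mu//= -(int_q x); apply: ge0_le_integral => //.
- by move=> y _; rewrite lee_fin mulr_ge0.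
- by apply/measurable_EFinP; apply: measurable_funM.
- by apply/measurable_EFinP; exact: (measurableT_comp m_q (pair1_measurable x)).
- by move=> y _; rewrite lee_fin.
Qed.

Let ig_k x (S : set (Borel R d)) : measurable S ->
  (\int[mu]_y (k (x, y) * \1_S y)%:E)%E =
  (\int[lam]_(y in S) (proposal h f x y * accept lam h f x y)%:E)%E.
Proof.
move=> mS; rewrite integral_mu; last 2 first.
- by apply: measurable_funM => //; exact: measurable_indic.
- by move=> y; rewrite mulr_ge0.
rewrite [RHS]integral_mkcond; apply: eq_integral => y _.
by rewrite epatch_indic/= -EFinM -kw; congr EFin; ring.
Qed.

Let fin_k x (S : set (Borel R d)) : measurable S ->
  (\int[mu]_y (k (x, y) * \1_S y)%:E)%E \is a fin_num.
Proof.
move=> mS; rewrite ge0_fin_numE; last first.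
  by apply: integral_ge0 => y _; rewrite lee_fin mulr_ge0.
apply: le_lt_trans (ltry 1); apply: le_trans (k_le1 x).
apply: ge0_le_integral => //.
- by move=> y _; rewrite lee_fin mulr_ge0.
- by apply/measurable_EFinP; apply: measurable_funM => //; exact: measurable_indic.
- exact/measurable_EFinP.
- by move=> y _; rewrite lee_fin ler_piMr// indicE lern1 leq_b1.
Qed.

Let kernelE x S : measurable S ->
  mala_kernel lam h f x S = (metropolis mu k \1_S x)%:E.
Proof.
move=> mS; rewrite /mala_kernel -!ig_k// /metropolis EFinD EFinM EFinB; congr (_ + _ * _)%E.
  by rewrite /Rintegral fineK//; exact: fin_k.
congr (1 - _)%E; rewrite /Rintegral.
have E : (\int[mu]_y (k (x, y) * \1_setT y)%:E = \int[mu]_y (k (x, y))%:E)%E.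
  by apply: eq_integral => y _; rewrite indicE in_setT mulr1.
by rewrite E fineK// -E; exact: fin_k.
Qed.

Section start.
Variables (g1 : R -> R) (v : R).
Hypotheses (mg1 : measurable_fun setT g1) (g1_le : forall t, `|g1 t| <= 1).
Hypothesis g1_mean : (\int[lebesgue_measure]_t (w1 t * (1 + g1 t))%:E = 1)%E.
Hypothesis g1_var : (\int[lebesgue_measure]_t (w1 t * g1 t ^+ 2)%:E = v%:E)%E.
Hypothesis v0 : 0 < v.

Let g (x : Borel R d) := g1 ((x : Rd R d) ord0 i0).

Let bg : bmeas g.
Proof.
split; last by exists 1 => x; exact: g1_le.
by apply: measurableT_comp => //; exact: measurable_coord.
Qed.

Let g_ge x : 0 <= 1 + g x.
Proof. by have := g1_le ((x : Rd R d) ord0 i0); rewrite ler_norml /g => /andP[]; lra. Qed.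

Let marginal (G : R -> R) c : measurable_fun setT G -> (forall t, 0 <= G t) ->
  (\int[lebesgue_measure]_t (w1 t * G t)%:E = c%:E)%E ->
  (\int[mu]_x (G ((x : Rd R d) ord0 i0))%:E = c%:E)%E.
Proof.
move=> mG G0 Gc; rewrite integral_mu//; last first.
  by apply: measurableT_comp => //; exact: measurable_coord.
transitivity (\int[lam]_x (\prod_(i < d) (if i == i0 then fun t => w1 t * G t else w1)
   ((x : Rd R d) ord0 i))%:E)%E.
  apply: eq_integral => x _; congr EFin; rewrite /w [RHS](bigD1 i0)//= eqxx.
  rewrite (bigD1 i0)//= mulrCA mulrA; congr (_ * _).
  by apply: eq_bigr => i /negbTE ->.
rewrite (tensor_integral lamE (f := fun i => if i == i0 then fun t => w1 t * G t else w1)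
  (c := fun i => if i == i0 then c else 1)).
- congr EFin; rewrite (bigD1 i0)//= eqxx big1 ?mulr1//.
  by move=> i /negbTE ->.
- move=> i; case: ifP => _; last exact: measurable_w1.
  by apply: measurable_funM => //; exact: measurable_w1.
- by move=> i t; case: ifP => _; [apply: mulr_ge0 => //|]; exact: w1_ge0.
- by move=> i; case: ifP => // _; exact: integral_w1.
Qed.

Let b1g := bmeasD (bmeas_cst (1 : R)) bg.

Let mu0 := density_measure mu b1g.1 g_ge.

Let mu0T : mu0 setT = 1%E.
Proof.
rewrite /mu0 /density_measure (marginal (G := fun t => 1 + g1 t) (c := 1))//.
  by apply: measurable_funD.
by move=> t; have := g1_le t; rewrite ler_norml => /andP[]; lra.
Qed.

HB.instance Definition _ := Measure.on mu0.
HB.instance Definition _ := Measure_isProbability.Build _ _ _ mu0 mu0T.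

Let targetE : target lam f = mu.
Proof. by apply/funext => S; rewrite /target densityE. Qed.

(** [|g| <= 1] bounds the density [1 + g] by [2]. *)
Let mu0_warm M : 2 <= M -> warm lam M f (mu0 : set _ -> \bar R).
Proof.
move=> M2 S mS; rewrite targetE.
apply: (@le_trans _ _ (\int[mu]_(x in S) (cst M%:E x))%E).
  apply: ge0_le_integral => //.
  - by move=> x _; rewrite lee_fin.
  - by apply/measurable_EFinP; apply: measurable_funTS; exact: b1g.1.
  - move=> x _; rewrite lee_fin.
    by have := g1_le ((x : Rd R d) ord0 i0); rewrite ler_norml /g /= => /andP[]; lra.
by rewrite integral_cst.
Qed.

Let Egg : \int[mu]_x (g x * g x) = v.
Proof.
rewrite /Rintegral (marginal (G := fun t => g1 t * g1 t) (c := v))//.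
- exact: measurable_funM.
- by move=> t; rewrite -expr2 sqr_ge0.
Qed.

Let tv_bound n eps rho : 0 < rho -> rho <= 1 ->
  (\int[mu]_x \int[mu]_y (k (x, y) * (g x - g y) ^+ 2)%:E <= (2 * ((1 - rho) * v))%:E)%E ->
  tv_le eps (mala_law lam h f mu0 n) (target lam f) ->
  rho ^+ n.+1 * v <= 2 * eps.
Proof.
move=> rho0 rho1 dir tv; rewrite -Egg.
apply: (tv_lower_bound m_k k_ge0 k_sym k_le1 bg _ _ _ rho0 rho1 _ _ (n := n)
  (law := fun n => mala_law lam h f mu0 n)).
- by move=> x; exact: g1_le.
- move=> S mS /=; rewrite EFin_expect; last by apply: bmeasM => //; exact: bmeas_indic.
  rewrite /mu0 /density_measure integral_mkcond; apply: eq_integral => x _.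
  by rewrite epatch_indic/= EFinM muleC.
- by move=> m S mS /=; rewrite (funext (fun x => kernelE x mS)).
- by rewrite Egg.
- apply: le_trans (metropolis_dirichlet m_k k_ge0 k_sym k_le1 bg dir).
  by rewrite Egg; lra.
- by move: tv; rewrite targetE.
Qed.

(** The start [mu0] alone bounds the supremum from below. If it never comes within [eps] of the
    target, its mixing time is the infimum of the empty set, [+oo]. *)
Let sup_bound eps rho M t : 2 <= M -> 0 < rho -> rho <= 1 ->
  (\int[mu]_x \int[mu]_y (k (x, y) * (g x - g y) ^+ 2)%:E <= (2 * ((1 - rho) * v))%:E)%E ->
  (forall n : nat, rho ^+ n.+1 * v <= 2 * eps -> t <= n%:R) ->
  (t%:E <= ereal_sup [set tau_TV lam h f eps (nu : set (Borel R d) -> \bar R)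
             | nu in [set nu : probability (Borel R d) R | warm lam M f nu]])%E.
Proof.
move=> M2 rho0 rho1 dir tn.
apply: (@le_trans _ _ (tau_TV lam h f eps (mu0 : set (Borel R d) -> \bar R))).
  apply: le_ereal_inf_tmp => _ [n /= tv <-].
  by rewrite lee_fin; apply: tn; exact: tv_bound.
by apply: ereal_sup_ubound; exists mu0 => //; exact: mu0_warm.
Qed.

Let m_kg : measurable_fun setT
  (fun p : Borel R d * Borel R d => (k p * (g p.1 - g p.2) ^+ 2)%:E).
Proof.
apply/measurable_EFinP; apply: measurable_funM; first exact: m_k.
apply: measurable_funX; apply: measurable_funB.
  exact: (measurableT_comp bg.1 measurable_fst).
exact: (measurableT_comp bg.1 measurable_snd).
Qed.

Let kg_ge0 p : 0 <= k p * (g p.1 - g p.2) ^+ 2.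
Proof. by rewrite mulr_ge0// sqr_ge0. Qed.

(** A product majorant of the accepted flow, weighted by the squared increment of [g], reduces the
    Dirichlet form to one-dimensional double integrals. *)
Let dirichlet_le (F : 'I_d -> R -> R -> R) (c : 'I_d -> R) :
  (forall i, measurable_fun setT (fun p : R * R => F i p.1 p.2)) ->
  (forall i s t, 0 <= F i s t) ->
  (forall i s, (\int[lebesgue_measure]_t (F i s t)%:E < +oo)%E) ->
  (forall i, (\int[lebesgue_measure]_s \int[lebesgue_measure]_t (F i s t)%:E = (c i)%:E)%E) ->
  (forall x y : Borel R d, k (x, y) * (g x - g y) ^+ 2 * w y * w x <=
    \prod_(i < d) F i ((x : Rd R d) ord0 i) ((y : Rd R d) ord0 i)) ->
  (\int[mu]_x \int[mu]_y (k (x, y) * (g x - g y) ^+ 2)%:E <= (\prod_(i < d) c i)%:E)%E.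
Proof.
move=> mF F0 Foo cE kF.
have [mP <-] := tensor_integral_pair lamE mF F0 Foo cE.
have mI : measurable_fun setT
    (fun x => \int[mu]_y (k (x, y) * (g x - g y) ^+ 2)%:E)%E.
  apply: (@measurable_fun_fubini_tonelli_F _ _ _ _ _ mu
    (fun p : Borel R d * Borel R d => (k p * (g p.1 - g p.2) ^+ 2)%:E)) => //.
have I0 x : (0 <= \int[mu]_y (k (x, y) * (g x - g y) ^+ 2)%:E)%E.
  by apply: integral_ge0 => y _; rewrite lee_fin; exact: (kg_ge0 (x, y)).
rewrite ge0_integral_density//.
have m_kgx x : measurable_fun setT (fun y => k (x, y) * (g x - g y) ^+ 2).
  by apply/measurable_EFinP; exact: (measurableT_comp m_kg (pair1_measurable x)).
apply: ge0_le_integral => //.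
- by move=> x _; rewrite mule_ge0// lee_fin.
- by apply: emeasurable_funM => //; exact/measurable_EFinP.
move=> x _; rewrite integral_mu//.
rewrite -ge0_integralZr//.
- apply: ge0_le_integral => //.
  + by move=> y _; rewrite -EFinM lee_fin mulr_ge0// mulr_ge0//; exact: (kg_ge0 (x, y)).
  + apply: emeasurable_funM => //; apply/measurable_EFinP.
    exact: measurable_funM.
  + apply/measurable_EFinP; apply: measurable_prod => i _.
    have H := measurableT_comp (mF i) (pair1_measurable ((x : Rd R d) ord0 i)).
    exact: (measurableT_comp H (measurable_coord i)).
  + by move=> y _; rewrite -EFinM lee_fin.
- by apply/measurable_EFinP; exact: measurable_funM.
- by move=> y _; rewrite lee_fin mulr_ge0//; exact: (kg_ge0 (x, y)).
- by rewrite lee_fin.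
Qed.

(** Bounding the acceptance probability by [1] leaves the flow of proposals: every coordinate but
    [i0] integrates to [1], and [i0] contributes a one-dimensional Dirichlet form. This is sharp
    enough when the moves are short. *)
Lemma mala_dirichlet_bound eps rho M t : 2 <= M -> 0 < rho -> rho <= 1 ->
  (\int[lebesgue_measure]_x \int[lebesgue_measure]_y
     (w1 x * q1 x y * (g1 x - g1 y) ^+ 2)%:E <= (2 * ((1 - rho) * v))%:E)%E ->
  (forall n : nat, rho ^+ n.+1 * v <= 2 * eps -> t <= n%:R) ->
  (t%:E <= ereal_sup [set tau_TV lam h f eps (nu : set (Borel R d) -> \bar R)
             | nu in [set nu : probability (Borel R d) R | warm lam M f nu]])%E.
Proof.
move=> M2 rho0 rho1 dir; apply: sup_bound => //.
pose p1 x y := w1 x * q1 x y.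
pose pg x y := p1 x y * (g1 x - g1 y) ^+ 2.
have p1_ge0 x y : 0 <= p1 x y by rewrite mulr_ge0// ?w1_ge0// q1_ge0.
have pg_ge0 x y : 0 <= pg x y by rewrite mulr_ge0// sqr_ge0.
have int_p1 s : (\int[lebesgue_measure]_t (p1 s t)%:E = (w1 s)%:E)%E.
  under eq_integral do rewrite EFinM.
  rewrite ge0_integralZl//.
  - by rewrite integral_q1// mule1.
  - by apply/measurable_EFinP; exact: measurable_q1r.
  - by move=> t' _; rewrite lee_fin q1_ge0.
  - by rewrite lee_fin w1_ge0.
have m_p1 : measurable_fun setT (fun p : R * R => p1 p.1 p.2).
  apply: measurable_funM; last exact: measurable_q1.
  exact: (measurableT_comp (measurable_w1 _ mphi) measurable_fst).
have m_pg : measurable_fun setT (fun p : R * R => pg p.1 p.2).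
  apply: measurable_funM => //; apply: measurable_funX; apply: measurable_funB.
    exact: (measurableT_comp mg1 measurable_fst).
  exact: (measurableT_comp mg1 measurable_snd).
have [D DE] : exists D, (\int[lebesgue_measure]_x \int[lebesgue_measure]_y (pg x y)%:E = D%:E)%E.
  exists (fine (\int[lebesgue_measure]_x \int[lebesgue_measure]_y (pg x y)%:E)%E); rewrite fineK// ge0_fin_numE.
    by apply: (le_lt_trans dir); exact: ltry.
  by apply: integral_ge0 => x _; apply: integral_ge0 => y _; rewrite lee_fin.
apply: le_trans (dirichlet_le (F := fun i => if i == i0 then pg else p1)
   (c := fun i => if i == i0 then D else 1) _ _ _ _ _) _.
- by move=> i; case: ifP.
- by move=> i s t'; case: ifP.
- move=> i s; case: ifP => _; last by rewrite int_p1 ltry.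
  apply: (@le_lt_trans _ _ (\int[lebesgue_measure]_t (4 * p1 s t)%:E)%E).
    have mp1s := measurableT_comp m_p1 (pair1_measurable s).
    apply: ge0_le_integral => //.
    + by move=> t' _; rewrite lee_fin.
    + by apply/measurable_EFinP; exact: (measurableT_comp m_pg (pair1_measurable s)).
    + by apply/measurable_EFinP; exact: measurable_funM.
    + move=> t' _; rewrite lee_fin /pg [leRHS]mulrC ler_wpM2l//.
      exact: sqr_diff_le4.
  under eq_integral do rewrite EFinM.
  rewrite ge0_integralZl//.
  + by rewrite int_p1 -EFinM ltry.
  + by apply/measurable_EFinP; exact: (measurableT_comp m_p1 (pair1_measurable s)).
  + by move=> t' _; rewrite lee_fin.
- move=> i; case: ifP => // _.
  under eq_integral do rewrite int_p1.
  exact: integral_w1.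
- move=> x y; have -> : \prod_(i < d) (if i == i0 then pg else p1) ((x : Rd R d) ord0 i)
      ((y : Rd R d) ord0 i) = (w x * q x y) * (g x - g y) ^+ 2.
    rewrite /w /q -big_split/= (bigD1 i0)//= eqxx [in RHS](bigD1 i0)//= /pg /p1 /g.
    rewrite -[RHS]mulrA [X in _ = _ * X]mulrC [RHS]mulrA; congr (_ * _).
    by apply: eq_bigr => i /negbTE ->.
  rewrite (_ : _ * w x = (k (x, y) * w y) * w x * (g x - g y) ^+ 2); last by ring.
  by rewrite ler_wpM2r ?sqr_ge0// mulrC ler_wpM2l.
- rewrite (bigD1 i0)//= eqxx big1 ?mulr1; last by move=> i /negbTE ->.
  by rewrite -DE.
Qed.

(** The squared increment of [g] is at most [4], and the accepted flow is at most the product of the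
    [r1], so the Dirichlet form is at most [4 * a ^+ d]. This suits large steps, where nearly every
    move is rejected. *)
Lemma mala_affinity_bound eps rho M t a : 2 <= M -> 0 < rho -> rho <= 1 ->
  (\int[lebesgue_measure]_x \int[lebesgue_measure]_y (r1 x y)%:E <= a%:E)%E ->
  4 * a ^+ d <= 2 * ((1 - rho) * v) ->
  (forall n : nat, rho ^+ n.+1 * v <= 2 * eps -> t <= n%:R) ->
  (t%:E <= ereal_sup [set tau_TV lam h f eps (nu : set (Borel R d) -> \bar R)
             | nu in [set nu : probability (Borel R d) R | warm lam M f nu]])%E.
Proof.
move=> M2 rho0 rho1 aff ad; apply: sup_bound => //.
have m_r1 := measurable_r1 h Z1 mphi mdphi.
have r1_0 x y : 0 <= r1 x y by exact: r1_ge0.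
have [D DE] : exists D, (\int[lebesgue_measure]_x \int[lebesgue_measure]_y (r1 x y)%:E = D%:E)%E.
  exists (fine (\int[lebesgue_measure]_x \int[lebesgue_measure]_y (r1 x y)%:E)%E); rewrite fineK// ge0_fin_numE.
    by apply: (le_lt_trans aff); exact: ltry.
  by apply: integral_ge0 => x _; apply: integral_ge0 => y _; rewrite lee_fin.
have D0 : 0 <= D.
  rewrite -lee_fin -DE.
  by apply: integral_ge0 => x _; apply: integral_ge0 => y _; rewrite lee_fin.
have Da : D <= a by rewrite -lee_fin -DE.
have r1_lty s : (\int[lebesgue_measure]_t (r1 s t)%:E < +oo)%E.
  pose C := powR (4 * pi * h) (- (1 / 2)).
  (* A geometric mean is at most the sum, and the backward proposal [q1 t s] is at most its peak
     [C], so the majorant is integrable in [t]. *)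
  apply: (@le_lt_trans _ _ (\int[lebesgue_measure]_t ((w1 s)%:E * (q1 s t)%:E + C%:E * (w1 t)%:E))%E).
    apply: ge0_le_integral => //.
    + by move=> t' _; rewrite lee_fin.
    + by apply/measurable_EFinP; exact: (measurableT_comp m_r1 (pair1_measurable s)).
    + apply: emeasurable_funD; apply: emeasurable_funM => //; apply/measurable_EFinP.
        exact: measurable_q1r.
      exact: measurable_w1.
    + move=> t' _; rewrite -!EFinM -EFinD lee_fin.
      have q1C : q1 t' s <= C.
        rewrite /q1 ler_piMr ?powR_ge0// -expR0 ler_expR mulNr oppr_le0.
        by rewrite divr_ge0 ?sqr_ge0// mulr_ge0// ltW.
      have P0 : 0 <= w1 s * q1 s t' by rewrite mulr_ge0 ?w1_ge0 ?q1_ge0.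
      have W0 : 0 <= w1 t' by exact: w1_ge0.
      apply: (@le_trans _ _ (w1 s * q1 s t' + w1 t' * q1 t' s)); last first.
        by rewrite lerD2l [leRHS]mulrC ler_wpM2l.
      have Q0 : 0 <= w1 t' * q1 t' s by rewrite mulr_ge0// q1_ge0.
      rewrite -ler_sqr ?nnegrE ?addr_ge0// r1_sqr//.
      by nra.
  rewrite ge0_integralD//.
  + rewrite ge0_integralZl//; last 3 first.
      by apply/measurable_EFinP; exact: measurable_q1r.
      by move=> t' _; rewrite lee_fin q1_ge0.
      by rewrite lee_fin w1_ge0.
    rewrite ge0_integralZl//; last 3 first.
      by apply/measurable_EFinP; exact: measurable_w1.
      by move=> t' _; rewrite lee_fin w1_ge0.
      by rewrite lee_fin powR_ge0.
    by rewrite integral_q1// integral_w1// -!EFinM -EFinD ltry.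
  + by move=> t' _; rewrite -EFinM lee_fin mulr_ge0 ?w1_ge0 ?q1_ge0.
  + by apply: emeasurable_funM => //; apply/measurable_EFinP; exact: measurable_q1r.
  + by move=> t' _; rewrite -EFinM lee_fin mulr_ge0 ?powR_ge0 ?w1_ge0.
  + by apply: emeasurable_funM => //; apply/measurable_EFinP; exact: measurable_w1.
(* The constant [4] is attached to the factor [i0], so that the majorant remains a product. *)
apply: le_trans (dirichlet_le (F := fun i x y => (if i == i0 then 4 else 1) * r1 x y)
   (c := fun i => (if i == i0 then 4 else 1) * D) _ _ _ _ _) _.
- by move=> i; exact: measurable_funM.
- by move=> i s t'; rewrite mulr_ge0//; case: ifP.
- move=> i s; under eq_integral do rewrite EFinM.
  rewrite ge0_integralZl//.
  + by apply: lte_mul_pinfty => //; case: ifP; rewrite lee_fin.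
  + by apply/measurable_EFinP; exact: (measurableT_comp m_r1 (pair1_measurable s)).
  + by move=> t' _; rewrite lee_fin.
  + by case: ifP; rewrite lee_fin.
- move=> i; under eq_integral => s _.
    under eq_integral do rewrite EFinM.
    rewrite ge0_integralZl//; last 3 first.
      by apply/measurable_EFinP; exact: (measurableT_comp m_r1 (pair1_measurable s)).
      by move=> t' _; rewrite lee_fin.
      by case: ifP; rewrite lee_fin.
    over.
  rewrite ge0_integralZl//; last 3 first.
  + apply: (@measurable_fun_fubini_tonelli_F _ _ _ _ _ lebesgue_measure
      (fun p : R * R => (r1 p.1 p.2)%:E)).
      by apply/measurable_EFinP; exact: m_r1.
    by move=> x; rewrite lee_fin.
  + by move=> x _; apply: integral_ge0 => y _; rewrite lee_fin.
  + by case: ifP; rewrite lee_fin.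
  by rewrite DE.
- move=> x y; rewrite big_split/=.
  have -> : \prod_(i < d) (if i == i0 then 4 else 1) = 4 :> R.
    by rewrite (bigD1 i0)//= eqxx big1 ?mulr1// => i /negbTE ->.
  rewrite (_ : _ * w x = (g x - g y) ^+ 2 * (k (x, y) * w y * w x)); last by ring.
  apply: ler_pM.
  + exact: sqr_ge0.
  + by rewrite mulr_ge0// mulr_ge0.
  + exact: sqr_diff_le4 (g1_le _) (g1_le _).
  + have Z0 : 0 <= k (x, y) * w y * w x by rewrite mulr_ge0// mulr_ge0.
    have P0 : 0 <= \prod_(i < d) r1 ((x : Rd R d) ord0 i) ((y : Rd R d) ord0 i).
      by apply: prodr_ge0 => i _.
    (* Squaring turns the product of the [r1] into the product of the forward and backward flows,
       each of which bounds the accepted flow. *)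
    rewrite -ler_sqr ?nnegrE// -prodrXl.
    have -> : \prod_(i < d) r1 ((x : Rd R d) ord0 i) ((y : Rd R d) ord0 i) ^+ 2 =
        (w x * q x y) * (w y * q y x).
      by rewrite /w /q -!big_split/=; apply: eq_bigr => i _; rewrite r1_sqr.
    rewrite expr2; apply: ler_pM => //.
      by rewrite [leLHS]mulrC; apply: ler_wpM2l.
    by rewrite k_sym mulrAC [leLHS]mulrC; apply: ler_wpM2l.
- rewrite big_split/= prodr_const card_ord (bigD1 i0)//= eqxx big1 ?mulr1; last by move=> i /negbTE ->.
  rewrite lee_fin; apply: le_trans ad; rewrite ler_pM2l// lerXn2r// nnegrE.
  exact: le_trans D0 Da.
Qed.

End start.

End separable_mala.

(** * Smoothness and strong convexity of separable potentials *)

Section tangent.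
Context (R : realType).
Implicit Types (g dg phi dphi : R -> R) (x y : R).

Lemma is_derive_MVT g dg x y : (forall x : R, is_derive x 1 g (dg x)) -> x <= y ->
  exists2 c, x <= c <= y & g y - g x = dg c * (y - x).
Proof.
move=> gd xy.
have [|c] := @MVT_segment R g dg x y xy (fun x _ => gd x).
  apply: derivable_within_continuous => z _.
  exact: (@ex_derive _ _ _ _ _ _ _ (gd z)).
by rewrite in_itv/=; exists c.
Qed.

Lemma tangent_le g dg x y : (forall x : R, is_derive x 1 g (dg x)) ->
  {homo dg : x y / x <= y} -> g x + dg x * (y - x) <= g y.
Proof.
move=> gd ndg; have [xy|/ltW yx] := leP x y.
  have [c /andP[xc _] gE] := is_derive_MVT gd xy.
  have : dg x * (y - x) <= dg c * (y - x) by rewrite ler_wpM2r ?subr_ge0// ndg.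
  by lra.
have [c /andP[_ cx] gE] := is_derive_MVT gd yx.
have : dg c * (x - y) <= dg x * (x - y) by rewrite ler_wpM2r ?subr_ge0// ndg.
by lra.
Qed.

Let is_derive_sqr (a x : R) : is_derive x 1 (fun x : R => a / 2 * x ^+ 2) (a * x).
Proof.
apply: is_derive_eq; rewrite /GRing.scale/=. by field.
Qed.

(** [phi x - m / 2 * x ^ 2] has a nondecreasing derivative, so it lies above its tangents. Negative
    [m] is allowed: it gives the upper bound below, through [- phi], and a lower bound for the
    sine. *)
Lemma tangent_ge_sqr phi dphi m x y : (forall x : R, is_derive x 1 phi (dphi x)) ->
  (forall x y, x <= y -> m * (y - x) <= dphi y - dphi x) ->
  phi x + dphi x * (y - x) + m / 2 * (y - x) ^+ 2 <= phi y.
Proof.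
move=> pd H.
have gd (z : R) : is_derive z 1 (fun z : R => phi z - m / 2 * z ^+ 2) (dphi z - m * z).
  by apply: is_deriveB.
have := tangent_le x y gd; rewrite /=.
have nd : {homo (fun z => dphi z - m * z) : x y / x <= y}.
  by move=> s t st; have := H _ _ st; lra.
move=> /(_ nd); rewrite (_ : m / 2 * (y - x) ^+ 2 = m / 2 * y ^+ 2 - m / 2 * x ^+ 2 - m * x * (y - x)); last by field.
lra.
Qed.

Lemma tangent_le_sqr phi dphi L x y : (forall x : R, is_derive x 1 phi (dphi x)) ->
  (forall x y, x <= y -> dphi y - dphi x <= L * (y - x)) ->
  phi y <= phi x + dphi x * (y - x) + L / 2 * (y - x) ^+ 2.
Proof.
move=> pd H.
have pd' (z : R) : is_derive z 1 (fun z : R => - phi z) (- dphi z) by apply: is_deriveN.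
have H' s t : s <= t -> (- L) * (t - s) <= - dphi t - - dphi s.
  by move=> st; have := H _ _ st; lra.
have := tangent_ge_sqr x y pd' H'; rewrite /=; lra.
Qed.

End tangent.

Section separable_classA.
Context (R : realType) (d : nat).
Variables (phi dphi ddphi : R -> R).
Hypothesis phiD : forall x : R, is_derive x 1 phi (dphi x).
Hypothesis dphiD : forall x : R, is_derive x 1 dphi (ddphi x).

Local Notation f := (@separable R d phi).

Let diff_comp_coord (g dg : R -> R) (i : 'I_d) x : (forall x : R, is_derive x 1 g (dg x)) ->
  differentiable (fun x : Rd R d => g (x ord0 i)) x.
Proof.
move=> gd; apply: (differentiable_comp (f := fun x : Rd R d => x ord0 i)).
  exact: differentiable_coord.
apply/derivable1_diffP; exact: (@ex_derive _ _ _ _ _ _ _ (gd _)).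
Qed.

Let separableE : f = \sum_(i < d) (fun x : Rd R d => phi (x ord0 i)).
Proof. by apply/funext => x; rewrite fct_sumE. Qed.

Let diff_f x : differentiable f x.
Proof. by rewrite separableE; apply: differentiable_sum => i; exact: diff_comp_coord. Qed.

Lemma separable_grad x : grad f x = \row_i dphi (x ord0 i).
Proof.
apply/rowP => i; rewrite !mxE -deriveE//.
have D j : 'D_(delta_mx ord0 i : Rd R d) (fun x : Rd R d => phi (x ord0 j)) x =
    (i == j)%:R * dphi (x ord0 j).
  have -> : 'D_(delta_mx ord0 i : Rd R d) (fun x : Rd R d => phi (x ord0 j)) x =
      'D_((i == j)%:R : R) phi (x ord0 j).
    rewrite /derive; set F := (X in lim (X @ _)); set G := (X in _ = lim (X @ _)).
    suff -> : F = G by [].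
    by apply/funext => t; rewrite /F /G /= !mxE eqxx/= eq_sym.
  have df : differentiable phi (x ord0 j).
    by apply/derivable1_diffP; exact: (@ex_derive _ _ _ _ _ _ _ (phiD _)).
  rewrite deriveE// diff1E// derive1E.
  by rewrite (@derive_val _ _ _ _ _ _ _ (phiD (x ord0 j))).
rewrite separableE derive_sum; last by move=> j; apply: diff_derivable; exact: diff_comp_coord.
under eq_bigr do rewrite D.
by rewrite (bigD1 i)//= eqxx mul1r big1 ?addr0// => j /negbTE; rewrite eq_sym => ->; rewrite mul0r.
Qed.

Let diff_grad x : differentiable (grad f) x.
Proof.
have -> : grad f = \sum_(i < d) (fun x : Rd R d => dphi (x ord0 i) *: (delta_mx ord0 i : Rd R d)).
  apply/funext => y; rewrite separable_grad fct_sumE; apply/rowP => i.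
  rewrite mxE summxE (bigD1 i)//= !mxE !eqxx mulr1 big1 ?addr0// => j ji.
  by rewrite !mxE eqxx/= eq_sym (negbTE ji) mulr0.
apply: differentiable_sum => i; apply: differentiableZl.
exact: diff_comp_coord.
Qed.

Lemma separable_classA (L m : R) :
  (forall x y, x <= y -> m * (y - x) <= dphi y - dphi x) ->
  (forall x y, x <= y -> dphi y - dphi x <= L * (y - x)) ->
  classA L m f.
Proof.
move=> Hm HL; split; first by split.
by split=> x y; rewrite separable_grad /sqnorm /dotv mulr_sumr /separable -!big_split/=;
  apply: ler_sum => i _; rewrite !mxE -expr2;
  [exact: tangent_le_sqr|exact: tangent_ge_sqr].
Qed.

End separable_classA.

(** * Bounds on the sine and Gaussian integrals *)

Section trigonometry.
Context (R : realType).
Implicit Types x y : R.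

Lemma dist_sin_le x y : `|sin y - sin x| <= `|y - x|.
Proof.
wlog xy : x y / x <= y.
  move=> H; have [xy|/ltW yx] := leP x y; first exact: H.
  by rewrite distrC (distrC y); exact: H.
have [c _ ->] := is_derive_MVT (fun x => is_derive_sin x) xy.
by rewrite normrM ler_piMl// ler_norml cos_geN1 cos_le1.
Qed.

Lemma dist_cos_le x y : `|cos y - cos x| <= `|y - x|.
Proof.
wlog xy : x y / x <= y.
  move=> H; have [xy|/ltW yx] := leP x y; first exact: H.
  by rewrite distrC (distrC y); exact: H.
have [c _ ->] := is_derive_MVT (fun x => is_derive_cos x) xy.
by rewrite normrM normrN ler_piMl// ler_norml sin_geN1 sin_le1.
Qed.

(** The cosine is [1]-Lipschitz, so [tangent_ge_sqr] applies at [0] with [m = - 1]. *)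
Lemma sin_ge_quad x : 0 <= x -> x - x ^+ 2 / 2 <= sin x.
Proof.
move=> x0.
have H (s t : R) : s <= t -> (- 1) * (t - s) <= cos t - cos s.
  move=> st; have := dist_cos_le s t; rewrite (@ger0_norm _ (t - s)) ?subr_ge0//.
  by rewrite ler_norml => /andP[]; lra.
have := tangent_ge_sqr 0 x (fun x => is_derive_sin x) H.
by rewrite sin0 cos0; lra.
Qed.

End trigonometry.

Section gaussian_integrals.
Context (R : realType).
Local Notation leb := (@lebesgue_measure R).
Implicit Types b c m : R.

Lemma integral_gauss_center b m : 0 < b ->
  (\int[leb]_x (expR (- (b * (x - m) ^+ 2)))%:E = (Num.sqrt (pi / b))%:E)%E.
Proof.
move=> b0; pose s : R := Num.sqrt (2 * b)^-1.
have s2 : s ^+ 2 = (2 * b)^-1 by rewrite sqr_sqrtr// invr_ge0 mulr_ge0// ltW.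
have s0 : s != 0 by rewrite gt_eqF// sqrtr_gt0 invr_gt0 mulr_gt0.
have pb0 : 0 < Num.sqrt (pi / b) by rewrite sqrtr_gt0 divr_gt0 ?pi_gt0.
transitivity (\int[leb]_x ((Num.sqrt (pi / b))%:E * (normal_pdf m s x)%:E))%E.
  apply: eq_integral => x _; rewrite -EFinM normal_pdfE// /normal_fun /normal_peak s2.
  congr EFin.
  rewrite (_ : (2 * b)^-1 * pi *+ 2 = pi / b); last by field; rewrite gt_eqF.
  rewrite [RHS]mulrA divff ?gt_eqF// mul1r; congr expR.
  by field; rewrite gt_eqF.
rewrite ge0_integralZl//.
- by rewrite integral_normal_pdf mule1.
- by apply/measurable_EFinP; exact: measurable_normal_pdf.
- by move=> x _; rewrite lee_fin normal_pdf_ge0.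
Qed.

Lemma integral_gauss b c : 0 < b ->
  (\int[leb]_x (expR (- (b * x ^+ 2) + c * x))%:E
   = (Num.sqrt (pi / b) * expR (c ^+ 2 / (4 * b)))%:E)%E.
Proof.
move=> b0.
transitivity (\int[leb]_x ((expR (c ^+ 2 / (4 * b)))%:E *
    (expR (- (b * (x - c / (2 * b)) ^+ 2)))%:E))%E.
  apply: eq_integral => x _; rewrite -EFinM -expRD; congr (expR _)%:E.
  by field; rewrite gt_eqF.
rewrite ge0_integralZl//.
- by rewrite integral_gauss_center// -EFinM mulrC.
- apply/measurable_EFinP; apply: measurableT_comp => //.
  apply: measurableT_comp => //; apply: measurable_funM => //.
  by apply: measurable_funX; exact: measurable_funB.
Qed.

Lemma integral_reflect (F : R -> R) : measurable_fun setT F -> (forall x, 0 <= F x) ->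
  (\int[leb]_x (F (- x))%:E = \int[leb]_x (F x)%:E)%E.
Proof.
move=> mF F0.
rewrite [RHS](eq_setfun_integral (m2 := pushforward leb (-%R : R -> measurableTypeR R))).
  rewrite ge0_integral_pushforward ?preimage_setT//.
    exact/measurable_EFinP.
  by move=> y _; rewrite lee_fin.
by move=> A mA; rewrite lebesgue_measureN.
Qed.

End gaussian_integrals.

(** * The one-dimensional potential and its test function *)

Section potential.
Context (R : realType).
Variables (a A h : R).
Hypotheses (a0 : 0 < a) (h0 : 0 < h) (A0 : 0 <= A).
Local Notation leb := (@lebesgue_measure R).

(** The perturbation varies on the length scale [sqrt h] of the proposal noise, and its second
    derivative is at most [A / h] in absolute value. [A = 0] is the Gaussian target. *)
Definition potential (x : R) := a / 2 * x ^+ 2 + A * cos (x / Num.sqrt h).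
Definition dpotential (x : R) := a * x - A / Num.sqrt h * sin (x / Num.sqrt h).
Definition ddpotential (x : R) := a - A / h * cos (x / Num.sqrt h).

Let s0 : 0 < Num.sqrt h. Proof. by rewrite sqrtr_gt0. Qed.

Let is_derive_scale (g dg : R -> R) (x : R) : (forall x : R, is_derive x 1 g (dg x)) ->
  is_derive x 1 (fun x => g (x / Num.sqrt h)) (dg (x / Num.sqrt h) / Num.sqrt h).
Proof.
move=> gD.
have hD : is_derive x 1 (fun x : R => x / Num.sqrt h) (Num.sqrt h)^-1.
  by apply: is_derive_eq; rewrite scaler0 add0r /GRing.scale/= mulr1.
exact: (@is_derive1_comp _ g (fun x : R => x / Num.sqrt h) _ _ _ (gD (x / Num.sqrt h)) hD).
Qed.

Let AhE : A / h = A / (Num.sqrt h * Num.sqrt h).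
Proof. by rewrite -expr2 sqr_sqrtr// ltW. Qed.

Lemma is_derive_potential (x : R) : is_derive x 1 potential (dpotential x).
Proof.
have cD := is_derive_scale x (fun x => is_derive_cos x).
rewrite /potential; apply: is_derive_eq; rewrite /GRing.scale/= /dpotential.
by field; rewrite gt_eqF.
Qed.

Lemma is_derive_dpotential (x : R) : is_derive x 1 dpotential (ddpotential x).
Proof.
have cD := is_derive_scale x (fun x => is_derive_sin x).
rewrite /dpotential; apply: is_derive_eq; rewrite /GRing.scale/= /ddpotential.
rewrite AhE.
by field; rewrite gt_eqF.
Qed.

Lemma dpotential_diff x y : x <= y ->
  (a - A / h) * (y - x) <= dpotential y - dpotential x <= (a + A / h) * (y - x).
Proof.
move=> xy.
have := dist_sin_le (x / Num.sqrt h) (y / Num.sqrt h).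
rewrite -mulrBl normrM (ger0_norm (_ : 0 <= y - x)) ?subr_ge0//.
rewrite (ger0_norm (_ : 0 <= (Num.sqrt h)^-1)); last by rewrite invr_ge0 ltW.
rewrite ler_norml => /andP[lo up].
have c0 : 0 <= A / Num.sqrt h by rewrite divr_ge0// ltW.
have E : A / h * (y - x) = A / Num.sqrt h * ((y - x) / Num.sqrt h).
  by rewrite AhE; field; rewrite gt_eqF.
have := ler_wpM2l c0 lo; have := ler_wpM2l c0 up.
rewrite /dpotential mulrN -E !mulrBl !mulrDl E.
set u := sin _; set v := sin _; set k := A / Num.sqrt h => H1 H2.
apply/andP; split; lra.
Qed.

Lemma measurable_potential : measurable_fun setT potential.
Proof.
apply: continuous_measurable_fun => x.
by apply: differentiable_continuous; apply/derivable1_diffP;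
  exact: (@ex_derive _ _ _ _ _ _ _ (is_derive_potential x)).
Qed.

Lemma measurable_dpotential : measurable_fun setT dpotential.
Proof.
apply: continuous_measurable_fun => x.
by apply: differentiable_continuous; apply/derivable1_diffP;
  exact: (@ex_derive _ _ _ _ _ _ _ (is_derive_dpotential x)).
Qed.

Lemma potentialN x : potential (- x) = potential x.
Proof. by rewrite /potential sqrrN mulNr cosN. Qed.

Lemma potential_le x : potential x <= a / 2 * x ^+ 2 + A.
Proof. by rewrite lerD2l ler_piMr// cos_le1. Qed.

Lemma potential_ge x : a / 2 * x ^+ 2 - A <= potential x.
Proof. by rewrite lerD2l -mulrN1 ler_wpM2l// cos_geN1. Qed.

Local Notation G := (Num.sqrt (2 * pi / a)).

Let G0 : 0 < G.
Proof. by rewrite sqrtr_gt0 divr_gt0// mulr_gt0// pi_gt0. Qed.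

Let gaussE c : (\int[leb]_x (expR c * expR (- (a / 2 * x ^+ 2)))%:E = (expR c * G)%:E)%E.
Proof.
under eq_integral do rewrite EFinM.
rewrite ge0_integralZl//.
- have := @integral_gauss R (a / 2) 0; rewrite expr0n/= mul0r expR0 mulr1.
  under eq_integral do rewrite mul0r addr0.
  move=> ->; last by rewrite divr_gt0.
  by rewrite -EFinM; congr (_ * Num.sqrt _)%:E; field; rewrite gt_eqF.
- apply/measurable_EFinP; apply: measurableT_comp => //.
  apply: measurableT_comp => //; exact: measurable_funM.
Qed.

Let mexp : measurable_fun setT (fun x => (expR (- potential x))%:E).
Proof.
apply/measurable_EFinP; apply: measurableT_comp => //; apply: measurableT_comp => //.
exact: measurable_potential.
Qed.

Let mgauss c : measurable_fun setT (fun x : R => (expR c * expR (- (a / 2 * x ^+ 2)))%:E).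
Proof.
apply/measurable_EFinP; apply: measurable_funM => //; apply: measurableT_comp => //.
apply: measurableT_comp => //; exact: measurable_funM.
Qed.

(** The perturbation is at most [A] in absolute value, so the integrand lies between two multiples
    of a Gaussian. For [A = 0] the two bounds coincide and determine [Z]. *)
Lemma potential_Z : exists Z,
  [/\ (\int[leb]_x (expR (- potential x))%:E = Z%:E)%E, expR (- A) * G <= Z & Z <= expR A * G].
Proof.
have up : (\int[leb]_x (expR (- potential x))%:E <= (expR A * G)%:E)%E.
  rewrite -gaussE; apply: ge0_le_integral => //.
  - exact: mgauss.
  - by move=> x _; rewrite lee_fin -expRD ler_expR; have := potential_ge x; lra.
have lo : ((expR (- A) * G)%:E <= \int[leb]_x (expR (- potential x))%:E)%E.
  rewrite -gaussE; apply: ge0_le_integral => //.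
  - exact: mgauss.
  - by move=> x _; rewrite lee_fin -expRD ler_expR; have := potential_le x; lra.
exists (fine (\int[leb]_x (expR (- potential x))%:E)%E).
have E : ((fine (\int[leb]_x (expR (- potential x))%:E))%:E
    = \int[leb]_x (expR (- potential x))%:E)%E.
  rewrite fineK// ge0_fin_numE; first by apply: (le_lt_trans up); exact: ltry.
  by apply: integral_ge0 => x _; rewrite lee_fin expR_ge0.
by split=> //; rewrite -lee_fin E.
Qed.

Variables (Z : R).
Hypotheses (ZE : (\int[leb]_x (expR (- potential x))%:E = Z%:E)%E).
Hypotheses (Z_ge : expR (- A) * G <= Z) (Z_le : Z <= expR A * G).

Let Z0 : 0 < Z. Proof. by apply: lt_le_trans Z_ge; rewrite mulr_gt0 ?expR_gt0. Qed.

Let sa0 : 0 < Num.sqrt a. Proof. by rewrite sqrtr_gt0. Qed.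

Let pi_le4 : (pi : R) <= 4.
Proof. by have /andP[_] := pihalf_02 R; lra. Qed.

Let G_le : G <= 3 / Num.sqrt a.
Proof.
have H3 : 0 <= 3 / Num.sqrt a by rewrite divr_ge0// ltW.
have Hp : 0 <= 2 * pi / a by rewrite ltW// divr_gt0// mulr_gt0// pi_gt0.
rewrite -ler_sqr ?nnegrE ?sqrtr_ge0// sqr_sqrtr//.
rewrite exprMn exprVn sqr_sqrtr; last exact: ltW.
apply: ler_wpM2r; first by rewrite invr_ge0 ltW.
by have := pi_le4; rewrite expr2; lra.
Qed.

(** On this interval the potential is at most [1 / 2 + A <= 3 / 2], and [Z] is at most
    [3 e / sqrt a] because [2 pi <= 9]; the two exponents add up to [5 / 2]. *)
Lemma w1_potential_ge x : A <= 1 -> 0 <= x <= (Num.sqrt a)^-1 ->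
  expR (- (5 / 2)) * (Num.sqrt a / 3) <= w1 potential Z x.
Proof.
move=> A1 /andP[x0 xa]; rewrite /w1.
have ax : a * x ^+ 2 <= 1.
  rewrite -{1}(sqr_sqrtr (ltW a0)) -exprMn -[leRHS](expr1n _ 2).
  have sax : 0 <= Num.sqrt a * x by rewrite mulr_ge0// ltW.
  rewrite lerXn2r ?nnegrE//.
  by rewrite mulrC -ler_pdivlMr// div1r.
have H1 : expR (- (3 / 2)) <= expR (- potential x).
  by rewrite ler_expR; have := potential_le x; lra.
have H2 : Z <= expR 1 * (3 / Num.sqrt a).
  by apply: (le_trans Z_le); apply: ler_pM => //; rewrite ?expR_ge0 ?ler_expR ?sqrtr_ge0.
have -> : expR (- (5 / 2)) * (Num.sqrt a / 3) =
    expR (- (3 / 2)) / (expR 1 * (3 / Num.sqrt a)) :> R.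
  rewrite invfM -expRN [RHS]mulrA -expRD invf_div; congr (expR _ * _); lra.
apply: ler_pM => //.
by rewrite lef_pV2// posrE mulr_gt0 ?expR_gt0// divr_gt0.
Qed.

(** A bounded substitute for the linear function, the slow mode of a Gaussian target. It is odd,
    hence centred under an even potential; it varies on the scale [1 / sqrt a] of the target, so its
    variance is of order [1]; and it is [sqrt a]-Lipschitz, so short moves hardly change it. *)
Definition test_fun (x : R) := sin (Num.sqrt a * x).

Lemma measurable_test_fun : measurable_fun setT test_fun.
Proof.
apply: measurableT_comp; last exact: measurable_funM.
by apply: continuous_measurable_fun; exact: continuous_sin.
Qed.

Lemma test_fun_le1 x : `|test_fun x| <= 1.
Proof. by rewrite ler_norml sin_geN1 sin_le1. Qed.

(** Reflection exchanges the integrals with [1 + test_fun] and [1 - test_fun], whose sum is [2].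
    Both integrands are nonnegative, so the signed one is never integrated. *)
Lemma test_fun_mean :
  (\int[leb]_x (w1 potential Z x * (1 + test_fun x))%:E = 1)%E.
Proof.
have mw := measurable_w1 Z measurable_potential.
have mg := measurable_test_fun.
have w0 x := w1_ge0 potential Z0 x.
have g1 x : 0 <= 1 + test_fun x /\ 0 <= 1 - test_fun x.
  by have := test_fun_le1 x; rewrite ler_norml => /andP[]; split; lra.
have mp : measurable_fun setT (fun x => w1 potential Z x * (1 + test_fun x)).
  by apply: measurable_funM => //; exact: measurable_funD.
have mm : measurable_fun setT (fun x => w1 potential Z x * (1 - test_fun x)).
  by apply: measurable_funM => //; exact: measurable_funB.
set I := (\int[leb]_x _)%E.
have IN : (\int[leb]_x (w1 potential Z x * (1 - test_fun x))%:E = I)%E.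
  rewrite /I -[RHS]integral_reflect//; last by move=> x; rewrite mulr_ge0// (g1 x).1.
  apply: eq_integral => x _; rewrite /w1 potentialN.
  by rewrite /test_fun mulrN sinN.
have I2 : (I + I = 2%:E)%E.
  rewrite -{2}IN /I -ge0_integralD//.
  - transitivity (\int[leb]_x (2%:E * (w1 potential Z x)%:E))%E.
      by apply: eq_integral => x _; rewrite -EFinD -EFinM; congr EFin; ring.
    rewrite ge0_integralZl//.
    + by rewrite integral_w1 ?mule1//; exact: measurable_potential.
    + exact/measurable_EFinP.
    + by move=> x _; rewrite lee_fin.
  - by move=> x _; rewrite lee_fin mulr_ge0// (g1 x).1.
  - exact/measurable_EFinP.
  - by move=> x _; rewrite lee_fin mulr_ge0// (g1 x).2.
  - exact/measurable_EFinP.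
move: I2; clear IN; case: I => [r| |]//=.
by rewrite -EFinD => -[r2]; congr EFin; lra.
Qed.

(** Product of the density bound of [w1_potential_ge], of [(3 / 8) ^ 2], and of the length
    [1 / (2 sqrt a)] of the interval where [t = sqrt a * x] runs over [[1 / 2, 1]]. There
    [sin t >= t - t ^ 2 / 2 >= 3 / 8]. *)
Definition test_var_lb : R := expR (- (5 / 2)) * (3 / 128).

Lemma test_fun_var : A <= 1 -> exists v, [/\
  (\int[leb]_x (w1 potential Z x * test_fun x ^+ 2)%:E = v%:E)%E, v <= 1 & test_var_lb <= v].
Proof.
move=> A1.
have mw := measurable_w1 Z measurable_potential.
have mg := measurable_test_fun.
have w0 x := w1_ge0 potential Z0 x.
have m2 : measurable_fun setT (fun x => w1 potential Z x * test_fun x ^+ 2).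
  by apply: measurable_funM => //; exact: measurable_funX.
set I := (\int[leb]_x _)%E.
have I1 : (I <= 1)%E.
  rewrite -(integral_w1 measurable_potential Z0 ZE); apply: ge0_le_integral => //.
  - by move=> x _; rewrite lee_fin mulr_ge0// sqr_ge0.
  - exact/measurable_EFinP.
  - exact/measurable_EFinP.
  - move=> x _; rewrite lee_fin ler_piMr// -real_normK ?num_real//.
    by rewrite expr_le1// test_fun_le1.
have Iv : (test_var_lb%:E <= I)%E.
  pose D := `[(Num.sqrt a)^-1 / 2, (Num.sqrt a)^-1]%classic : set R.
  have mD : measurable D by exact: measurable_itv.
  have lD : leb D = ((Num.sqrt a)^-1 / 2)%:E.
    rewrite /D lebesgue_measure_itv/= lte_fin ifT.
      by rewrite -EFinB; congr EFin; field; rewrite gt_eqF.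
    by have : 0 < (Num.sqrt a)^-1; [rewrite invr_gt0|lra].
  have -> : test_var_lb%:E = (\int[leb]_(x in D)
      (expR (- (5 / 2)) * (Num.sqrt a / 3) * (9 / 64))%:E)%E.
    rewrite integral_cst// [X in (_ * X)%E]lD -EFinM /test_var_lb; congr EFin.
    by field; rewrite gt_eqF.
  apply: (@le_trans _ _ (\int[leb]_(x in D) (w1 potential Z x * test_fun x ^+ 2)%:E)%E).
    apply: ge0_le_integral => //.
    - by apply/measurable_EFinP; exact: measurable_funTS.
    - move=> x; rewrite /D/= in_itv/= => /andP[x1 x2].
      have ai0 : 0 < (Num.sqrt a)^-1 by rewrite invr_gt0.
      rewrite lee_fin; apply: ler_pM => //.
      + by apply: w1_potential_ge => //; apply/andP; split; lra.
      pose t := Num.sqrt a * x.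
      have t1 : 1 / 2 <= t.
        have := ler_wpM2l (ltW sa0) x1; rewrite mulrA divff ?gt_eqF//.
      have t2 : t <= 1.
        have := ler_wpM2l (ltW sa0) x2; rewrite divff ?gt_eqF//.
      have t0 : 0 <= t by lra.
      have H := sin_ge_quad t0.
      have H38 : 3 / 8 <= sin t.
        apply: le_trans H.
        have : 0 <= (1 - t) * (t - 1 / 2) by apply: mulr_ge0; lra.
        by rewrite expr2; lra.
      rewrite (_ : 9 / 64 = (3 / 8) ^+ 2 :> R); last by field.
      by rewrite lerXn2r ?nnegrE//; apply: le_trans H38; lra.
  apply: ge0_subset_integral => //.
  - exact/measurable_EFinP.
  - by move=> x _; rewrite lee_fin mulr_ge0// sqr_ge0.
exists (fine I).
have E : ((fine I)%:E = I)%E.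
  rewrite fineK// ge0_fin_numE; first by apply: (le_lt_trans I1); exact: ltry.
  by apply: integral_ge0 => x _; rewrite lee_fin mulr_ge0// sqr_ge0.
by split=> //; rewrite -lee_fin E.
Qed.

End potential.

(** * Gaussian targets: Dirichlet form and affinity *)

Section gaussian_target.
Context (R : realType).
Local Notation leb := (@lebesgue_measure R).

(** The inequality [b / 2 * u <= exp (b / 2 * u)] trades the square [u] for half of the exponent,
    and the wider Gaussian costs a factor [sqrt 2 <= 3 / 2]. *)
Lemma gauss_moment_le (b c : R) : 0 < b ->
  (\int[leb]_x ((x - c) ^+ 2 * expR (- (b * (x - c) ^+ 2)))%:E <=
   (3 / b * Num.sqrt (pi / b))%:E)%E.
Proof.
move=> b0; have b20 : 0 < b / 2 by rewrite divr_gt0.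
have m2 : measurable_fun setT (fun x : R => (x - c) ^+ 2).
  by apply: measurable_funX; exact: measurable_funB.
have mE k : measurable_fun setT (fun x : R => expR (- (k * (x - c) ^+ 2))).
  by apply: measurableT_comp => //; apply: measurableT_comp => //; exact: measurable_funM.
apply: (@le_trans _ _ (\int[leb]_x ((2 / b)%:E * (expR (- (b / 2 * (x - c) ^+ 2)))%:E))%E).
  apply: ge0_le_integral => //.
  - by move=> x _; rewrite lee_fin mulr_ge0 ?sqr_ge0 ?expR_ge0.
  - by apply/measurable_EFinP; apply: measurable_funM; [exact: m2|exact: mE].
  - by apply: emeasurable_funM => //; apply/measurable_EFinP; exact: mE.
  - move=> x _; rewrite -EFinM lee_fin.
    set u := (x - c) ^+ 2.
    have -> : - (b * u) = b / 2 * u * (-1) + - (b / 2 * u) by field.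
    rewrite expRD mulrA ler_wpM2r ?expR_ge0// mulrN1 expRN ler_pdivrMr ?expR_gt0//.
    rewrite -ler_pdivrMl ?divr_gt0// invf_div.
    have := expR_ge1Dx (b / 2 * u); lra.
rewrite ge0_integralZl//.
- rewrite integral_gauss_center// -EFinM lee_fin.
  have -> : pi / (b / 2) = 2 * (pi / b) :> R by field; rewrite gt_eqF.
  rewrite sqrtrM// mulrA ler_wpM2r ?sqrtr_ge0//.
  rewrite mulrAC; apply: ler_wpM2r; first by rewrite invr_ge0 ltW.
  have : Num.sqrt 2 <= 3 / 2 :> R.
    by rewrite -ler_sqr ?nnegrE ?sqrtr_ge0 ?divr_ge0// sqr_sqrtr// expr2; lra.
  lra.
- by apply/measurable_EFinP; exact: mE.
- by rewrite lee_fin divr_ge0// ltW.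
Qed.

Variables (a h : R).
Hypotheses (a0 : 0 < a) (h0 : 0 < h).
Local Notation phi := (potential a 0 h).
Local Notation dphi := (dpotential a 0 h).
Local Notation Z := (Num.sqrt (2 * pi / a)).
Local Notation cst := (powR (4 * pi * h) (- (1 / 2))).

Let phiE x : phi x = a / 2 * x ^+ 2.
Proof. by rewrite /potential mul0r addr0. Qed.

Let dphiE x : dphi x = a * x.
Proof. by rewrite /dpotential mul0r mul0r subr0. Qed.

Let Z0 : 0 < Z.
Proof. by rewrite sqrtr_gt0 divr_gt0// mulr_gt0// pi_gt0. Qed.

Let cstE : cst = (Num.sqrt (4 * pi * h))^-1.
Proof. by rewrite powRN div1r powR12_sqrt// !mulr_ge0// ?pi_ge0// ltW. Qed.

Let ph0 : 0 < 4 * pi * h.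
Proof. by rewrite !mulr_gt0// pi_gt0. Qed.

Lemma gaussian_Z : (\int[leb]_x (expR (- phi x))%:E = Z%:E)%E.
Proof.
have [Z' [ZE]] := potential_Z a0 h0 (lexx 0).
rewrite oppr0 expR0 mul1r => lo up; rewrite ZE; congr EFin.
by apply/eqP; rewrite eq_le up lo.
Qed.

Let mphi : measurable_fun setT phi := measurable_potential a 0 h0.
Let mdphi : measurable_fun setT dphi := measurable_dpotential a 0 h0.

Let q1_moment x :
  (\int[leb]_y (q1 dphi h x y * (y - x + h * dphi x) ^+ 2)%:E <= (12 * h)%:E)%E.
Proof.
have b0 : 0 < (4 * h)^-1 by rewrite invr_gt0 mulr_gt0.
rewrite [leLHS](_ : _ = \int[leb]_y (cst%:E * ((y - (x - h * dphi x)) ^+ 2 *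
   expR (- ((4 * h)^-1 * (y - (x - h * dphi x)) ^+ 2)))%:E))%E; last first.
  apply: eq_integral => y _; rewrite -EFinM /q1; congr EFin.
  rewrite (_ : y - (x - h * dphi x) = y - x + h * dphi x); last by ring.
  rewrite -mulrA; congr (_ * _); rewrite mulrC; congr (_ * expR _).
  by rewrite mulNr mulrC.
rewrite ge0_integralZl//.
- apply: (@le_trans _ _ (cst%:E * (3 / (4 * h)^-1 * Num.sqrt (pi / (4 * h)^-1))%:E)%E).
    by rewrite lee_wpmul2l ?lee_fin ?powR_ge0//; exact: gauss_moment_le.
  rewrite -EFinM lee_fin cstE !invrK.
  rewrite (_ : pi * (4 * h) = 4 * pi * h); last by ring.
  by rewrite mulrCA mulVf ?gt_eqF ?sqrtr_gt0//; lra.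
- apply/measurable_EFinP; apply: measurable_funM.
    by apply: measurable_funX; exact: measurable_funB.
  apply: measurableT_comp => //; apply: measurableT_comp => //.
  apply: measurable_funM => //.
  by apply: measurable_funX; exact: measurable_funB.
- by move=> y _; rewrite lee_fin mulr_ge0 ?sqr_ge0 ?expR_ge0.
- by rewrite lee_fin powR_ge0.
Qed.

Let w1_moment : (\int[leb]_x (w1 phi Z x * x ^+ 2)%:E <= (6 / a)%:E)%E.
Proof.
have b0 : 0 < a / 2 by rewrite divr_gt0.
rewrite [leLHS](_ : _ = \int[leb]_x (Z^-1%:E * ((x - 0) ^+ 2 *
   expR (- (a / 2 * (x - 0) ^+ 2)))%:E))%E; last first.
  apply: eq_integral => x _; rewrite -EFinM /w1 phiE subr0; congr EFin; ring.
rewrite ge0_integralZl//.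
- apply: (@le_trans _ _ (Z^-1%:E * (3 / (a / 2) * Num.sqrt (pi / (a / 2)))%:E)%E).
    by rewrite lee_wpmul2l ?lee_fin ?invr_ge0 ?sqrtr_ge0//; exact: gauss_moment_le.
  rewrite -EFinM lee_fin.
  rewrite (_ : pi / (a / 2) = 2 * pi / a); last by field; rewrite gt_eqF.
  rewrite mulrCA mulVf ?gt_eqF// mulr1 le_eqVlt; apply/orP; left; apply/eqP.
  by field; rewrite gt_eqF.
- apply/measurable_EFinP; apply: measurable_funM.
    by apply: measurable_funX; exact: measurable_funB.
  apply: measurableT_comp => //; apply: measurableT_comp => //.
  apply: measurable_funM => //.
  by apply: measurable_funX; exact: measurable_funB.
- by move=> y _; rewrite lee_fin mulr_ge0 ?sqr_ge0 ?expR_ge0.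
Qed.

(** The squared increment of the test function is at most [a * (y - x) ^ 2], and the move is noise
    minus drift. With the two moment bounds the noise contributes [24 * (h * a)] and the drift
    [12 * (h * a) ^ 2 <= 12 * (h * a)]. *)
Lemma gaussian_dirichlet : h * a <= 1 ->
  (\int[leb]_x \int[leb]_y (w1 phi Z x * q1 dphi h x y *
     (test_fun a x - test_fun a y) ^+ 2)%:E <= (36 * (h * a))%:E)%E.
Proof.
move=> ha1.
have w0 x : 0 <= w1 phi Z x by exact: w1_ge0.
have q0 x y : 0 <= q1 dphi h x y by exact: q1_ge0.
have mw : measurable_fun setT (w1 phi Z) by exact: measurable_w1.
have mq x : measurable_fun setT (q1 dphi h x) by exact: measurable_q1r.
have mqt x : measurable_fun setT (fun y => q1 dphi h x y * (y - x + h * dphi x) ^+ 2).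
  apply: measurable_funM => //; apply: measurable_funX; apply: measurable_funD => //.
  exact: measurable_funB.
have mg := measurable_test_fun a.
pose B x := w1 phi Z x * (24 * (h * a)) + w1 phi Z x * x ^+ 2 * (2 * h ^+ 2 * a ^+ 3).
have inner x : (\int[leb]_y (w1 phi Z x * q1 dphi h x y *
     (test_fun a x - test_fun a y) ^+ 2)%:E <= (B x)%:E)%E.
  apply: (@le_trans _ _ (\int[leb]_y ((2 * a * w1 phi Z x)%:E *
      (q1 dphi h x y * (y - x + h * dphi x) ^+ 2)%:E +
      (2 * h ^+ 2 * a ^+ 3 * x ^+ 2 * w1 phi Z x)%:E * (q1 dphi h x y)%:E))%E).
    apply: ge0_le_integral => //.
    - by move=> y _; rewrite lee_fin (mulr_ge0 (mulr_ge0 (w0 _) (q0 _ _)) (sqr_ge0 _)).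
    - apply/measurable_EFinP; apply: measurable_funM.
        by apply: measurable_funM => //; exact: mq.
      by apply: measurable_funX; exact: measurable_funB.
    - apply: emeasurable_funD; apply: emeasurable_funM => //; apply/measurable_EFinP.
        exact: mqt.
      exact: mq.
    - move=> y _; rewrite -!EFinM -EFinD lee_fin.
      have sa2 : Num.sqrt a ^+ 2 = a by rewrite sqr_sqrtr// ltW.
      have H1 : (test_fun a x - test_fun a y) ^+ 2 <= a * (y - x) ^+ 2.
        have := dist_sin_le (Num.sqrt a * y) (Num.sqrt a * x).
        rewrite -/(test_fun a x) -/(test_fun a y) => H.
        rewrite (_ : a * _ = (Num.sqrt a * (y - x)) ^+ 2); last by rewrite exprMn sa2.
        rewrite -(real_normK (num_real (test_fun a x - _))).
        rewrite -(real_normK (num_real (Num.sqrt a * (y - x)))) lerXn2r ?nnegrE//.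
        by rewrite (le_trans H)// mulrBr distrC.
      have H2 : (y - x) ^+ 2 <= 2 * (y - x + h * dphi x) ^+ 2 + 2 * h ^+ 2 * a ^+ 2 * x ^+ 2.
        rewrite dphiE -subr_ge0.
        rewrite (_ : _ - _ = (y - x + 2 * (h * (a * x))) ^+ 2); last by ring.
        exact: sqr_ge0.
      apply: (@le_trans _ _ (w1 phi Z x * q1 dphi h x y * (a * (2 * (y - x + h * dphi x) ^+ 2
          + 2 * h ^+ 2 * a ^+ 2 * x ^+ 2)))).
        apply: ler_wpM2l; first by rewrite mulr_ge0.
        by apply: (le_trans H1); apply: ler_wpM2l => //; exact: ltW.
      by rewrite le_eqVlt; apply/orP; left; apply/eqP; ring.
  have k0 : 0 <= 2 * a * w1 phi Z x by rewrite mulr_ge0// mulr_ge0// ltW.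
  have k1 : 0 <= 2 * h ^+ 2 * a ^+ 3 * x ^+ 2 * w1 phi Z x.
    by rewrite mulr_ge0// mulr_ge0 ?sqr_ge0// mulr_ge0 ?exprn_ge0// ?mulr_ge0 ?exprn_ge0// ltW.
  rewrite ge0_integralD//; last 4 first.
  - by move=> y _; rewrite -EFinM lee_fin mulr_ge0// mulr_ge0 ?sqr_ge0.
  - by apply: emeasurable_funM => //; apply/measurable_EFinP; exact: mqt.
  - by move=> y _; rewrite -EFinM lee_fin mulr_ge0.
  - by apply: emeasurable_funM => //; apply/measurable_EFinP; exact: mq.
  rewrite ge0_integralZl//; last 2 first.
  - by apply/measurable_EFinP; exact: mqt.
  - by move=> y _; rewrite lee_fin mulr_ge0 ?sqr_ge0.
  rewrite ge0_integralZl//; last 2 first.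
  - by apply/measurable_EFinP; exact: mq.
  - by move=> y _; rewrite lee_fin.
  rewrite integral_q1// mule1.
  apply: (@le_trans _ _ ((2 * a * w1 phi Z x)%:E * (12 * h)%:E +
      (2 * h ^+ 2 * a ^+ 3 * x ^+ 2 * w1 phi Z x)%:E)%E).
    by rewrite leeD2r// lee_wpmul2l ?lee_fin//; exact: q1_moment.
  rewrite -EFinM -EFinD lee_fin /B le_eqVlt; apply/orP; left; apply/eqP; ring.
have mB : measurable_fun setT B.
  apply: measurable_funD; apply: measurable_funM => //.
  by apply: measurable_funM => //; exact: measurable_funX.
apply: (@le_trans _ _ (\int[leb]_x (B x)%:E)%E).
  apply: ge0_le_integral => //.
  - by move=> x _; apply: integral_ge0 => y _; rewrite lee_fin (mulr_ge0 (mulr_ge0 (w0 _) (q0 _ _)) (sqr_ge0 _)).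
  - apply: (@measurable_fun_fubini_tonelli_F _ _ _ _ _ leb (fun p : R * R =>
      (w1 phi Z p.1 * q1 dphi h p.1 p.2 * (test_fun a p.1 - test_fun a p.2) ^+ 2)%:E)).
      apply/measurable_EFinP; apply: measurable_funM.
        apply: measurable_funM; last exact: measurable_q1.
        exact: (measurableT_comp mw measurable_fst).
      apply: measurable_funX; apply: measurable_funB.
        exact: (measurableT_comp mg measurable_fst).
      exact: (measurableT_comp mg measurable_snd).
    by move=> p; rewrite lee_fin (mulr_ge0 (mulr_ge0 (w0 _) (q0 _ _)) (sqr_ge0 _)).
  - exact/measurable_EFinP.
have c0 : 0 <= 2 * h ^+ 2 * a ^+ 3 by rewrite !mulr_ge0 ?exprn_ge0// ltW.
have mwx : measurable_fun setT (fun x => w1 phi Z x * x ^+ 2).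
  by apply: measurable_funM => //; exact: measurable_funX.
rewrite [leLHS](_ : _ = \int[leb]_x ((24 * (h * a))%:E * (w1 phi Z x)%:E +
    (2 * h ^+ 2 * a ^+ 3)%:E * (w1 phi Z x * x ^+ 2)%:E))%E; last first.
  by apply: eq_integral => x _; rewrite -!EFinM -EFinD /B; congr EFin; ring.
have k0 : 0 <= 24 * (h * a) by rewrite !mulr_ge0// ltW.
rewrite ge0_integralD//; last 4 first.
- by move=> y _; rewrite -EFinM lee_fin mulr_ge0.
- by apply: emeasurable_funM => //; exact/measurable_EFinP.
- by move=> y _; rewrite -EFinM lee_fin mulr_ge0// mulr_ge0 ?sqr_ge0.
- by apply: emeasurable_funM => //; exact/measurable_EFinP.
rewrite ge0_integralZl//; last 2 first.
- exact/measurable_EFinP.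
- by move=> y _; rewrite lee_fin.
rewrite ge0_integralZl//; last 2 first.
- exact/measurable_EFinP.
- by move=> y _; rewrite lee_fin mulr_ge0 ?sqr_ge0.
rewrite integral_w1//; last exact: gaussian_Z.
rewrite mule1.
apply: (@le_trans _ _ ((24 * (h * a))%:E + (2 * h ^+ 2 * a ^+ 3)%:E * (6 / a)%:E)%E).
  by rewrite leeD2l// lee_wpmul2l ?lee_fin.
rewrite -EFinM -EFinD lee_fin.
rewrite (_ : 2 * h ^+ 2 * a ^+ 3 * (6 / a) = 12 * (h * a) * (h * a)); last by field; rewrite gt_eqF.
have ha0 : 0 <= h * a by rewrite mulr_ge0 ?ltW.
have := ler_wpM2l ha0 ha1; lra.
Qed.

Lemma gaussian_affinity :
  (\int[leb]_x \int[leb]_y (r1 phi dphi h Z x y)%:E =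
   (Num.sqrt (8 / (8 + (h * a) ^+ 3)))%:E)%E.
Proof.
pose s := h * a.
have s0 : 0 < s by rewrite mulr_gt0.
(* The exponent of [r1] is the quadratic form [- b x ^ 2 + c x y - b y ^ 2]. Integrating out [y]
   leaves [b'], whose numerator [(s ^ 2 + 2) ^ 2 - 4 (1 - s) ^ 2] factors as [s (s ^ 3 + 8)]: this
   is the origin of the cube. *)
pose b := (s ^+ 2 + 2) / (8 * h).
pose c := (1 - s) / (2 * h).
have b0 : 0 < b by rewrite divr_gt0 ?mulr_gt0// ltr_wpDl// sqr_ge0.
have D0 : 0 < s * (s ^+ 3 + 8) by rewrite mulr_gt0// ltr_wpDl// exprn_ge0// ltW.
have s20 : 0 < s ^+ 2 + 2 by rewrite ltr_wpDl// sqr_ge0.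
pose b' := s * (s ^+ 3 + 8) / ((8 * h) * (s ^+ 2 + 2)).
have b'0 : 0 < b' by rewrite divr_gt0// mulr_gt0// mulr_gt0.
have b'E : b - c ^+ 2 / (4 * b) = b'.
  by rewrite /b /c /b'; field; rewrite !gt_eqF.
have inner x : (\int[leb]_y (r1 phi dphi h Z x y)%:E =
   (cst / Z * Num.sqrt (pi / b))%:E * (expR (- (b' * x ^+ 2)))%:E)%E.
  transitivity (\int[leb]_y ((cst / Z * expR (- (b * x ^+ 2)))%:E *
      (expR (- (b * y ^+ 2) + (c * x) * y))%:E))%E.
    apply: eq_integral => y _; rewrite -EFinM /r1; congr EFin.
    rewrite -[RHS]mulrA -expRD; congr (_ * expR _).
    by rewrite !phiE !dphiE /b /c /s; field; rewrite gt_eqF.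
  rewrite ge0_integralZl//.
  - rewrite integral_gauss// -!EFinM; congr EFin.
    rewrite -b'E [in RHS]mulrBl opprB expRD.
    rewrite (_ : (c * x) ^+ 2 / (4 * b) = c ^+ 2 / (4 * b) * x ^+ 2); last by field; rewrite gt_eqF.
    ring.
  - apply/measurable_EFinP; apply: measurableT_comp => //.
    apply: measurable_funD; last exact: measurable_funM.
    by apply: measurableT_comp => //; apply: measurable_funM.
  - by rewrite lee_fin mulr_ge0 ?expR_ge0// divr_ge0 ?powR_ge0// ltW.
under eq_integral do rewrite inner.
have k0 : 0 <= cst / Z * Num.sqrt (pi / b).
  by rewrite mulr_ge0 ?sqrtr_ge0// divr_ge0 ?powR_ge0// ltW.
rewrite ge0_integralZl//; last first.
  apply/measurable_EFinP; apply: measurableT_comp => //.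
  by apply: measurableT_comp => //; apply: measurable_funM.
have -> : (\int[leb]_x (expR (- (b' * x ^+ 2)))%:E = (Num.sqrt (pi / b'))%:E)%E.
  by rewrite -(integral_gauss_center 0 b'0); apply: eq_integral => x _; rewrite subr0.
rewrite -EFinM; congr EFin.
rewrite -/s.
have s80 : 0 < 8 + s ^+ 3 by rewrite ltr_wpDr// exprn_ge0// ltW.
have q0 : 0 <= 8 / (8 + s ^+ 3) by rewrite divr_ge0// ltW.
have p1 : 0 <= 2 * pi / a by rewrite ltW// divr_gt0// mulr_gt0// pi_gt0.
have p2 : 0 <= pi / b by rewrite ltW// divr_gt0// pi_gt0.
have p3 : 0 <= pi / b' by rewrite ltW// divr_gt0// pi_gt0.
have pi0 : (pi : R) != 0 by rewrite gt_eqF// pi_gt0.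
have L0 : 0 <= cst / Z * Num.sqrt (pi / b) * Num.sqrt (pi / b').
  exact: mulr_ge0 k0 (sqrtr_ge0 _).
apply/eqP; rewrite -(@eqrXn2 _ 2) ?sqrtr_ge0//.
rewrite 3!exprMn cstE !exprVn !sqr_sqrtr//; last exact: ltW.
apply/eqP; rewrite (_ : a = s / h); last by rewrite /s; field; rewrite gt_eqF.
rewrite /b' /b; move: (pi : R) pi0 => p pi0; field.
by rewrite pi0 !gt_eqF.
Qed.

End gaussian_target.

(** * The trapezoidal error of the sine *)

Section trapezoid.
Context (R : realType).

(* The error of the trapezoidal rule for [sin] on [u, u + v]; it is
   [2 cos u] at [v = pi] and [- 2 pi sin u] at [v = 2 pi]. *)
Definition trapezoid_error (u v : R) := cos u - cos (u + v) - v / 2 * (sin u + sin (u + v)).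

(** The constant is [1 / 20 + 1 / 20 + 4 / 20], for the changes of the cosine, of the length, and of
    the sine at the moving end, the last one weighted by [v0 / 2 <= 4]. *)
Lemma trapezoid_error_diff u v v0 : 0 <= v0 <= 8 -> v0 <= v <= v0 + 1 / 20 ->
  `|trapezoid_error u v - trapezoid_error u v0| <= 3 / 10.
Proof.
move=> /andP[v00 v08] /andP[v1 v2].
have C := dist_cos_le (u + v0) (u + v).
have S := dist_sin_le (u + v0) (u + v).
have E : `|u + v - (u + v0)| = v - v0 by rewrite ger0_norm; lra.
rewrite E in C S.
rewrite /trapezoid_error.
rewrite (_ : _ - _ = - (cos (u + v) - cos (u + v0)) - (v - v0) / 2 * (sin u + sin (u + v))
   - v0 / 2 * (sin (u + v) - sin (u + v0))); last by field.
have s1 : `|sin u + sin (u + v)| <= 2.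
  rewrite (le_trans (ler_normD _ _))//.
  have : `|sin u| <= 1 by rewrite ler_norml sin_geN1 sin_le1.
  have : `|sin (u + v)| <= 1 by rewrite ler_norml sin_geN1 sin_le1.
  lra.
have T1 : `|(v - v0) / 2 * (sin u + sin (u + v))| <= (v - v0) / 2 * 2.
  by rewrite normrM ger0_norm ?ler_wpM2l//; lra.
have T2 : `|v0 / 2 * (sin (u + v) - sin (u + v0))| <= v0 / 2 * (v - v0).
  by rewrite normrM ger0_norm ?ler_wpM2l//; lra.
have T3 : v0 / 2 * (v - v0) <= 4 * (1 / 20) by apply: ler_pM; lra.
apply: (le_trans (ler_normB _ _)); apply: (le_trans (lerD (ler_normB _ _) (lexx _))).
rewrite normrN; lra.
Qed.

(** [|cos u|] or [|sin u|] is at least [1 / 2], so the error is at least [1] in absolute value at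
    [pi] or at [2 pi], and it loses at most [3 / 10] over the next [1 / 20]. A whole interval is
    needed for the proposal to hit it with positive probability. *)
Lemma trapezoid_error_lb u : exists v0, [/\ 0 <= v0, v0 <= 8 &
  forall v, v0 <= v <= v0 + 1 / 20 -> 7 / 10 <= `|trapezoid_error u v|].
Proof.
have /andP[pi2 pi4] : 2 <= (pi : R) <= 4.
  by have /andP[] := pihalf_02 R; have := pi_ge2 R => H1 H2 H3; apply/andP; split; lra.
suff [v0 [v00 v08 H]] : exists v0, [/\ 0 <= v0, v0 <= 8 & 1 <= `|trapezoid_error u v0|].
  exists v0; split => // v vv.
  have D := @trapezoid_error_diff u v v0 (introT andP (conj v00 v08)) vv.
  rewrite distrC in D.
  have := ler_normD (trapezoid_error u v0 - trapezoid_error u v) (trapezoid_error u v).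
  rewrite subrK => H'; lra.
have [c|c] := leP (1 / 2) `|cos u|.
  exists pi; split; [lra|lra|].
  rewrite /trapezoid_error cosDpi sinDpi subrr mulr0 subr0 opprK -mulr2n normrMn.
  by rewrite mulr2n; lra.
have sc := cos2Dsin2 u.
have s : 1 / 2 <= `|sin u|.
  rewrite leNgt; apply/negP => s.
  have c2 : cos u ^+ 2 <= 1 / 4.
    rewrite -(real_normK (num_real (cos u))) (_ : 1 / 4 = (1 / 2) ^+ 2); last by field.
    by rewrite lerXn2r ?nnegrE// ltW.
  have s2 : sin u ^+ 2 <= 1 / 4.
    rewrite -(real_normK (num_real (sin u))) (_ : 1 / 4 = (1 / 2) ^+ 2); last by field.
    by rewrite lerXn2r ?nnegrE// ltW.
  lra.
exists (2 * pi); split; [lra|lra|].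
rewrite /trapezoid_error (_ : u + 2 * pi = u + pi + pi); last by ring.
rewrite cosDpi sinDpi cosDpi sinDpi !opprK subrr sub0r normrN.
rewrite (_ : 2 * pi / 2 * (sin u + sin u) = 2 * pi * sin u); last by field.
rewrite normrM ger0_norm; last lra.
apply: (@le_trans _ _ (2 * (1 / 2))); first by lra.
by apply: ler_pM => //; lra.
Qed.

End trapezoid.

(** * Affinity and Hellinger distance *)

Section exponential_gap.
Context (R : realType).

(** For [l < 0] one has [exp (l / 2) <= 1 / (1 + t / 2) <= 1 - t / 4]; the second inequality is
    where [t <= 1] enters. *)
Lemma expR_gap (l t : R) : 0 <= t <= 1 -> t <= `|l| -> (t / 4) ^+ 2 <= (1 - expR (l / 2)) ^+ 2.
Proof.
move=> /andP[t0 t1] tl.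
rewrite -(real_normK (num_real (1 - expR (l / 2)))) lerXn2r ?nnegrE ?divr_ge0//.
have [l0|l0] := leP 0 l.
  rewrite (ger0_norm l0) in tl.
  rewrite distrC; apply: le_trans (ler_norm _).
  have := expR_ge1Dx (l / 2); lra.
rewrite (ltr0_norm l0) in tl.
apply: le_trans (ler_norm _).
have H := expR_ge1Dx (- l / 2).
have e0 := expR_gt0 (l / 2).
have E : expR (l / 2) * expR (- l / 2) = 1.
  by rewrite -expRD -mulrDl subrr mul0r expR0.
have H2 : expR (l / 2) * (1 + t / 2) <= 1.
  by rewrite -[leRHS]E; apply: ler_wpM2l; [exact: ltW|lra].
have : (1 - t / 4) * (1 + t / 2) >= 1.
  have : 0 <= t * (1 - t) by rewrite mulr_ge0//; lra.
  lra.
move=> H3; have : expR (l / 2) * (1 + t / 2) <= (1 - t / 4) * (1 + t / 2) by lra.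
by rewrite ler_pM2r; lra.
Qed.

End exponential_gap.

Lemma lebesgue_itvcc (R : realType) (a b : R) : a <= b ->
  lebesgue_measure (`[a, b]%classic : set R) = (b - a)%:E.
Proof.
rewrite lebesgue_measure_itv/= lte_fin le_eqVlt => /predU1P[->|->//].
by rewrite ltxx subrr.
Qed.

(** Meant for integrals not yet known to be finite: the value [2] of the sum excludes the infinite
    cases. *)
Lemma ereal_complement_le (R : realType) (K I : \bar R) (a : R) :
  (K + 2%:E * I = 2%:E -> a%:E <= K -> 0 <= I -> I <= (1 - a / 2)%:E)%E.
Proof.
have two0 : (0 < 2%:E :> \bar R)%E by rewrite lte_fin.
case: I => [i| |].
- case: K => [k| |] H; rewrite -?EFinM in H.
  + by move: H; rewrite -EFinD => -[ki]; rewrite !lee_fin => ak _; lra.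
  + by move: H; rewrite addye.
  + by rewrite leeNy_eq.
- rewrite gt0_muley//; case: K => [k| |].
  + by rewrite addey.
  + by rewrite addye.
  + by rewrite leeNy_eq.
- by move=> _ _; rewrite leeNy_eq.
Qed.

Section affinity_gap.
Context (R : realType).
Variables (phi dphi : R -> R) (h Z : R).
Hypotheses (mphi : measurable_fun setT phi) (mdphi : measurable_fun setT dphi).
Hypotheses (h0 : 0 < h) (Z0 : 0 < Z).
Local Notation leb := (@lebesgue_measure R).
Hypothesis ZE : (\int[leb]_t (expR (- phi t))%:E = Z%:E)%E.

(** Logarithm of the backward joint density [w1 y * q1 y x] over the forward one. The terms without
    [h] are the error of the trapezoidal rule for the integral of [dphi] from [x] to [y]. *)
Definition log_ratio x y :=
  phi x - phi y + (y - x) / 2 * (dphi x + dphi y) + h / 4 * (dphi x ^+ 2 - dphi y ^+ 2).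

Local Notation p x y := (w1 phi Z x * q1 dphi h x y).
Local Notation r x y := (r1 phi dphi h Z x y).

Let r_ratio x y : r x y = p x y * expR (log_ratio x y / 2).
Proof.
rewrite /r1 /w1 /q1 /log_ratio; set c := powR _ _.
rewrite [RHS](_ : _ = c / Z * (expR (- phi x) * expR (- (y - x + h * dphi x) ^+ 2 / (4 * h)) *
  expR ((phi x - phi y + (y - x) / 2 * (dphi x + dphi y) +
        h / 4 * (dphi x ^+ 2 - dphi y ^+ 2)) / 2))); last by ring.
rewrite -!expRD; congr (_ * expR _).
by field; rewrite gt_eqF.
Qed.

Let p_ratio x y : p y x = p x y * expR (log_ratio x y).
Proof.
rewrite /w1 /q1 /log_ratio; set c := powR _ _.
rewrite [RHS](_ : _ = c / Z * (expR (- phi x) * expR (- (y - x + h * dphi x) ^+ 2 / (4 * h)) *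
  expR ((phi x - phi y + (y - x) / 2 * (dphi x + dphi y) +
        h / 4 * (dphi x ^+ 2 - dphi y ^+ 2))))); last by ring.
rewrite [LHS](_ : _ = c / Z * (expR (- phi y) * expR (- (x - y + h * dphi y) ^+ 2 / (4 * h)))); last by ring.
rewrite -!expRD; congr (_ * expR _).
by field; rewrite gt_eqF.
Qed.

(** Squared difference of the square roots of the forward and backward joint densities. *)
Let F x y := p x y * (1 - expR (log_ratio x y / 2)) ^+ 2.

Let FE x y : F x y + 2 * r x y = p x y + p y x.
Proof.
rewrite /F r_ratio [p y x]p_ratio.
have -> : expR (log_ratio x y) = expR (log_ratio x y / 2) ^+ 2.
  by rewrite -expRM_natl; congr expR; field.
by ring.
Qed.

Let p_ge0 x y : 0 <= p x y. Proof. by rewrite mulr_ge0 ?w1_ge0 ?q1_ge0. Qed.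

Let m_p : measurable_fun setT (fun z : R * R => p z.1 z.2).
Proof.
apply: measurable_funM; last exact: measurable_q1.
exact: (measurableT_comp (measurable_w1 Z mphi) measurable_fst).
Qed.

Let m_p' : measurable_fun setT (fun z : R * R => p z.2 z.1).
Proof. exact: (measurableT_comp m_p (@measurable_swap _ _ R R)). Qed.

Let m_F : measurable_fun setT (fun z : R * R => F z.1 z.2).
Proof.
have -> : (fun z : R * R => F z.1 z.2) = (fun z => p z.1 z.2 + p z.2 z.1 - 2 * r z.1 z.2).
  by apply/funext => z; have := FE z.1 z.2; lra.
apply: measurable_funB; first exact: measurable_funD.
by apply: measurable_funM => //; exact: measurable_r1.
Qed.

Let int_p x : (\int[leb]_y (p x y)%:E = (w1 phi Z x)%:E)%E.
Proof.
under eq_integral do rewrite EFinM.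
rewrite ge0_integralZl//.
- by rewrite integral_q1// mule1.
- by apply/measurable_EFinP; exact: measurable_q1r.
- by move=> t _; rewrite lee_fin q1_ge0.
- by rewrite lee_fin w1_ge0.
Qed.

Let int_int_p : (\int[leb]_x \int[leb]_y (p x y)%:E = 1)%E.
Proof. by under eq_integral do rewrite int_p; exact: integral_w1. Qed.

Let int_int_p' : (\int[leb]_x \int[leb]_y (p y x)%:E = 1)%E.
Proof.
rewrite -int_int_p.
apply: (@fubini_tonelli _ _ _ _ _ leb leb (fun z : R * R => (p z.2 z.1)%:E)).
  exact/measurable_EFinP.
by move=> z; rewrite lee_fin.
Qed.

(* The affinity of the forward and backward joint densities is one minus their
   squared Hellinger distance. *)
Lemma affinity_le (X t delta : R) (J : R -> R * R) :
  0 <= X -> 0 <= t <= 1 -> 0 <= delta ->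
  (forall x, 0 <= x <= X -> [/\ (J x).1 <= (J x).2,
     forall y, (J x).1 <= y <= (J x).2 -> t <= `|log_ratio x y| &
     forall y, (J x).1 <= y <= (J x).2 -> delta <= w1 phi Z x * (q1 dphi h x y * ((J x).2 - (J x).1))]) ->
  (\int[leb]_x \int[leb]_y (r x y)%:E <= (1 - X * delta * (t / 4) ^+ 2 / 2)%:E)%E.
Proof.
move=> X0 t01 delta0 HJ.
have F0 x y : 0 <= F x y by rewrite mulr_ge0// sqr_ge0.
have r0 x y : 0 <= r x y by exact: r1_ge0.
have m_r := measurable_r1 h Z mphi mdphi.
pose c := delta * (t / 4) ^+ 2.
have c0 : 0 <= c by rewrite mulr_ge0// sqr_ge0.
have mFx x : measurable_fun setT (fun y => (F x y)%:E).
  by apply/measurable_EFinP; exact: (measurableT_comp m_F (pair1_measurable x)).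
have mIF : measurable_fun setT (fun x => \int[leb]_y (F x y)%:E)%E.
  apply: (@measurable_fun_fubini_tonelli_F _ _ _ _ _ leb (fun z : R * R => (F z.1 z.2)%:E)).
    exact/measurable_EFinP.
  by move=> z; rewrite lee_fin.
(* For each [x] in [[0, X]], integrating [p x y] over [J x] gives at least [delta], and on [J x] the
   other factor of [F] is at least [(t / 4) ^ 2] by [expR_gap]. *)
have lower : ((X * c)%:E <= \int[leb]_x \int[leb]_y (F x y)%:E)%E.
  have mD : measurable (`[0, X]%classic : set R) by exact: measurable_itv.
  apply: (@le_trans _ _ (\int[leb]_(x in `[0%R, X]) \int[leb]_y (F x y)%:E)%E); last first.
    apply: ge0_subset_integral => //.
    by move=> x _; apply: integral_ge0 => y _; rewrite lee_fin.
  have -> : (X * c)%:E = (\int[leb]_(x in `[0%R, X]) c%:E)%E.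
    rewrite integral_cst//.
    rewrite [Y in (_ * Y)%E](_ : _ = X%:E); last first.
      by have := lebesgue_itvcc X0; rewrite subr0.
    by rewrite -EFinM mulrC.
  apply: ge0_le_integral => //.
  - exact: measurable_funTS.
  move=> x; rewrite /= in_itv/= => xX.
  have [J12 Jt Jd] := HJ x xX.
  have mJ : measurable (`[(J x).1, (J x).2]%classic : set R) by exact: measurable_itv.
  apply: (@le_trans _ _ (\int[leb]_(y in `[(J x).1, (J x).2]) (F x y)%:E)%E); last first.
    apply: ge0_subset_integral => //; first exact: mFx.
    by move=> y _; rewrite lee_fin.
  (* A degenerate [J x] forces [delta = 0], which makes the bound trivial. *)
  have [J12'|J12'] := ltP (J x).1 (J x).2; last first.
    have Je : (J x).2 = (J x).1 by apply/eqP; rewrite eq_le J12 J12'.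
    have := Jd (J x).1; rewrite lexx J12 Je subrr !mulr0 => /(_ isT) d0.
    have -> : c = 0 by rewrite /c (_ : delta = 0) ?mul0r//; apply/eqP; rewrite eq_le d0.
    by apply: integral_ge0 => y _; rewrite lee_fin.
  have len0 : 0 < (J x).2 - (J x).1 by rewrite subr_gt0.
  have -> : c%:E = (\int[leb]_(y in `[(J x).1, (J x).2]) (c / ((J x).2 - (J x).1))%:E)%E.
    rewrite integral_cst//.
    rewrite [X in (_ * X)%E](_ : _ = ((J x).2 - (J x).1)%:E); last first.
      exact: lebesgue_itvcc.
    by rewrite -EFinM divfK// gt_eqF.
  apply: ge0_le_integral => //.
  - by move=> y _; rewrite lee_fin divr_ge0// ltW.
  - by apply: measurable_funTS; exact: mFx.
  move=> y; rewrite /= in_itv/= => yJ; rewrite lee_fin /F /c mulrAC.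
  apply: ler_pM.
  - by rewrite divr_ge0// ltW.
  - exact: sqr_ge0.
  - by rewrite ler_pdivrMr// -mulrA; exact: Jd.
  - by apply: expR_gap => //; exact: Jt.
have mIr : measurable_fun setT (fun x => \int[leb]_y (r x y)%:E)%E.
  apply: (@measurable_fun_fubini_tonelli_F _ _ _ _ _ leb (fun z : R * R => (r z.1 z.2)%:E)).
    exact/measurable_EFinP.
  by move=> z; rewrite lee_fin.
(* This is [FE] integrated: both joint densities have mass [1], the backward one by Tonelli. *)
have total : (\int[leb]_x \int[leb]_y (F x y)%:E + 2%:E * \int[leb]_x \int[leb]_y (r x y)%:E = 2%:E)%E.
  have mrx x : measurable_fun setT (fun y => (r x y)%:E).
    by apply/measurable_EFinP; exact: (measurableT_comp m_r (pair1_measurable x)).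
  have Ir0 x : (0 <= \int[leb]_y (r x y)%:E)%E by apply: integral_ge0 => y _; rewrite lee_fin.
  have IF0 x : (0 <= \int[leb]_y (F x y)%:E)%E by apply: integral_ge0 => y _; rewrite lee_fin.
  rewrite -ge0_integralZl// -ge0_integralD//; last 2 first.
  - by move=> x _; rewrite mule_ge0.
  - exact: emeasurable_funM.
  have mp x : measurable_fun setT (fun y => (p x y)%:E).
    by apply/measurable_EFinP; exact: (measurableT_comp m_p (pair1_measurable x)).
  have mp' x : measurable_fun setT (fun y => (p y x)%:E).
    by apply/measurable_EFinP; exact: (measurableT_comp m_p' (pair1_measurable x)).
  transitivity (\int[leb]_x (\int[leb]_y (p x y)%:E + \int[leb]_y (p y x)%:E))%E.
    apply: eq_integral => x _.
    have nn (u : R -> R) : (forall y, 0 <= u y) -> forall y, setT y -> (0 <= (u y)%:E)%E.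
      by move=> u0 y _; rewrite lee_fin.
    transitivity (\int[leb]_y ((p x y)%:E + (p y x)%:E))%E; last first.
      by rewrite (ge0_integralD leb measurableT (nn _ (p_ge0 x)) (mp x) (nn _ (p_ge0 ^~ x)) (mp' x)).
    transitivity (\int[leb]_y ((F x y)%:E + 2%:E * (r x y)%:E))%E; last first.
      by apply: eq_integral => y _; rewrite -EFinM -!EFinD FE.
    rewrite ge0_integralD//.
    - by rewrite (ge0_integralZl leb measurableT (mrx x) (nn _ (r0 x))).
    - exact: nn (F0 x).
    - exact: mFx.
    - by move=> y _; rewrite -EFinM lee_fin mulr_ge0.
    - by apply: emeasurable_funM => //; exact: mrx.
  rewrite ge0_integralD//.
  - by rewrite int_int_p int_int_p' -EFinD; congr EFin; lra.
  - by move=> x _; apply: integral_ge0 => y _; rewrite lee_fin.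
  - apply: (@measurable_fun_fubini_tonelli_F _ _ _ _ _ leb (fun z : R * R => (p z.1 z.2)%:E)).
      exact/measurable_EFinP.
    by move=> z; rewrite lee_fin.
  - by move=> x _; apply: integral_ge0 => y _; rewrite lee_fin.
  - apply: (@measurable_fun_fubini_tonelli_F _ _ _ _ _ leb (fun z : R * R => (p z.2 z.1)%:E)).
      exact/measurable_EFinP.
    by move=> z; rewrite lee_fin.
have I0 : (0 <= \int[leb]_x \int[leb]_y (r x y)%:E)%E.
  by apply: integral_ge0 => x _; apply: integral_ge0 => y _; rewrite lee_fin.
rewrite (_ : X * delta * (t / 4) ^+ 2 = X * c); last by rewrite /c mulrA.
exact: ereal_complement_le total lower I0.
Qed.

End affinity_gap.

(** * Affinity of the oscillating target *)

Section oscillating_target.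
Context (R : realType).
Local Notation leb := (@lebesgue_measure R).
Variables (L h : R).
Hypotheses (L0 : 0 < L) (h0 : 0 < h) (Lh : L * h <= 1 / 10000).
Local Notation a := (2 * L / 3).
Local Notation A := (L * h / 3).
Local Notation phi := (potential a A h).
Local Notation dphi := (dpotential a A h).

Let a0 : 0 < a. Proof. by rewrite divr_gt0// mulr_gt0. Qed.
Let A0 : 0 <= A. Proof. by rewrite divr_ge0// mulr_ge0// ltW. Qed.
Let A1 : A <= 1. Proof. by have := Lh; lra. Qed.

Let sg := Num.sqrt h.
Let la := Num.sqrt L.
Let sg0 : 0 < sg. Proof. by rewrite sqrtr_gt0. Qed.
Let la0 : 0 < la. Proof. by rewrite sqrtr_gt0. Qed.
Let sg2 : sg * sg = h. Proof. by rewrite -expr2 sqr_sqrtr// ltW. Qed.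
Let la2 : la * la = L. Proof. by rewrite -expr2 sqr_sqrtr// ltW. Qed.
Let z := la * sg.
Let z0 : 0 < z. Proof. by rewrite mulr_gt0. Qed.
Let z2 : z * z = L * h. Proof. by rewrite /z -la2 -sg2; ring. Qed.
Let z_le : z <= 1 / 100.
Proof.
have z0' := ltW z0.
rewrite -ler_sqr ?nnegrE// expr2 z2 (_ : (1 / 100) ^+ 2 = 1 / 10000)//.
by field.
Qed.

(** The parameters satisfy [a - A / h = L / 3] and [a + A / h = L]. *)
Lemma dpotential_slope (x y : R) : x <= y -> 0 <= dphi y - dphi x <= L * (y - x).
Proof.
move=> xy; have /andP[lo up] := dpotential_diff a h0 A0 xy.
have E1 : a - A / h = L / 3 by field; rewrite gt_eqF.
have E2 : a + A / h = L by field; rewrite gt_eqF.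
rewrite E1 in lo; rewrite E2 in up; rewrite up andbT; apply: le_trans lo.
by rewrite mulr_ge0// ?subr_ge0// divr_ge0// ltW.
Qed.

Let X := (Num.sqrt a)^-1.

Let X_le : L * X <= 5 / 4 * la.
Proof.
have X0 : 0 <= X by rewrite invr_ge0 sqrtr_ge0.
rewrite -ler_sqr ?nnegrE ?mulr_ge0 ?sqrtr_ge0//; last exact: ltW.
rewrite !exprMn /X exprVn sqr_sqrtr; last exact: ltW.
rewrite sqr_sqrtr; last exact: ltW.
rewrite (_ : L ^+ 2 * a^-1 = 3 / 2 * L); last by field; rewrite gt_eqF.
apply: ler_wpM2r; first exact: ltW.
by rewrite expr2; lra.
Qed.

Let dphi_bound x : 0 <= x <= X -> 0 <= dphi x <= 5 / 4 * la.
Proof.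
move=> /andP[x0 xX].
have /andP[] := dpotential_slope x0.
have -> : dphi 0 = 0 by rewrite /dpotential mulr0 mul0r sin0 mulr0 subr0.
rewrite !subr0 => -> H /=; apply: (le_trans H); apply: le_trans X_le.
by apply: ler_wpM2l => //; exact: ltW.
Qed.

(** The trapezoidal rule is exact on linear functions, so the quadratic part of the potential
    cancels and only the cosine contributes. *)
Let log_ratioE x y : log_ratio phi dphi h x y =
  A * trapezoid_error (x / sg) ((y - x) / sg) + h / 4 * (dphi x ^+ 2 - dphi y ^+ 2).
Proof.
rewrite /log_ratio; congr (_ + _).
rewrite /potential /dpotential /trapezoid_error -/sg.
have -> : x / sg + (y - x) / sg = y / sg by ring.
set u := sin _; set v := sin _; set u' := cos _; set v' := cos _.
by field; rewrite gt_eqF.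
Qed.

(** The trapezoidal part is at least [7 / 30 * L h]. Over a move of at most [9 sqrt h], [dphi] grows
    by at most [9 L sqrt h] from a value at most [5 / 4 * sqrt L], so the other part is [L h] times
    a quantity of order [sqrt (L h) <= 1 / 100], in total at most [6 / 100 * L h]. *)
Let log_ratio_lb x v : 0 <= x <= X -> 0 <= v <= 9 ->
  7 / 10 <= `|trapezoid_error (x / sg) v| ->
  L * h / 10 <= `|log_ratio phi dphi h x (x + sg * v)|.
Proof.
move=> xX /andP[v0 v9] T.
have -> : log_ratio phi dphi h x (x + sg * v) =
    A * trapezoid_error (x / sg) v + h / 4 * (dphi x ^+ 2 - dphi (x + sg * v) ^+ 2).
  rewrite log_ratioE; congr (A * trapezoid_error _ _ + _).
  by field; rewrite gt_eqF.
set y := x + sg * v.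
have xy : x <= y by rewrite /y lerDl mulr_ge0// ltW.
have /andP[d0 dL] := dpotential_slope xy.
have /andP[p0 pL] := dphi_bound xX.
have yx : y - x <= sg * 9 by rewrite /y addrC addKr ler_wpM2l// ltW.
have dL9 : dphi y - dphi x <= 9 * (L * sg).
  apply: (le_trans dL); rewrite (_ : 9 * (L * sg) = L * (sg * 9)); last by ring.
  by rewrite ler_wpM2l// ltW.
have H3 : `|h / 4 * (dphi x ^+ 2 - dphi y ^+ 2)| <= L * h * (6 / 100).
  rewrite (_ : _ * _ = - (h / 4 * ((dphi y - dphi x) * (dphi y - dphi x + 2 * dphi x)))); last by ring.
  rewrite normrN ger0_norm; last first.
    apply: mulr_ge0; first by rewrite divr_ge0// ltW.
    by apply: mulr_ge0 => //; lra.
  apply: (@le_trans _ _ (h / 4 * ((9 * (L * sg)) * (9 * (L * sg) + 5 / 2 * la)))).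
    apply: ler_wpM2l; first by rewrite divr_ge0// ltW.
    by apply: ler_pM => //; lra.
  rewrite (_ : _ * _ = L * h * (9 / 4 * (z * (9 * z + 5 / 2)))); last first.
    by rewrite /z -la2 -sg2; field.
  apply: ler_wpM2l; first by rewrite mulr_ge0// ltW.
  have : z * (9 * z + 5 / 2) <= 1 / 100 * (9 * (1 / 100) + 5 / 2).
    by have := ltW z0; have := z_le => H1 H2; apply: ler_pM; lra.
  lra.
have H1 : A * (7 / 10) <= `|A * trapezoid_error (x / sg) v|.
  by rewrite normrM (ger0_norm A0) ler_wpM2l.
set T1 := A * trapezoid_error _ _ in H1 *; set T2 := h / 4 * _ in H3 *.
have := ler_normB (T1 + T2) T2; rewrite addrK => H4.
have Lh0 : 0 <= L * h by rewrite mulr_ge0// ltW.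
lra.
Qed.

(** The move is at most [9 sqrt h] and the drift at most [sqrt h]; the square of their sum over
    [4 h] is at most [25]. The bound [4 pi <= 16] handles the prefactor. *)
Let q1_lb x y : 0 <= x <= X -> 0 <= y - x <= sg * 9 ->
  expR (- 25) / (4 * sg) <= q1 dphi h x y.
Proof.
move=> xX /andP[y0 y9].
have /andP[p0 pL] := dphi_bound xX.
have pi4 : (pi : R) <= 4 by have /andP[_] := pihalf_02 R; lra.
have ph0 : 0 < 4 * pi * h by rewrite !mulr_gt0// pi_gt0.
rewrite /q1 mulrC powRN div1r powR12_sqrt ?(ltW ph0)//.
apply: ler_pM => //.
- by rewrite invr_ge0 mulr_ge0// ltW.
- rewrite lef_pV2 ?posrE ?sqrtr_gt0 ?mulr_gt0 ?pi_gt0//.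
  rewrite -ler_sqr ?nnegrE ?sqrtr_ge0 ?mulr_ge0 ?(ltW sg0)//.
  rewrite sqr_sqrtr ?(ltW ph0)// exprMn expr2 (expr2 sg) sg2.
  by apply: ler_wpM2r; [exact: ltW|lra].
rewrite ler_expR mulNr lerN2 ler_pdivrMr ?mulr_gt0//.
have H : y - x + h * dphi x <= 10 * sg.
  have : h * dphi x <= sg; last by lra.
  apply: (@le_trans _ _ (h * (5 / 4 * la))); first by rewrite ler_wpM2l// ltW.
  rewrite (_ : _ * _ = sg * (5 / 4 * z)); last first.
    by rewrite /z -[X in X * _]sg2; ring.
  rewrite ler_piMr ?(ltW sg0)//; have := z_le; lra.
have H0 : 0 <= y - x + h * dphi x by rewrite addr_ge0// mulr_ge0// ltW.
apply: (@le_trans _ _ ((10 * sg) ^+ 2)); first by rewrite lerXn2r ?nnegrE ?mulr_ge0 ?(ltW sg0).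
by rewrite exprMn (expr2 sg) sg2; lra.
Qed.

(** The defect given by [affinity_le] at [X = 1 / sqrt a] and [t = L h / 10], divided by
    [(L h) ^ 2]. The scales [sqrt a] and [sqrt h] cancel, and the denominator is
    [3 * 4 * 20 * 40 ^ 2 * 2]. *)
Definition gap_const : R := expR (- (55 / 2)) / (768 * 1000).

Lemma gap_const_gt0 : 0 < gap_const.
Proof.
have k0 n : 0 < n.+1%:R :> R by rewrite ltr0n.
exact: divr_gt0 (expR_gt0 _) (mulr_gt0 (k0 767) (k0 999)).
Qed.

Variable Z : R.
Hypotheses (ZE : (\int[leb]_x (expR (- phi x))%:E = Z%:E)%E).
Hypotheses (Z_ge : expR (- A) * Num.sqrt (2 * pi / a) <= Z)
  (Z_le : Z <= expR A * Num.sqrt (2 * pi / a)).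

Lemma oscillating_affinity :
  (\int[leb]_x \int[leb]_y (r1 phi dphi h Z x y)%:E <=
    (1 - gap_const * (L * h) ^+ 2)%:E)%E.
Proof.
have Z0 : 0 < Z.
  by apply: lt_le_trans Z_ge; rewrite mulr_gt0 ?expR_gt0// sqrtr_gt0 divr_gt0// mulr_gt0// pi_gt0.
have X0 : 0 < X by rewrite invr_gt0 sqrtr_gt0.
have /choice[v0 v0P] := fun x : R => trapezoid_error_lb (x / sg).
(* The window of [trapezoid_error_lb] at [u = x / sqrt h], in units of [sqrt h]. Its position
   depends on [x], its length does not. *)
pose J x := (x + sg * v0 x, x + sg * (v0 x + 1 / 20)).
pose delta := expR (- (5 / 2)) * (Num.sqrt a / 3) * (expR (- 25) / (4 * sg) * (sg / 20)).
have Lh0 : 0 <= L * h by rewrite mulr_ge0// ltW.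
have t01 : 0 <= L * h / 10 <= 1 by have := Lh; move=> ?; apply/andP; split; lra.
have delta0 : 0 <= delta.
  by rewrite /delta !mulr_ge0 ?expR_ge0 ?invr_ge0 ?mulr_ge0 ?sqrtr_ge0.
have vJ x y : (J x).1 <= y <= (J x).2 -> exists v, [/\ y = x + sg * v,
    v0 x <= v <= v0 x + 1 / 20 & 0 <= v <= 9].
  have [v0x v8 _] := v0P x; move=> /andP[/= y1 y2].
  exists ((y - x) / sg).
  have v1 : v0 x <= (y - x) / sg by rewrite ler_pdivlMr//; lra.
  have v2 : (y - x) / sg <= v0 x + 1 / 20 by rewrite ler_pdivrMr//; lra.
  split; [by field; rewrite gt_eqF|by rewrite v1 v2|by apply/andP; split; lra].
have mphi := measurable_potential a A h0; have mdphi := measurable_dpotential a A h0.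
apply: le_trans (affinity_le mphi mdphi h0 Z0 ZE (ltW X0) t01 delta0 (J := J) _) _.
- move=> x xX; have [v0x v8 vT] := v0P x; split.
  + by rewrite /J/= lerD2l ler_wpM2l ?(ltW sg0)//; lra.
  + move=> y /vJ[v [-> vv v9]]; apply: log_ratio_lb => //; exact: vT.
  + move=> y /vJ[v [-> vv /andP[v1 v9]]]; rewrite /delta.
    have -> : (J x).2 - (J x).1 = sg / 20 by rewrite /J/=; field.
    apply: ler_pM.
    * by rewrite mulr_ge0 ?expR_ge0 ?divr_ge0 ?sqrtr_ge0.
    * by rewrite mulr_ge0 ?divr_ge0 ?expR_ge0 ?mulr_ge0 ?sqrtr_ge0.
    * exact: (w1_potential_ge h a0 A0 Z_ge Z_le A1 xX).
    * apply: ler_wpM2r; first by rewrite divr_ge0// ltW.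
      apply: q1_lb => //; rewrite addrC addKr; apply/andP; split.
        by rewrite mulr_ge0// ltW.
      by rewrite ler_wpM2l// ltW.
- rewrite lee_fin lerD2l lerN2 /gap_const /delta /X le_eqVlt; apply/orP; left; apply/eqP.
  have -> : - (55 / 2) = - (5 / 2) + (- 25) :> R by field.
  rewrite expRD; field; rewrite !gt_eqF//.
  by rewrite sqrtr_gt0.
Qed.

End oscillating_target.

(** * From the decay rate to the number of steps *)

Section mixing_count.
Context (R : realType).
Implicit Types (delta v eps K : R).

Local Notation v0 := (test_var_lb R).

Lemma test_var_lb_gt0 : 0 < v0.
Proof. by rewrite mulr_gt0 ?expR_gt0. Qed.

Lemma test_var_lb_le1 : v0 <= 1.
Proof.
have : expR (- (5 / 2)) <= 1 :> R by rewrite -[leRHS]expR0 ler_expR; lra.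
rewrite /test_var_lb; have := expR_gt0 (- (5 / 2) : R); lra.
Qed.

Lemma one_minus_ge_expR delta : 0 <= delta <= 1 / 2 -> expR (- (2 * delta)) <= 1 - delta.
Proof.
move=> /andP[d0 d1]; rewrite expRN -[leLHS]mul1r ler_pdivrMr ?expR_gt0//.
have H := expR_ge1Dx (2 * delta).
apply: (@le_trans _ _ ((1 - delta) * (1 + 2 * delta))).
  have : 0 <= delta * (1 - 2 * delta) by rewrite mulr_ge0//; lra.
  lra.
by apply: ler_wpM2l => //; lra.
Qed.

(** By [1 - delta >= exp (- 2 delta)], the logarithm is at most [2 delta (n + 1)], hence at most
    [4 delta n] once [n >= 1]. A nonpositive logarithm makes the claim trivial. *)
Lemma mixing_count delta v eps K (n : nat) : 0 < delta <= 1 / 2 -> v0 <= v -> 0 < eps ->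
  0 <= K -> 4 * K * delta <= 1 ->
  (1 - delta) ^+ n.+1 * v <= 2 * eps -> K * ln (v0 / 4 / eps) <= n%:R.
Proof.
move=> /andP[d0 d1] vv e0 K0 Kd H.
have [l0|l0] := leP (ln (v0 / 4 / eps)) 0.
  by apply: (@le_trans _ _ 0) => //; rewrite mulr_ge0_le0.
have vp := test_var_lb_gt0.
have H' : (1 - delta) ^+ n.+1 * v0 <= 2 * eps.
  by apply: le_trans H; rewrite ler_wpM2l// exprn_ge0//; lra.
have rp : 0 < v0 / 4 / eps by rewrite !divr_gt0.
(* For [n = 0], [1 - delta >= 1 / 2] gives [v0 <= 4 * eps], against the positive logarithm; this is
   the reason for [v0 / 4]. *)
case: n H' {H} => [|n] H.
  have : v0 / 4 / eps <= 1 by rewrite ler_pdivrMr// mul1r; rewrite expr1 in H; nra.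
  by move=> /ln_le0; rewrite leNgt l0.
have E : expR (- (2 * delta * n.+2%:R)) * v0 <= 2 * eps.
  apply: le_trans H; rewrite ler_wpM2r ?(ltW vp)//.
  rewrite (_ : - _ = - (2 * delta) * n.+2%:R); last by ring.
  rewrite expRM_natr lerXn2r ?nnegrE ?expR_ge0//; first lra.
  by apply: one_minus_ge_expR; rewrite (ltW d0).
have E2 : ln (v0 / 4 / eps) <= 2 * delta * n.+2%:R.
  rewrite -[leRHS]expRK ler_ln ?posrE ?expR_gt0//.
  rewrite ler_pdivrMr//.
  have e1 := expR_gt0 (2 * delta * n.+2%:R).
  rewrite expRN in E.
  have : v0 <= 2 * eps * expR (2 * delta * n.+2%:R).
    by rewrite -ler_pdivrMr// mulrC.
  have : 0 <= eps * expR (2 * delta * n.+2%:R) by rewrite mulr_ge0// ltW.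
  lra.
have n2 : n.+2%:R <= 2 * n.+1%:R :> R.
  by rewrite -natrM ler_nat mul2n -addnn addSnnS leq_addl.
apply: (@le_trans _ _ (K * (2 * delta * (2 * n.+1%:R)))).
  rewrite ler_wpM2l//; apply: (le_trans E2).
  by apply: ler_wpM2l => //; lra.
rewrite (_ : _ * _ = 4 * K * delta * n.+1%:R); last by ring.
by rewrite ler_piMl.
Qed.

End mixing_count.

(** * The step-size regimes *)

Section regimes.
Context (R : realType) (d : nat) (i0 : 'I_d).
Variables (lam : {measure set (Borel R d) -> \bar R}) (lamE : is_lebesgue lam).
Variables (L m h eps M K : R).
Hypotheses (L0 : 0 < L) (m0 : 0 < m) (Lm : 3 * m <= L) (h0 : 0 < h).
Hypotheses (eps0 : 0 < eps) (M2 : 2 <= M) (K0 : 0 <= K).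

Local Notation v0 := (test_var_lb R).
Local Notation hard f := (classA L m f /\
  ((K * ln (v0 / 4 / eps))%:E <= ereal_sup [set tau_TV lam h f eps (nu : set (Borel R d) -> \bar R)
    | nu in [set nu : probability (Borel R d) R | warm lam M f nu]])%E).

Let v0p := test_var_lb_gt0 R.
Let mL : m <= L. Proof. by have := Lm; have := m0; lra. Qed.

(** [delta] is such that [2 * (delta * v0)] is the bound [36 * (h * m)] of [gaussian_dirichlet]. *)
Lemma small_step : 18 * (h * m) / v0 <= 1 / 2 -> 4 * K * (18 * (h * m) / v0) <= 1 ->
  exists f, hard f.
Proof.
set delta := 18 * (h * m) / v0 => d1 Kd.
have hm0 : 0 < h * m by rewrite mulr_gt0.
have d0 : 0 < delta by rewrite divr_gt0// mulr_gt0.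
have hm1 : h * m <= 1.
  move: d1; rewrite /delta ler_pdivrMr// => d1.
  by have := test_var_lb_le1 R; lra.
exists (separable (potential m 0 h)).
have pD := is_derive_potential m 0 h0; have dpD := is_derive_dpotential m 0 h0.
split.
  apply: (separable_classA _ pD dpD) => x y xy.
    have /andP[+ _] := dpotential_diff m h0 (lexx 0) xy.
    by rewrite mul0r subr0.
  have /andP[_ H] := dpotential_diff m h0 (lexx 0) xy.
  apply: (le_trans H); rewrite mul0r addr0 ler_wpM2r ?subr_ge0//.
set Z := Num.sqrt (2 * pi / m).
have Z0 : 0 < Z by rewrite sqrtr_gt0 divr_gt0// mulr_gt0// pi_gt0.
have ZE := gaussian_Z m0 h0.
have Zge : expR (- 0) * Z <= Z by rewrite oppr0 expR0 mul1r.
have Zle : Z <= expR 0 * Z by rewrite expR0 mul1r.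
have [v [vE v1 vv]] := test_fun_var m0 h0 (lexx 0) ZE Zge Zle ler01.
have vp : 0 < v by apply: lt_le_trans vv.
apply: (mala_dirichlet_bound i0 lamE (measurable_potential m 0 h0)
  (measurable_dpotential m 0 h0) h0 Z0 ZE (separable_grad pD) (measurable_test_fun m)
  (test_fun_le1 m) (test_fun_mean m0 h0 ZE Zge) vE vp M2 (rho := 1 - delta)).
- lra.
- lra.
- apply: (le_trans (gaussian_dirichlet m0 h0 hm1)); rewrite lee_fin subKr.
  rewrite (_ : 36 * (h * m) = 2 * (delta * v0)).
    by rewrite ler_wpM2l// ler_wpM2l// ltW.
  by rewrite /delta; field; rewrite gt_eqF.
- by move=> n; apply: mixing_count => //; rewrite d0.
Qed.

(** Serves both regimes of larger steps. [q] is the rate at which each coordinate lowers the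
    affinity, and [E] bounds the total rate from below; [delta] is such that
    [2 * (delta * v0) = 4 * expR (- E)]. *)
Lemma affinity_step (a A q E : R) : 0 < a -> 0 <= A <= 1 ->
  m <= a - A / h -> a + A / h <= L ->
  (forall Z : R, (\int[lebesgue_measure]_x (expR (- potential a A h x))%:E = Z%:E)%E ->
   expR (- A) * Num.sqrt (2 * pi / a) <= Z -> Z <= expR A * Num.sqrt (2 * pi / a) ->
   (\int[lebesgue_measure]_x \int[lebesgue_measure]_y
     (r1 (potential a A h) (dpotential a A h) h Z x y)%:E <= (expR (- q))%:E)%E) ->
  E <= q * d%:R -> 2 * expR (- E) / v0 <= 1 / 2 -> 4 * K * (2 * expR (- E) / v0) <= 1 ->
  exists f, hard f.
Proof.
move=> a0 /andP[A0 A1] ma aL aff Eq.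
set delta := 2 * expR (- E) / v0 => d1 Kd.
have d0 : 0 < delta by rewrite divr_gt0// mulr_gt0// expR_gt0.
exists (separable (potential a A h)).
have pD := is_derive_potential a A h0; have dpD := is_derive_dpotential a A h0.
split.
  apply: (separable_classA _ pD dpD) => x y xy; have /andP[lo up] := dpotential_diff a h0 A0 xy.
    by apply: le_trans lo; rewrite ler_wpM2r ?subr_ge0.
  by apply: (le_trans up); rewrite ler_wpM2r ?subr_ge0.
have [Z [ZE Zge Zle]] := potential_Z a0 h0 A0.
have Z0 : 0 < Z.
  by apply: lt_le_trans Zge; rewrite mulr_gt0 ?expR_gt0// sqrtr_gt0 divr_gt0// mulr_gt0// pi_gt0.
have [v [vE v1 vv]] := test_fun_var a0 h0 A0 ZE Zge Zle A1.
have vp : 0 < v by apply: lt_le_trans vv.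
apply: (mala_affinity_bound i0 lamE (measurable_potential a A h0)
  (measurable_dpotential a A h0) h0 Z0 ZE (separable_grad pD) (measurable_test_fun a)
  (test_fun_le1 a) (test_fun_mean a0 h0 ZE Zge) vE vp M2 (rho := 1 - delta)
  _ _ (aff Z ZE Zge Zle)).
- lra.
- lra.
- rewrite subKr -expRM_natr.
  apply: (@le_trans _ _ (4 * expR (- E))).
    by rewrite ler_wpM2l// ler_expR mulNr lerN2.
  rewrite (_ : 4 * expR (- E) = 2 * (delta * v0)).
    by rewrite ler_wpM2l// ler_wpM2l// ltW.
  by rewrite /delta; field; rewrite gt_eqF.
- by move=> n; apply: mixing_count => //; rewrite d0.
Qed.

End regimes.

(** * Matching the parameters in high dimension *)

Section dimension.
Context (R : realType).

Lemma sqrt_natE (d : nat) : (0 < d)%N -> Num.sqrt d%:R = expR (ln d%:R / 2) :> R.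
Proof.
move=> d0; have dp : 0 < d%:R :> R by rewrite ltr0n.
apply/eqP; rewrite -(@eqrXn2 _ 2) ?sqrtr_ge0 ?expR_ge0// sqr_sqrtr ?(ltW dp)//.
by rewrite -expRM_natl mulrC divfK// lnK.
Qed.

(** The polynomial bound on [k] makes [lam] at most a multiple of [ln d], and
    [sqrt d = exp (ln d / 2)] outgrows the cube of [ln d]. *)
Lemma dimension_threshold (alpha beta e l0 : R) : 0 < alpha -> 0 < beta -> 0 < e ->
  exists N : nat, (0 < N)%N /\ forall d : nat, (N < d)%N ->
    forall k : R, 3 <= k -> k <= alpha * powR d%:R beta ->
    let lam := Num.max (ln k) (ln d%:R) in
    [/\ l0 <= lam, 1 <= lam & lam ^+ 3 <= e * Num.sqrt d%:R].
Proof.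
move=> al0 be0 e0.
pose C := `|ln alpha| + beta + 1.
have C1 : 1 <= C by rewrite /C; have := normr_ge0 (ln alpha); lra.
(* With [l = ln d], [exp (l / 2) >= (l / 8) ^ 4] and [8 ^ 4 = 4096]; from this threshold on,
   [e * (l / 8) ^ 4 >= (C * l) ^ 3]. *)
pose l1 := Num.max 1 (Num.max l0 (4096 * C ^+ 3 / e)).
exists (Num.truncn (expR l1)).+1; split => // d Nd k k3 kd lam.
have d0 : (0 < d)%N by apply: leq_trans Nd.
have dp : 0 < d%:R :> R by rewrite ltr0n.
have dl1 : l1 <= ln d%:R.
  rewrite -[leLHS]expRK ler_ln ?posrE ?expR_gt0//.
  apply: (le_trans (ltW (truncnS_gt _))).
  by rewrite ler_nat ltnW.
have [l_1 l_0 l_e] : [/\ 1 <= ln (d%:R : R), l0 <= ln d%:R & 4096 * C ^+ 3 / e <= ln d%:R].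
  by move: dl1; rewrite /l1 !ge_max => /andP[? /andP[? ?]].
set l : R := ln d%:R in l_1 l_0 l_e lam *.
have llam : l <= lam by rewrite /lam le_max lexx orbT.
have lamC : lam <= C * l.
  rewrite /lam ge_max; apply/andP; split.
    have kp : 0 < k by lra.
    apply: (@le_trans _ _ (ln (alpha * powR d%:R beta))).
      by rewrite ler_ln// posrE mulr_gt0// powR_gt0.
    rewrite lnM ?posrE ?powR_gt0// ln_powR -/l /C.
    have : `|ln alpha| <= `|ln alpha| * l by rewrite ler_peMr.
    have := ler_norm (ln alpha).
    by rewrite !mulrDl; lra.
  by rewrite ler_peMl//; lra.
split; [lra|lra|].
have lam0 : 0 <= lam by lra.
apply: (@le_trans _ _ ((C * l) ^+ 3)); first by rewrite lerXn2r ?nnegrE//; lra.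
rewrite sqrt_natE// -/l.
have E8 : (l / 8) ^+ 4 <= expR (l / 2).
  have l80 : 0 <= l / 8 by lra.
  rewrite (_ : l / 2 = l / 8 * 4%:R); last by field.
  rewrite expRM_natr lerXn2r ?nnegrE ?expR_ge0//.
  have := expR_ge1Dx (l / 8); lra.
apply: (@le_trans _ _ (e * (l / 8) ^+ 4)); last by rewrite ler_wpM2l// ltW.
rewrite (_ : e * (l / 8) ^+ 4 = (e * l / 4096) * l ^+ 3); last by field.
rewrite exprMn; apply: ler_wpM2r; first by rewrite exprn_ge0//; lra.
rewrite ler_pdivlMr; last lra.
by move: l_e; rewrite ler_pdivrMr// => H; lra.
Qed.

(** Used with [x = h * m], [s = sqrt d] and [l = La ^ 3]. The factor [v / 72] of the count is
    [v / (4 * 18)]: it cancels the [4] of [mixing_count] and the [18 / v] of [delta]. *)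
Lemma small_defect (v k s l x : R) : 0 < v -> 0 < s -> 0 < l -> 1 <= k ->
  l <= v / 36 * s -> x * (k * s) <= l ->
  let delta := 18 * x / v in delta <= 1 / 2 /\ 4 * (v / 72 * k * s / l) * delta <= 1.
Proof.
move=> v0 s0 l0 k1 ls xl /=; split; last first.
  rewrite (_ : _ * _ = x * (k * s) / l); first by rewrite ler_pdivrMr// mul1r.
  by field; rewrite !gt_eqF.
rewrite ler_pdivrMr// mulrAC ler_pdivlMr// -subr_ge0.
have [x0|x0] := leP x 0; first lra.
have xs : x * s <= x * (k * s) by rewrite ler_pM2l// ler_peMl// ltW.
have : x * s <= v / 36 * s := le_trans xs (le_trans xl ls).
by rewrite ler_pM2r//; lra.
Qed.

(** Squaring the last hypothesis gives [g * x ^ 2 * y >= g * l ^ 6 >= (g * l) * l], and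
    [g * l >= 3 / 2]. *)
Lemma gap_large (g l x y : R) : 0 < g -> 1 <= l -> 3 / 2 / g <= l -> 0 <= y ->
  l ^+ 3 <= x * Num.sqrt y -> 3 / 2 * l <= g * x ^+ 2 * y.
Proof.
move=> g0 l1 gl y0 H.
have l0 : 0 <= l := le_trans ler01 l1.
have l3 : l <= l ^+ 3 by rewrite ler_eXnr.
apply: (@le_trans _ _ (g * (l ^+ 3) ^+ 2)); last first.
  rewrite -mulrA -[X in _ * (_ * X)](sqr_sqrtr y0) -exprMn; apply: ler_wpM2l.
    exact: ltW.
  by rewrite lerXn2r// nnegrE ?exprn_ge0// (le_trans _ H)// exprn_ge0.
apply: (@le_trans _ _ (g * l * l)).
  by apply: ler_wpM2r => //; rewrite [leRHS]mulrC -ler_pdivrMr.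
rewrite -mulrA; apply: ler_wpM2l; first exact: ltW.
by rewrite [leRHS]expr2; apply: ler_pM.
Qed.

Lemma linear_large (eta l : R) (d : nat) : 0 < eta -> (0 < d)%N -> 1 <= l ->
  l ^+ 3 <= 2 * eta / 3 * Num.sqrt d%:R -> 3 / 2 * l <= eta * d%:R.
Proof.
move=> eta0 d0 l1 H.
have l3 : l <= l ^+ 3 by rewrite ler_eXnr.
have sd1 : 1 <= Num.sqrt d%:R :> R by rewrite -[leLHS]sqrtr1 ler_sqrt ?ler1n.
have sd : Num.sqrt d%:R <= d%:R :> R.
  by rewrite -[leRHS](sqr_sqrtr (ler0n _ d)) expr2 ler_peMl// sqrtr_ge0.
have : eta * Num.sqrt d%:R <= eta * d%:R by rewrite ler_wpM2l// ltW.
lra.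
Qed.

(** The exponentials in [K] and [delta] cancel, leaving [4 * 2 / 72 = 1 / 9]. The bound
    [delta <= 1 / 2] follows from [exp (3 / 2 * La) >= La >= 4 / v]. *)
Lemma exp_defect_small (v La K : R) : 0 < v -> 4 / v <= La -> K <= v / 72 * expR (3 / 2 * La) ->
  let delta := 2 * expR (- (3 / 2 * La)) / v in delta <= 1 / 2 /\ 4 * K * delta <= 1.
Proof.
move=> v0 vLa HK /=; set E := 3 / 2 * La in HK *; split.
  rewrite ler_pdivrMr//.
  have : expR (- E) <= v / 4.
    rewrite expRN -[v / 4]invrK lef_pV2 ?posrE ?expR_gt0 ?invr_gt0 ?divr_gt0//.
    rewrite invf_div; apply: (le_trans vLa).
    have : 0 < La by apply: lt_le_trans vLa; rewrite divr_gt0.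
    by have := expR_ge1Dx E; rewrite /E; lra.
  lra.
apply: (@le_trans _ _ (4 * (v / 72 * expR E) * (2 * expR (- E) / v))).
  by rewrite ler_wpM2r ?ler_wpM2l// divr_ge0 ?(ltW v0)// mulr_ge0// expR_ge0.
rewrite (_ : _ * _ = 1 / 9 * (expR E * expR (- E))); last first.
  by field; rewrite gt_eqF.
rewrite -expRD subrr expR0; lra.
Qed.

End dimension.

(** The affinity decreases in [h * a], so its value at [c] bounds it; the exponential form prepares
    the [d]-th power. *)
Lemma gaussian_affinity_gap (R : realType) (a h c : R) : 0 < a -> 0 < h -> 0 < c -> c <= h * a ->
  (\int[lebesgue_measure]_x \int[lebesgue_measure]_y
     (r1 (potential a 0 h) (dpotential a 0 h) h (Num.sqrt (2 * pi / a)) x y)%:E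
   <= (expR (- (ln (1 + c ^+ 3 / 8) / 2)))%:E)%E.
Proof.
move=> a0 h0 c0 ca.
have c30 : 0 < c ^+ 3 by rewrite exprn_gt0.
rewrite gaussian_affinity// lee_fin.
rewrite -ler_sqr ?nnegrE ?sqrtr_ge0 ?expR_ge0// sqr_sqrtr; last first.
  by rewrite divr_ge0// addr_ge0// exprn_ge0// mulr_ge0// ltW.
rewrite -expRM_natl mulrN [2%:R * _]mulrC divfK// expRN lnK; last by rewrite posrE addr_gt0// divr_gt0.
have hc3 : c ^+ 3 <= (h * a) ^+ 3 by rewrite lerXn2r ?nnegrE ?(ltW c0) ?mulr_ge0 ?(ltW h0) ?(ltW a0)//.
rewrite -[leLHS]invrK lef_pV2 ?posrE ?invr_gt0 ?divr_gt0//; [|lra|lra].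
by rewrite invf_div; lra.
Qed.

(** * Choice of the target according to the step size *)

Theorem theorem2 (R : realType) :
  exists c3 c4 : R, 0 < c3 /\ 0 < c4 /\
  forall alpha beta : R, 0 < alpha -> 0 < beta ->
  exists N : nat, (0 < N)%N /\
  forall d : nat, (N < d)%N ->
  forall lam : {measure set (Borel R d) -> \bar R}, is_lebesgue lam ->
  forall L m : R, 0 < L -> 0 < m ->
  3 <= L / m -> L / m <= alpha * powR (d%:R) beta ->
  forall M : R, 12 <= M ->
  forall eps : R, 0 < eps -> eps < 1 ->
  ((c3 * (L / m) * Num.sqrt (d%:R) / (Num.max (ln (L / m)) (ln (d%:R))) ^+ 3
     * ln (c4 / eps))%:E
   <= minimax_mixing lam L m eps M)%E.
Proof.
pose v0 := test_var_lb R; have v0p : 0 < v0 := test_var_lb_gt0 R.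
have v01 : v0 <= 1 := test_var_lb_le1 R.
pose g0 := gap_const R; have g0p : 0 < g0 := gap_const_gt0 R.
have [c1 c1p c1E] : exists2 c : R, 0 < c & c = 1 / 10000.
  by exists (1 / 10000) => [|//]; lra.
have [eta etap etaE] : exists2 eta : R, 0 < eta & eta = ln (1 + c1 ^+ 3 / 8) / 2.
  exists (ln (1 + c1 ^+ 3 / 8) / 2) => [|//].
  by rewrite divr_gt0// ln_gt0// ltrDl divr_gt0// exprn_gt0.
exists (v0 / 72), (v0 / 4); split; first by rewrite divr_gt0.
split; first by rewrite divr_gt0.
move=> alpha beta al0 be0.
(* The first bound is used for small steps in [small_defect], the second for large ones in
   [linear_large]. *)
pose e := Num.min (v0 / 36) (2 * eta / 3).
have e0 : 0 < e by rewrite lt_min !divr_gt0// mulr_gt0.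
have [N [N0 HN]] := dimension_threshold (Num.max (3 / 2 / g0) (4 / v0)) al0 be0 e0.
exists N; split => // d Nd lam lamE L m L0 m0 k3 kd M M12 eps eps0 _.
set k := L / m in k3 kd *.
have k1 : 1 <= k by apply: le_trans k3; rewrite ler1n.
have kp : 0 < k := lt_le_trans ltr01 k1.
have d0 : (0 < d)%N by apply: leq_trans Nd.
have dp : 0 < d%:R :> R by rewrite ltr0n.
have [] := HN d Nd k k3 kd; rewrite /=.
have : ln k <= Num.max (ln k) (ln d%:R) by rewrite le_max lexx.
have : ln d%:R <= Num.max (ln k) (ln d%:R) by rewrite le_max lexx orbT.
move: (Num.max (ln k) _) => La dLa kLa.
rewrite ge_max => /andP[Lag Lav] La1; rewrite /e => Lae.
have sd0 : 0 < Num.sqrt d%:R :> R by rewrite sqrtr_gt0.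
have La0 : 0 < La := lt_le_trans ltr01 La1.
have La30 : 0 < La ^+ 3 by rewrite exprn_gt0.
have La_le3 : La <= La ^+ 3 by rewrite ler_eXnr//.
have La31 : 1 <= La ^+ 3 := le_trans La1 La_le3.
have Lae1 : La ^+ 3 <= v0 / 36 * Num.sqrt d%:R.
  by apply: (le_trans Lae); rewrite ler_wpM2r ?(ltW sd0)// ge_min lexx.
have Lae2 : La ^+ 3 <= 2 * eta / 3 * Num.sqrt d%:R.
  by apply: (le_trans Lae); rewrite ler_wpM2r ?(ltW sd0)// ge_min lexx orbT.
pose K := v0 / 72 * k * Num.sqrt d%:R / La ^+ 3.
have K0 : 0 <= K.
  by rewrite /K divr_ge0 ?(ltW La30)// mulr_ge0 ?(ltW sd0)// mulr_ge0 ?(ltW kp)// divr_ge0// ltW.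
(* [k <= exp La] and [sqrt d <= exp (La / 2)], since [La] dominates both logarithms, and the
   denominator [La ^ 3] is at least [1]. *)
have Kexp : K <= v0 / 72 * expR (3 / 2 * La).
  rewrite /K ler_pdivrMr//.
  apply: (@le_trans _ _ (v0 / 72 * expR (3 / 2 * La) * 1)); last first.
    by rewrite ler_wpM2l// mulr_ge0 ?expR_ge0// divr_ge0// ltW.
  rewrite mulr1 -mulrA; apply: ler_wpM2l; first by rewrite divr_ge0// ltW.
  rewrite (_ : 3 / 2 * La = La + La / 2); last by field.
  rewrite expRD; apply: ler_pM.
  - exact: ltW.
  - exact: ltW.
  - by rewrite -[leLHS]lnK ?posrE// ler_expR.
  - by rewrite sqrt_natE// ler_expR ler_pM2r ?invr_gt0.
have Lm : 3 * m <= L by rewrite -ler_pdivlMr.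
have [d1 Kd] := exp_defect_small v0p Lav Kexp.
rewrite /minimax_mixing -/K; apply: le_ereal_inf_tmp => _ [h /= h0 <-].
suff [f [fA fK]] : exists f, classA L m f /\
  ((K * ln (v0 / 4 / eps))%:E <= ereal_sup [set tau_TV lam h f eps (nu : set (Borel R d) -> \bar R)
    | nu in [set nu : probability (Borel R d) R | warm lam M f nu]])%E.
  by apply: (le_trans fK); apply: ereal_sup_ubound; exists f.
have Lm3 : m <= L / 3 by rewrite ler_pdivlMr// mulrC.
have M2 : 2 <= M by apply: le_trans M12; rewrite ler_nat.
pose i0 : 'I_d := Ordinal d0.
have Lh0 : 0 < L * h by rewrite mulr_gt0.
have hmk : h * m * k = L * h by rewrite /k; field; rewrite gt_eqF.
have [hsmall|hbig] := leP (L * h) (La ^+ 3 / Num.sqrt d%:R).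
  have hm : h * m <= La ^+ 3 / (k * Num.sqrt d%:R).
    rewrite invfM [k^-1 * _]mulrC mulrA ler_pdivlMr//.
    by rewrite hmk.
  have hm' : h * m * (k * Num.sqrt d%:R) <= La ^+ 3 by rewrite -ler_pdivlMr// mulr_gt0.
  have [small1 small2] := small_defect v0p sd0 La30 k1 Lae1 hm'.
  apply: (small_step i0 lamE m0 Lm h0 eps0 M2 K0).
  - exact: small1.
  - exact: small2.
have [hc|hc] := leP (L * h) c1.
  have hc' := hc; rewrite c1E in hc'.
  have q0 : 3 / 2 * La <= g0 * (L * h) ^+ 2 * d%:R.
    apply: (gap_large g0p La1 Lag (ltW dp)).
    by rewrite -ler_pdivrMr// ltW.
  apply: (affinity_step i0 lamE h0 eps0 M2 K0 (a := 2 * L / 3) (A := L * h / 3)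
    (q := g0 * (L * h) ^+ 2) (E := 3 / 2 * La)) => //.
  - by rewrite divr_gt0// mulr_gt0.
  - by apply/andP; split; [rewrite divr_ge0// ltW|clear -hc'; lra].
  (* The smallest curvature is [2 L / 3 - L / 3 = L / 3], at least [m] because [kappa >= 3]. *)
  - rewrite (_ : L * h / 3 / h = L / 3); last by field; rewrite gt_eqF.
    by clear -Lm3; lra.
  - rewrite (_ : L * h / 3 / h = L / 3); last by field; rewrite gt_eqF.
    by clear -L0; lra.
  - move=> Z ZE Zge Zle.
    apply: (le_trans (oscillating_affinity L0 h0 hc' ZE Zge Zle)).
    (* [1 - q <= exp (- q)] turns the defect of one coordinate into a rate that adds up over [d]. *)
    by rewrite lee_fin -/g0; apply: le_trans (expR_ge1Dx _).
have qd := linear_large etap d0 La1 Lae2.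
apply: (affinity_step i0 lamE h0 eps0 M2 K0 (a := L) (A := 0)
    (q := eta) (E := 3 / 2 * La)) => //.
- by rewrite lexx ler01.
- by rewrite mul0r subr0 (le_trans _ Lm)// ler_peMl ?ler1n// ltW.
- by rewrite mul0r addr0.
- move=> Z ZE; rewrite oppr0 expR0 mul1r => Zge Zle.
  have -> : Z = Num.sqrt (2 * pi / L) by apply/eqP; rewrite eq_le Zge Zle.
  by rewrite etaE; apply: gaussian_affinity_gap => //; rewrite mulrC ltW.
Qed.
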